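(* Let $c=(c_1,c_2)$ be a constant in $\mathbb{C}^2$. There is no pair $(f_1,f_2)$ of transcendental entire functions on $\mathbb{C}^2$ with finite order satisfying, for all $z=(z_1,z_2)\in\mathbb{C}^2$, the system of Fermat-type difference equations $$\begin{cases} f_1(z_1,z_2)^2+(\Delta_c f_2(z_1,z_2))^2=1,\\ f_2(z_1,z_2)^2+(\Delta_c f_1(z_1,z_2))^2=1.\end{cases}$$
   Context: For a function $f$ on $\mathbb{C}^2$ and $c=(c_1,c_2)\in\mathbb{C}^2$, $\Delta_c f(z_1,z_2)=f(z_1+c_1,z_2+c_2)-f(z_1,z_2)$. An entire function on $\mathbb{C}^2$ is transcendental if it is not a polynomial. A pair $(f_1,f_2)$ of transcendental entire functions with finite order means that each of $f_1$ and $f_2$ is a transcendental entire function on $\mathbb{C}^2$ of finite order; the order of an entire function $f$ is $\limsup_{r\to\infty}\frac{\log^+ T(r,f)}{\log r}$ with $T(r,f)$ the Nevanlinna characteristic (equivalently $\limsup_{r\to\infty}\frac{\log^+\log^+ M(r,f)}{\log r}$ with $M(r,f)=\max_{\|z\|\le r}|f(z)|$). *)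

(* Defs.v *)
From Stdlib Require Export Reals.
From Coquelicot Require Export Coquelicot.

Open Scope R_scope.

Definition C2 : NormedModule C_AbsRing :=
  prod_NormedModule C_AbsRing C_NormedModule C_NormedModule.

(* Fréchet differentiability over the field C, with respect to both variables
   jointly: the differential is required to be C-linear. *)
Definition entire (f : C * C -> C) : Prop :=
  forall z : C * C,
    @ex_filterdiff C_AbsRing C2 C_NormedModule f (@locally C2 z).

Definition polynomial_function (f : C * C -> C) : Prop :=
  exists (n : nat) (a : nat -> nat -> C), forall z1 z2 : C,
    f (z1, z2) =
    sum_n (fun i => sum_n (fun j => (a i j * z1 ^ i * z2 ^ j)%C) n) n.

Definition transcendental_entire (f : C * C -> C) : Prop :=
  entire f /\ ~ polynomial_function f.

Definition norm_C2 (z : C * C) : R := sqrt (Cmod (fst z) ^ 2 + Cmod (snd z) ^ 2).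

(* For r >= 0 and f continuous the supremum is a finite maximum. *)
Definition max_modulus (f : C * C -> C) (r : R) : R :=
  real (Lub_Rbar (fun x : R =>
    exists z : C * C, norm_C2 z <= r /\ x = Cmod (f z))).

(* Stdlib's [ln] vanishes on nonpositive reals, so [log_plus 0 = 0]. *)
Definition log_plus (x : R) : R := Rmax 0 (ln x).

Definition LimSup_p_infty (g : R -> R) : Rbar :=
  Rbar_glb (fun s : Rbar => exists r0 : R,
    s = Lub_Rbar (fun y : R => exists r : R, r0 < r /\ y = g r)).

Definition order (f : C * C -> C) : Rbar :=
  LimSup_p_infty (fun r => log_plus (log_plus (max_modulus f r)) / ln r).

Definition finite_order (f : C * C -> C) : Prop := Rbar_lt (order f) p_infty.

Definition Delta (c : C * C) (f : C * C -> C) (z : C * C) : C :=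
  (f (fst z + fst c, snd z + snd c) - f z)%C.

(* Main.v *)
Require Import Defs.
From Stdlib Require Import Lra Lia Psatz Classical IndefiniteDescription ClassicalEpsilon List.

(** Restrict the system to a complex line [t |-> w + t c]. The restrictions [F1] and [F2]
    are entire functions of one variable with growth at most the exponential of a polynomial in
    [|t|], and they satisfy the same system with the difference operator of step 1. It
    suffices to show that [F1 ^ 2 = 1] for all such solutions ([fermat_system_line]): then
    [f1 ^ 2 = 1] on all of C^2, so that [f1] is constant, hence a polynomial.

    In one variable, [F1 ^ 2 + (F2(t + 1) - F2(t)) ^ 2 = 1] factors as a product of two
    functions equal to 1, so [F1 + i (F2(t + 1) - F2(t))] has no zeros. It is the exponential
    of an entire function ([entire_logarithm]) whose real part has polynomial growth, and
    such a function is a polynomial ([re_polynomial_growth]). Hence [F1] is the hyperbolic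
    cosine of a polynomial [L1], and likewise [F2] of a polynomial [L2]; each of the two
    differences is a multiple of the hyperbolic sine of the other polynomial. Each equation
    is now a vanishing sum of six exponentials of polynomials. By Borel's lemma
    ([exp_independence]) the exponents of such a sum match up modulo constants. If [L1] and
    [L2] are nonconstant, this forces [L1(t + 1) - L1(t)] to be constant and [L2] to be
    [L1] or [- L1] up to a constant; comparing coefficients then leads to contradictory
    equations for the constants ([exponential_system]). So [L1] or [L2] is constant, which
    gives [F1 ^ 2 = 1].

    The tools from complex analysis are developed from Goursat's theorem on. It is proved
    for triangles and in a form that tolerates one exceptional point, because it is applied
    to difference quotients: their primitives yield the mean value property and Cauchy's
    formula on circles, from which everything else follows. *)

Arguments Re : simpl never.
Arguments Im : simpl never.
Arguments Cplus : simpl never.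
Arguments Cmult : simpl never.
Arguments Copp : simpl never.
Arguments Cminus : simpl never.
Arguments Cinv : simpl never.
Arguments RtoC : simpl never.
Arguments Cmod : simpl never.

(** * Complex differentiation and continuity *)

(** The codomain is [C] as an absolute ring: with this structure the product and chain
    rules of the library apply, and [Cder_eps] gives access to plain estimates. The same
    choice is made for continuity below. *)
Definition Cder (f : C -> C) (z l : C) : Prop :=
  @is_derive C_AbsRing (AbsRing_NormedModule C_AbsRing) f z l.

Definition Ccont (f : C -> C) (z : C) : Prop :=
  @continuous (AbsRing_UniformSpace C_AbsRing) (AbsRing_UniformSpace C_AbsRing) f z.

Definition Rcont (g : R -> C) (t : R) : Prop :=
  @continuous R_UniformSpace (AbsRing_UniformSpace C_AbsRing) g t.

Lemma Cder_eps (f : C -> C) (z l : C) :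
  Cder f z l <-> forall eps : posreal, exists d : posreal, forall y : C,
    Cmod (y - z)%C < d -> Cmod (f y - f z - l * (y - z))%C <= eps * Cmod (y - z)%C.
Proof.
split.
- intros [_ H] eps.
  assert (Hz : @is_filter_lim (AbsRing_UniformSpace C_AbsRing) (@locally (AbsRing_UniformSpace C_AbsRing) z) z) by (intros P HP; exact HP).
  destruct (H z Hz eps) as [d Hd].
  exists d. intros y Hy. specialize (Hd y Hy).
  replace (f y - f z - l * (y - z))%C with (f y - f z - (y - z) * l)%C by ring.
  exact Hd.
- intros H. split; [apply is_linear_scal_l|].
  intros x Hx eps.
  assert (E : z = x) by exact (is_filter_lim_locally_unique (V:=AbsRing_NormedModule C_AbsRing) z x Hx).
  subst x.
  destruct (H eps) as [d Hd]. exists d. intros y Hy.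
  specialize (Hd y Hy).
  replace (f y - f z - l * (y - z))%C with (f y - f z - (y - z) * l)%C in Hd by ring.
  exact Hd.
Qed.

Lemma Ccont_eps (f : C -> C) (z : C) :
  Ccont f z <-> forall eps : posreal, exists d : posreal, forall y : C,
    Cmod (y - z)%C < d -> Cmod (f y - f z)%C < eps.
Proof.
split.
- intros H eps.
  destruct (H (fun u => Cmod (u - f z)%C < eps)) as [d Hd].
  { exists eps. intros y Hy. exact Hy. }
  exists d. intros y Hy. exact (Hd y Hy).
- intros H P [eps HP]. destruct (H eps) as [d Hd].
  exists d. intros y Hy. apply HP. exact (Hd y Hy).
Qed.

Lemma Rcont_eps (g : R -> C) (t : R) :
  Rcont g t <-> forall eps : posreal, exists d : posreal, forall y : R,
    Rabs (y - t) < d -> Cmod (g y - g t)%C < eps.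
Proof.
split.
- intros H eps.
  destruct (H (fun u => Cmod (u - g t)%C < eps)) as [d Hd].
  { exists eps. intros y Hy. exact Hy. }
  exists d. intros y Hy. exact (Hd y Hy).
- intros H P [eps HP]. destruct (H eps) as [d Hd].
  exists d. intros y Hy. apply HP. exact (Hd y Hy).
Qed.

Lemma Cder_Ccont (f : C -> C) (z l : C) : Cder f z l -> Ccont f z.
Proof.
intros H. apply (ex_derive_continuous (K:=C_AbsRing) (V:=AbsRing_NormedModule C_AbsRing)).
exists l; exact H.
Qed.

Lemma Cder_const (a z : C) : Cder (fun _ => a) z 0%C.
Proof. exact (is_derive_const (K:=C_AbsRing) (V:=AbsRing_NormedModule C_AbsRing) a z). Qed.

Lemma Cder_id (z : C) : Cder (fun u => u) z 1%C.
Proof. exact (is_derive_id (K:=C_AbsRing) z). Qed.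

Lemma Cder_plus (f g : C -> C) (z a b : C) :
  Cder f z a -> Cder g z b -> Cder (fun u => f u + g u)%C z (a + b)%C.
Proof. exact (is_derive_plus (K:=C_AbsRing) (V:=AbsRing_NormedModule C_AbsRing) f g z a b). Qed.

Lemma Cder_mult (f g : C -> C) (z a b : C) :
  Cder f z a -> Cder g z b -> Cder (fun u => f u * g u)%C z (a * g z + f z * b)%C.
Proof.
intros Hf Hg.
exact (is_derive_mult (K:=C_AbsRing) f g z a b Hf Hg Cmult_comm).
Qed.

Lemma Cder_comp (f g : C -> C) (z a b : C) :
  Cder f (g z) a -> Cder g z b -> Cder (fun u => f (g u)) z (a * b)%C.
Proof.
intros Hf Hg. rewrite Cmult_comm.
exact (is_derive_comp (K:=C_AbsRing) (V:=AbsRing_NormedModule C_AbsRing) f g z a b Hf Hg).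
Qed.

Lemma Cder_ext (f g : C -> C) (z a b : C) :
  (forall u, f u = g u) -> a = b -> Cder f z a -> Cder g z b.
Proof.
intros H <-. exact (is_derive_ext (K:=C_AbsRing) (V:=AbsRing_NormedModule C_AbsRing) f g z a H).
Qed.

Lemma Cder_scal (f : C -> C) (c z a : C) :
  Cder f z a -> Cder (fun u => c * f u)%C z (c * a)%C.
Proof.
intros H. eapply Cder_ext; [| |exact (Cder_mult (fun _ => c) f z _ _ (Cder_const c z) H)].
- reflexivity.
- cbv beta; ring.
Qed.

Lemma Cder_opp (f : C -> C) (z a : C) :
  Cder f z a -> Cder (fun u => - f u)%C z (- a)%C.
Proof.
intros H. eapply Cder_ext; [| |exact (Cder_scal f (-(1))%C z _ H)].
- intros u; simpl; ring.
- ring.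
Qed.

Lemma Cder_minus (f g : C -> C) (z a b : C) :
  Cder f z a -> Cder g z b -> Cder (fun u => f u - g u)%C z (a - b)%C.
Proof. intros Hf Hg. exact (Cder_plus _ _ _ _ _ Hf (Cder_opp _ _ _ Hg)). Qed.

Lemma Cder_ext_near (f g : C -> C) (z a : C) (r : R) :
  0 < r -> (forall u, Cmod (u - z)%C < r -> f u = g u) -> Cder f z a -> Cder g z a.
Proof.
intros Hr H Hf. apply Cder_eps. intros eps.
destruct (proj1 (Cder_eps _ _ _) Hf eps) as [d Hd].
assert (Hm : 0 < Rmin d r) by (apply Rmin_glb_lt; [apply cond_pos|exact Hr]).
exists (mkposreal _ Hm). simpl. intros y Hy.
rewrite <- !H.
- apply Hd. eapply Rlt_le_trans; [exact Hy|apply Rmin_l].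
- replace (z - z)%C with (RtoC 0) by ring. rewrite Cmod_0. exact Hr.
- eapply Rlt_le_trans; [exact Hy|apply Rmin_r].
Qed.

Lemma Cder_unique (f : C -> C) (z a b : C) : Cder f z a -> Cder f z b -> a = b.
Proof.
intros Ha Hb.
apply NNPP; intros Hn.
assert (Hp : 0 < Cmod (a - b)%C).
{ apply Cmod_gt_0. intros E. apply Hn. apply Ceq_minus; exact E. }
assert (He : 0 < Cmod (a - b)%C / 4) by lra.
destruct (proj1 (Cder_eps _ _ _) Ha (mkposreal _ He)) as [d1 H1].
destruct (proj1 (Cder_eps _ _ _) Hb (mkposreal _ He)) as [d2 H2].
simpl in *.
set (h := Rmin d1 d2 / 2).
assert (Hh : 0 < h) by (unfold h; apply Rdiv_lt_0_compat; [apply Rmin_glb_lt; apply cond_pos|lra]).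
assert (h < d1 /\ h < d2) as [K1 K2].
{ unfold h. pose proof (Rmin_l d1 d2). pose proof (Rmin_r d1 d2). unfold h in Hh. lra. }
assert (E : Cmod ((z + h) - z)%C = h).
{ replace (z + h - z)%C with (RtoC h) by ring. rewrite Cmod_R. apply Rabs_pos_eq; lra. }
specialize (H1 (z + h)%C). specialize (H2 (z + h)%C). rewrite E in H1, H2.
specialize (H1 K1). specialize (H2 K2).
assert (Cmod ((a - b) * h)%C <= Cmod (a - b)%C / 2 * h).
{ replace ((a - b) * h)%C with
   ((f (z + h) - f z - b * (z + h - z)) + - (f (z + h) - f z - a * (z + h - z)))%C by ring.
  eapply Rle_trans; [apply Cmod_triangle|]. rewrite Cmod_opp. lra. }
rewrite Cmod_mult, Cmod_R, (Rabs_pos_eq h) in H by lra.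
nra.
Qed.

Lemma Cder_pow (n : nat) (z : C) : Cder (fun u => u ^ S n)%C z (INR (S n) * z ^ n)%C.
Proof.
induction n as [|n IH].
- eapply Cder_ext; [| |exact (Cder_id z)].
  + intros u; simpl; ring.
  + simpl; ring.
- eapply Cder_ext; [| |exact (Cder_mult _ _ z _ _ (Cder_id z) IH)].
  + intros u; reflexivity.
  + rewrite (S_INR (S n)), RtoC_plus. rewrite !Cpow_S. ring.
Qed.

Lemma Ccont_const (a z : C) : Ccont (fun _ => a) z.
Proof. exact (Cder_Ccont _ _ _ (Cder_const a z)). Qed.

Lemma Ccont_id (z : C) : Ccont (fun u => u) z.
Proof. exact (Cder_Ccont _ _ _ (Cder_id z)). Qed.

Lemma Ccont_plus (f g : C -> C) (z : C) :
  Ccont f z -> Ccont g z -> Ccont (fun u => f u + g u)%C z.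
Proof. exact (continuous_plus (U := AbsRing_UniformSpace C_AbsRing) (V := AbsRing_NormedModule C_AbsRing) f g z). Qed.

Lemma Ccont_mult (f g : C -> C) (z : C) :
  Ccont f z -> Ccont g z -> Ccont (fun u => f u * g u)%C z.
Proof. exact (continuous_mult (U := AbsRing_UniformSpace C_AbsRing) (K := C_AbsRing) f g z). Qed.

Lemma Cmod_minus_ge (a b : C) : Cmod a - Cmod b <= Cmod (a - b)%C.
Proof.
pose proof (Cmod_triangle (a - b)%C b) as H.
replace (a - b + b)%C with a in H by ring. lra.
Qed.

Lemma Cmod_minus_sym (a b : C) : Cmod (a - b)%C = Cmod (b - a)%C.
Proof. rewrite <- Cmod_opp. f_equal. ring. Qed.

Lemma Cder_inv (z : C) : z <> 0%C -> Cder (fun u => / u)%C z (- / (z * z))%C.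
Proof.
intros Hz. apply Cder_eps. intros eps.
assert (Hp : 0 < Cmod z) by (apply Cmod_gt_0; exact Hz).
set (m := Cmod z) in *.
assert (Hm : 0 < Rmin (m / 2) (eps * m ^ 3 / 2)).
{ apply Rmin_glb_lt; [lra|]. pose proof (cond_pos eps).
  apply Rdiv_lt_0_compat; [|lra]. apply Rmult_lt_0_compat; [lra|apply pow_lt; lra]. }
exists (mkposreal _ Hm). simpl. intros y Hy.
assert (H1 : Cmod (y - z)%C < m / 2) by (eapply Rlt_le_trans; [exact Hy|apply Rmin_l]).
assert (H2 : Cmod (y - z)%C < eps * m ^ 3 / 2) by (eapply Rlt_le_trans; [exact Hy|apply Rmin_r]).
assert (Hy2 : m / 2 < Cmod y).
{ pose proof (Cmod_minus_ge z y). rewrite Cmod_minus_sym in H. fold m in H. lra. }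
assert (Hy0 : y <> 0%C) by (apply Cmod_gt_0; lra).
replace (/ y - / z - - / (z * z) * (y - z))%C with
  ((y - z) * ((y - z) * / (z * z * y)))%C by (field; split; assumption).
rewrite Cmod_mult, Rmult_comm. apply Rmult_le_compat_r; [apply Cmod_ge_0|].
rewrite Cmod_mult, Cmod_inv by (repeat apply Cmult_neq_0; assumption).
rewrite !Cmod_mult. fold m.
apply Rle_trans with ((eps * m ^ 3 / 2) * / (m * m * (m / 2))).
- apply Rmult_le_compat; [apply Cmod_ge_0| |lra|].
  + apply Rlt_le, Rinv_0_lt_compat. repeat apply Rmult_lt_0_compat; lra.
  + apply Rinv_le_contravar; [repeat apply Rmult_lt_0_compat; lra|].
    apply Rmult_le_compat_l; [|lra]. apply Rmult_le_pos; lra.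
- right. field. lra.
Qed.

Lemma Ccont_inv (z : C) : z <> 0%C -> Ccont (fun u => / u)%C z.
Proof. intros Hz. exact (Cder_Ccont _ _ _ (Cder_inv z Hz)). Qed.

Lemma Ccont_conj (f : C -> C) (z : C) : Ccont f z -> Ccont (fun u => Cconj (f u)) z.
Proof.
intros H. apply Ccont_eps. intros eps.
destruct (proj1 (Ccont_eps _ _) H eps) as [d Hd].
exists d. intros y Hy. rewrite <- Cminus_conj, Cmod_conj. exact (Hd y Hy).
Qed.

Lemma Ccont_comp (f g : C -> C) (z : C) :
  Ccont g z -> Ccont f (g z) -> Ccont (fun u => f (g u)) z.
Proof. exact (continuous_comp (U:=AbsRing_UniformSpace C_AbsRing) (V:=AbsRing_UniformSpace C_AbsRing) (W:=AbsRing_UniformSpace C_AbsRing) g f z). Qed.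

Lemma Rcont_comp (f : C -> C) (g : R -> C) (t : R) :
  Rcont g t -> Ccont f (g t) -> Rcont (fun u => f (g u)) t.
Proof. exact (continuous_comp (U:=R_UniformSpace) (V:=AbsRing_UniformSpace C_AbsRing) (W:=AbsRing_UniformSpace C_AbsRing) g f t). Qed.

Lemma Rcont_const (a : C) (t : R) : Rcont (fun _ => a) t.
Proof. exact (continuous_const (U:=R_UniformSpace) (V:=AbsRing_UniformSpace C_AbsRing) a t). Qed.

Lemma Rcont_plus (f g : R -> C) (t : R) :
  Rcont f t -> Rcont g t -> Rcont (fun u => f u + g u)%C t.
Proof. exact (continuous_plus (U := R_UniformSpace) (V := AbsRing_NormedModule C_AbsRing) f g t). Qed.

Lemma Rcont_mult (f g : R -> C) (t : R) :
  Rcont f t -> Rcont g t -> Rcont (fun u => f u * g u)%C t.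
Proof. exact (continuous_mult (U := R_UniformSpace) (K := C_AbsRing) f g t). Qed.

(** * Integrals of complex-valued functions of a real variable *)

Lemma Cmod_norm_R (x : C) : @norm _ C_R_NormedModule x = Cmod x.
Proof.
change (sqrt (Rabs (fst x) ^ 2 + Rabs (snd x) ^ 2) = Cmod x).
unfold Cmod. rewrite !pow2_abs. reflexivity.
Qed.

(** Integrability of continuous functions is stated for the product uniform structure
    of [C], which is not the one of the absolute ring but has the same neighbourhoods. *)
Lemma Rcont_alt (g : R -> C) (t : R) :
  Rcont g t <-> @continuous R_UniformSpace C_R_NormedModule g t.
Proof.
split; intros H P HP; apply H.
- apply (locally_C (g t)). exact HP.
- apply (locally_C (g t)). exact HP.
Qed.

Definition CInt (g : R -> C) (a b : R) : C := @RInt C_R_CompleteNormedModule g a b.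
Definition is_CInt (g : R -> C) (a b : R) (l : C) : Prop := @is_RInt C_R_NormedModule g a b l.

Lemma CInt_correct (g : R -> C) (a b : R) :
  (forall t, Rmin a b <= t <= Rmax a b -> Rcont g t) -> is_CInt g a b (CInt g a b).
Proof.
intros H. apply (RInt_correct (V:=C_R_CompleteNormedModule)).
apply (ex_RInt_continuous (V:=C_R_CompleteNormedModule)).
intros t Ht. apply Rcont_alt, H, Ht.
Qed.

Lemma CInt_unique (g : R -> C) (a b : R) (l : C) : is_CInt g a b l -> CInt g a b = l.
Proof. exact (is_RInt_unique (V:=C_R_CompleteNormedModule) g a b l). Qed.

Lemma is_CInt_ext (f g : R -> C) (a b : R) (l : C) :
  (forall t, Rmin a b <= t <= Rmax a b -> f t = g t) -> is_CInt f a b l -> is_CInt g a b l.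
Proof.
intros H. apply is_RInt_ext. intros t Ht. apply H; lra.
Qed.

Lemma CInt_ext (f g : R -> C) (a b : R) :
  (forall t, Rmin a b <= t <= Rmax a b -> f t = g t) -> CInt f a b = CInt g a b.
Proof.
intros H. apply (RInt_ext (V:=C_R_CompleteNormedModule)). intros t Ht. apply H; lra.
Qed.

Lemma is_CInt_plus (f g : R -> C) (a b : R) (l m : C) :
  is_CInt f a b l -> is_CInt g a b m -> is_CInt (fun t => f t + g t)%C a b (l + m)%C.
Proof. exact (is_RInt_plus (V:=C_R_NormedModule) f g a b l m). Qed.

Lemma is_CInt_const (a b : R) (v : C) : is_CInt (fun _ => v) a b (RtoC (b - a) * v)%C.
Proof.
rewrite <- scal_R_Cmult. exact (is_RInt_const (V:=C_R_NormedModule) a b v).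
Qed.

Lemma is_CInt_components (g : R -> C) (a b : R) (l : C) :
  is_CInt g a b l <->
  is_RInt (fun t => Re (g t)) a b (Re l) /\ is_RInt (fun t => Im (g t)) a b (Im l).
Proof.
split.
- intros H. split.
  + exact (is_RInt_fct_extend_fst (U:=R_NormedModule) (V:=R_NormedModule) g a b l H).
  + exact (is_RInt_fct_extend_snd (U:=R_NormedModule) (V:=R_NormedModule) g a b l H).
- intros [H1 H2]. destruct l as [l1 l2].
  exact (is_RInt_fct_extend_pair (U:=R_NormedModule) (V:=R_NormedModule) g a b l1 l2 H1 H2).
Qed.

Lemma is_CInt_scal (c : C) (g : R -> C) (a b : R) (l : C) :
  is_CInt g a b l -> is_CInt (fun t => c * g t)%C a b (c * l)%C.
Proof.
intros H. apply is_CInt_components in H as [H1 H2]. apply is_CInt_components. split.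
- rewrite re_mult. eapply is_RInt_ext; [intros t _; symmetry; apply re_mult|].
  apply (is_RInt_minus (V:=R_NormedModule)); apply (is_RInt_scal (V:=R_NormedModule)); assumption.
- rewrite im_mult. eapply is_RInt_ext; [intros t _; symmetry; apply im_mult|].
  apply (is_RInt_plus (V:=R_NormedModule)).
  + apply (is_RInt_scal (V:=R_NormedModule)); assumption.
  + apply (is_RInt_scal (V:=R_NormedModule)); assumption.
Qed.

Lemma is_CInt_conj (g : R -> C) (a b : R) (l : C) :
  is_CInt g a b l -> is_CInt (fun t => Cconj (g t)) a b (Cconj l).
Proof.
intros H. apply is_CInt_components in H as [H1 H2]. apply is_CInt_components. split.
- rewrite re_conj. eapply is_RInt_ext; [intros t _; symmetry; apply re_conj|exact H1].
- rewrite im_conj. eapply is_RInt_ext; [intros t _; symmetry; apply im_conj|].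
  exact (is_RInt_opp (V:=R_NormedModule) _ _ _ _ H2).
Qed.

Lemma is_CInt_bound (g : R -> C) (a b : R) (l : C) (M : R) :
  (forall t, Rmin a b <= t <= Rmax a b -> Cmod (g t) <= M) ->
  is_CInt g a b l -> Cmod l <= Rabs (b - a) * M.
Proof.
intros H Hl. rewrite <- Cmod_norm_R.
apply (norm_RInt_le_const_abs (V:=C_R_NormedModule) g); [|exact Hl].
intros t Ht. rewrite Cmod_norm_R. apply H; exact Ht.
Qed.

Definition Rder (g : R -> C) (t : R) (l : C) : Prop :=
  @is_derive R_AbsRing C_R_NormedModule g t l.

Lemma Rder_eps (g : R -> C) (t : R) (l : C) :
  Rder g t l <-> forall eps : posreal, exists d : posreal, forall y : R,
    Rabs (y - t) < d -> Cmod (g y - g t - l * RtoC (y - t))%C <= eps * Rabs (y - t).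
Proof.
split.
- intros [_ H] eps.
  assert (Hz : @is_filter_lim R_UniformSpace (@locally R_UniformSpace t) t) by (intros P HP; exact HP).
  destruct (H t Hz eps) as [d Hd].
  exists d. intros y Hy. specialize (Hd y Hy). simpl in Hd.
  change (@norm R_AbsRing R_NormedModule) with Rabs in Hd.
  rewrite Cmod_norm_R in Hd. rewrite scal_R_Cmult in Hd.
  replace (l * RtoC (y - t))%C with (RtoC (y - t) * l)%C by ring.
  exact Hd.
- intros H. split; [apply is_linear_scal_l|].
  intros x Hx eps.
  assert (E : t = x) by exact (is_filter_lim_locally_unique (V:=R_NormedModule) t x Hx).
  subst x.
  destruct (H eps) as [d Hd]. exists d. intros y Hy.
  specialize (Hd y Hy).
  rewrite Cmod_norm_R, scal_R_Cmult.
  replace (l * RtoC (y - t))%C with (RtoC (y - t) * l)%C in Hd by ring.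
  exact Hd.
Qed.

Lemma Rder_Rcont (g : R -> C) (t : R) (l : C) : Rder g t l -> Rcont g t.
Proof.
intros H. apply Rcont_alt.
apply (ex_derive_continuous (K:=R_AbsRing) (V:=C_R_NormedModule)). exists l; exact H.
Qed.

(** Chain rule across two base fields: a holomorphic function along a real curve. *)
Lemma Rder_comp (Q : C -> C) (g : R -> C) (t : R) (q l : C) :
  Cder Q (g t) q -> Rder g t l -> Rder (fun s => Q (g s)) t (q * l)%C.
Proof.
intros HQ Hg. apply Rder_eps. intros eps.
set (K := Cmod l + 1). set (B := Cmod q + 1).
pose proof (Cmod_ge_0 l) as Hl0. pose proof (Cmod_ge_0 q) as Hq0. pose proof (cond_pos eps) as He0.
assert (HK : 0 < K) by (unfold K; lra). assert (HB : 0 < B) by (unfold B; lra).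
assert (He1 : 0 < eps / (2 * K)) by (apply Rdiv_lt_0_compat; lra).
assert (He2 : 0 < Rmin 1 (eps / (2 * B))) by (apply Rmin_glb_lt; [lra|apply Rdiv_lt_0_compat; lra]).
destruct (proj1 (Cder_eps _ _ _) HQ (mkposreal _ He1)) as [d1 H1].
destruct (proj1 (Rder_eps _ _ _) Hg (mkposreal _ He2)) as [d2 H2].
simpl in H1, H2.
assert (Hd : 0 < Rmin d2 (d1 / K)).
{ apply Rmin_glb_lt; [apply cond_pos|]. apply Rdiv_lt_0_compat; [apply cond_pos|lra]. }
exists (mkposreal _ Hd). simpl. intros y Hy.
assert (Hy2 : Rabs (y - t) < d2) by (eapply Rlt_le_trans; [exact Hy|apply Rmin_l]).
assert (Hy1 : Rabs (y - t) < d1 / K) by (eapply Rlt_le_trans; [exact Hy|apply Rmin_r]).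
specialize (H2 y Hy2).
pose proof (Rabs_pos (y - t)) as Hpos. set (h := Rabs (y - t)) in *.
assert (H2a : Cmod (g y - g t - l * RtoC (y - t))%C <= h).
{ eapply Rle_trans; [exact H2|]. pose proof (Rmin_l 1 (eps / (2 * B))). nra. }
assert (H2b : Cmod (g y - g t - l * RtoC (y - t))%C <= eps / (2 * B) * h).
{ eapply Rle_trans; [exact H2|]. apply Rmult_le_compat_r; [lra|]. apply Rmin_r. }
assert (Hgy : Cmod (g y - g t)%C <= K * h).
{ replace (g y - g t)%C with ((g y - g t - l * RtoC (y - t)) + l * RtoC (y - t))%C by ring.
  eapply Rle_trans; [apply Cmod_triangle|]. rewrite Cmod_mult, Cmod_R. fold h. unfold K. lra. }
assert (Hgd : Cmod (g y - g t)%C < d1).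
{ eapply Rle_lt_trans; [exact Hgy|]. apply (Rmult_lt_reg_r (/ K)); [apply Rinv_0_lt_compat; lra|].
  replace (K * h * / K) with h by (field; lra). exact Hy1. }
specialize (H1 _ Hgd).
replace (Q (g y) - Q (g t) - q * l * RtoC (y - t))%C with
  ((Q (g y) - Q (g t) - q * (g y - g t)) + q * (g y - g t - l * RtoC (y - t)))%C by ring.
eapply Rle_trans; [apply Cmod_triangle|]. rewrite Cmod_mult.
apply Rle_trans with (eps / (2 * K) * (K * h) + B * (eps / (2 * B) * h)).
- apply Rplus_le_compat.
  + eapply Rle_trans; [exact H1|]. apply Rmult_le_compat_l; [lra|exact Hgy].
  + apply Rmult_le_compat; [lra|apply Cmod_ge_0|unfold B; lra|exact H2b].
- right. field. lra.
Qed.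

Lemma is_CInt_Rder (g dg : R -> C) (a b : R) :
  (forall t, Rmin a b <= t <= Rmax a b -> Rder g t (dg t)) ->
  (forall t, Rmin a b <= t <= Rmax a b -> Rcont dg t) ->
  is_CInt dg a b (g b - g a)%C.
Proof.
intros H1 H2. apply (is_RInt_derive (V:=C_R_CompleteNormedModule)); [exact H1|].
intros t Ht. apply Rcont_alt, H2, Ht.
Qed.

(** * Cauchy's theorem for triangles *)

Lemma Rcont_RtoC (t : R) : Rcont RtoC t.
Proof.
apply Rcont_eps. intros eps. exists eps. intros y Hy.
rewrite <- RtoC_minus, Cmod_R. exact Hy.
Qed.

Definition seg (f : C -> C) (a b : C) : C :=
  ((b - a) * CInt (fun t => f (a + RtoC t * (b - a))%C) 0 1)%C.

Lemma Rcont_on_line (f : C -> C) (a v : C) (t : R) :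
  (forall z, Ccont f z) -> Rcont (fun s => f (a + RtoC s * v)%C) t.
Proof.
intros Hf. apply Rcont_comp; [|apply Hf].
apply Rcont_plus; [apply Rcont_const|]. apply Rcont_mult; [apply Rcont_RtoC|apply Rcont_const].
Qed.

Lemma seg_correct (f : C -> C) (a b : C) : (forall z, Ccont f z) ->
  is_CInt (fun t => f (a + RtoC t * (b - a))%C) 0 1 (CInt (fun t => f (a + RtoC t * (b - a))%C) 0 1).
Proof. intros Hf. apply CInt_correct. intros t _. apply Rcont_on_line; exact Hf. Qed.

(** Reparametrisation by an affine map; orientation reversal and additivity along a
    segment both follow from it. *)
Lemma seg_sub (f : C -> C) (a b : C) (s t : R) : (forall z, Ccont f z) ->
  seg f (a + RtoC s * (b - a))%C (a + RtoC t * (b - a))%C =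
  ((b - a) * CInt (fun y => f (a + RtoC y * (b - a))%C) s t)%C.
Proof.
intros Hf. unfold seg.
set (g := fun y : R => f (a + RtoC y * (b - a))%C).
assert (Hg : is_CInt g s t (CInt g s t)).
{ apply CInt_correct. intros y _. apply Rcont_on_line; exact Hf. }
assert (H : is_CInt (fun y => RtoC (t - s) * g ((t - s) * y + s)%R)%C 0 1 (CInt g s t)).
{ eapply is_CInt_ext; [intros y _; apply scal_R_Cmult|].
  apply (is_RInt_comp_lin (V:=C_R_NormedModule)).
  replace ((t - s) * 0 + s) with s by ring. replace ((t - s) * 1 + s) with t by ring. exact Hg. }
rewrite <- (CInt_unique _ _ _ _ H).
replace (a + RtoC t * (b - a) - (a + RtoC s * (b - a)))%C with ((b - a) * RtoC (t - s))%C
  by (rewrite RtoC_minus; ring).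
rewrite <- Cmult_assoc. f_equal. symmetry. apply CInt_unique.
apply is_CInt_scal.
eapply is_CInt_ext; [|apply CInt_correct].
- intros y _. unfold g. f_equal. rewrite RtoC_plus, RtoC_mult. ring.
- intros y _. apply Rcont_on_line; exact Hf.
Qed.

Lemma seg_swap (f : C -> C) (a b : C) : (forall z, Ccont f z) -> seg f b a = (- seg f a b)%C.
Proof.
intros Hf.
pose proof (seg_sub f a b 1 0 Hf) as H1. pose proof (seg_sub f a b 0 1 Hf) as H2.
replace (a + 1 * (b - a))%C with b in * by ring.
replace (a + 0 * (b - a))%C with a in * by ring.
rewrite H1, H2. unfold CInt.
rewrite <- (opp_RInt_swap (V:=C_R_CompleteNormedModule)).
- change (@opp (CompleteNormedModule.AbelianGroup R_AbsRing C_R_CompleteNormedModule)) with Copp. ring.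
- eexists. apply seg_correct, Hf.
Qed.

Lemma seg_split (f : C -> C) (a b : C) (s : R) : (forall z, Ccont f z) ->
  seg f a b = (seg f a (a + RtoC s * (b - a)) + seg f (a + RtoC s * (b - a)) b)%C.
Proof.
intros Hf.
pose proof (seg_sub f a b 0 s Hf) as H1. pose proof (seg_sub f a b s 1 Hf) as H2.
pose proof (seg_sub f a b 0 1 Hf) as H3.
replace (a + 1 * (b - a))%C with b in * by ring.
replace (a + 0 * (b - a))%C with a in * by ring.
rewrite H1, H2, H3, <- Cmult_plus_distr_l. f_equal. symmetry.
apply (RInt_Chasles (V:=C_R_CompleteNormedModule)); eexists; apply CInt_correct;
  intros y _; apply Rcont_on_line; exact Hf.
Qed.

Lemma seg_same (f : C -> C) (a : C) : seg f a a = 0%C.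
Proof. unfold seg. ring. Qed.

Lemma seg_primitive (f F : C -> C) (a b : C) : (forall z, Ccont f z) ->
  (forall z, Cder F z (f z)) -> seg f a b = (F b - F a)%C.
Proof.
intros Hf HF. unfold seg.
pose proof (is_CInt_scal (b - a)%C _ _ _ _ (seg_correct f a b Hf)) as H.
rewrite <- (CInt_unique _ _ _ _ H). apply CInt_unique.
replace (F b - F a)%C with (F (a + RtoC 1 * (b - a)) - F (a + RtoC 0 * (b - a)))%C
  by (f_equal; [f_equal; ring|do 2 f_equal; ring]).
apply (is_CInt_Rder (fun t => F (a + RtoC t * (b - a))%C)).
- intros t _. rewrite (Cmult_comm (b - a)%C).
  apply (Rder_comp F (fun t => a + RtoC t * (b - a))%C); [apply HF|].
  apply Rder_eps. intros eps. exists eps. intros y Hy.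
  replace (_ - _ - _)%C with (RtoC 0) by (rewrite RtoC_minus; ring).
  rewrite Cmod_0. apply Rmult_le_pos; [apply Rlt_le, cond_pos|apply Rabs_pos].
- intros t _. apply Rcont_mult; [apply Rcont_const|]. apply Rcont_on_line; exact Hf.
Qed.

(** Stated for a difference because every use compares [f] with an affine or constant
    approximation whose integral is known. *)
Lemma seg_bound_diff (f g : C -> C) (a b : C) (M : R) :
  (forall z, Ccont f z) -> (forall z, Ccont g z) ->
  (forall t, 0 <= t <= 1 -> Cmod (f (a + RtoC t * (b - a)) - g (a + RtoC t * (b - a)))%C <= M) ->
  Cmod (seg f a b - seg g a b)%C <= Cmod (b - a)%C * M.
Proof.
intros Hf Hg H. unfold seg.
set (I := CInt _ 0 1). set (J := CInt _ 0 1).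
replace ((b - a) * I - (b - a) * J)%C with ((b - a) * (I + (-(1)) * J))%C by ring.
rewrite Cmod_mult. apply Rmult_le_compat_l; [apply Cmod_ge_0|].
replace M with (Rabs (1 - 0) * M) by (rewrite Rminus_0_r, Rabs_R1; ring).
eapply is_CInt_bound; [|apply is_CInt_plus; [apply seg_correct, Hf|apply is_CInt_scal, seg_correct, Hg]].
rewrite Rmin_left, Rmax_right by lra. intros t Ht. simpl.
eapply Rle_trans; [|apply (H t Ht)]. right. f_equal. ring.
Qed.

Lemma seg_bound (f : C -> C) (a b : C) (M : R) : (forall z, Ccont f z) ->
  (forall t, 0 <= t <= 1 -> Cmod (f (a + RtoC t * (b - a)))%C <= M) ->
  Cmod (seg f a b) <= Cmod (b - a)%C * M.
Proof.
intros Hf H.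
assert (E : seg (fun _ => 0%C) a b = 0%C).
{ rewrite (seg_primitive _ (fun _ => 0%C)).
  - ring.
  - intros z; apply Ccont_const.
  - intros z; apply Cder_const. }
replace (seg f a b) with (seg f a b - seg (fun _ => 0%C) a b)%C by (rewrite E; ring).
apply seg_bound_diff; [exact Hf|intros z; apply Ccont_const|].
intros t Ht. eapply Rle_trans; [|apply (H t Ht)]. right. f_equal. ring.
Qed.

Definition tri (f : C -> C) (a b c : C) : C := (seg f a b + seg f b c + seg f c a)%C.

Definition mid (a b : C) : C := (a + RtoC (/ 2) * (b - a))%C.

Lemma mid_sym (a b : C) : mid a b = mid b a.
Proof.
unfold mid. rewrite RtoC_inv by lra. field.
Qed.

Lemma tri_subdivision (f : C -> C) (a b c : C) : (forall z, Ccont f z) ->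
  tri f a b c =
  (tri f a (mid a b) (mid c a) + tri f (mid a b) b (mid b c)
   + tri f (mid c a) (mid b c) c + tri f (mid a b) (mid b c) (mid c a))%C.
Proof.
intros Hf. unfold tri.
rewrite (seg_split f a b (/2) Hf), (seg_split f b c (/2) Hf), (seg_split f c a (/2) Hf).
fold (mid a b) (mid b c) (mid c a).
rewrite (seg_swap f (mid a b) (mid c a) Hf), (seg_swap f (mid a b) (mid b c) Hf),
  (seg_swap f (mid b c) (mid c a) Hf).
ring.
Qed.

Lemma Cmod_half (x : C) : Cmod (RtoC (/ 2) * x)%C = Cmod x / 2.
Proof. rewrite Cmod_mult, Cmod_R, Rabs_pos_eq by lra. lra. Qed.

Lemma re_mid (a b v : C) : Re (mid a b * v) = (Re (a * v) + Re (b * v)) / 2.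
Proof.
unfold mid.
replace ((a + RtoC (/ 2) * (b - a)) * v)%C with (a * v + RtoC (/2) * (b * v - a * v))%C by ring.
unfold Cminus. rewrite re_plus, re_scal_l, re_plus, re_opp. lra.
Qed.

(** The invariant of the bisection. A closed half-plane is convex and closed, so it
    contains the point to which the nested triangles shrink. *)
Definition small_tri (v : C) (m D : R) (T : C * C * C) : Prop :=
  let '(a, b, c) := T in
  (Cmod (b - a)%C <= D /\ Cmod (c - b)%C <= D /\ Cmod (a - c)%C <= D) /\
  (m <= Re (a * v) /\ m <= Re (b * v) /\ m <= Re (c * v)).

Definition triT (f : C -> C) (T : C * C * C) : C := let '(a, b, c) := T in tri f a b c.

(** The integral over a triangle is the sum over its four midpoint triangles, so one of
    them carries at least a quarter of its modulus. *)
Lemma tri_bisection (f : C -> C) (v : C) (m D : R) (T : C * C * C) :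
  (forall z, Ccont f z) -> small_tri v m D T ->
  exists T', small_tri v m (D / 2) T' /\
    Cmod (fst (fst T') - fst (fst T))%C <= D /\ Cmod (triT f T) <= 4 * Cmod (triT f T').
Proof.
intros Hf. destruct T as [[a b] c]. simpl. intros [(S1 & S2 & S3) (M1 & M2 & M3)].
pose proof (tri_subdivision f a b c Hf) as E.
set (T1 := tri f a (mid a b) (mid c a)) in E. set (T2 := tri f (mid a b) b (mid b c)) in E.
set (T3 := tri f (mid c a) (mid b c) c) in E. set (T4 := tri f (mid a b) (mid b c) (mid c a)) in E.
assert (B : Cmod (tri f a b c) <= Cmod T1 + Cmod T2 + Cmod T3 + Cmod T4).
{ rewrite E. pose proof (Cmod_triangle (T1 + T2 + T3) T4).
  pose proof (Cmod_triangle (T1 + T2) T3). pose proof (Cmod_triangle T1 T2). lra. }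
assert (Eab : (mid a b - a)%C = (RtoC (/2) * (b - a))%C) by (unfold mid; ring).
assert (Eba : (b - mid a b)%C = (RtoC (/2) * (b - a))%C) by (rewrite mid_sym; unfold mid; ring).
assert (Ebc : (mid b c - b)%C = (RtoC (/2) * (c - b))%C) by (unfold mid; ring).
assert (Ecb : (c - mid b c)%C = (RtoC (/2) * (c - b))%C) by (rewrite mid_sym; unfold mid; ring).
assert (Eca : (mid c a - c)%C = (RtoC (/2) * (a - c))%C) by (unfold mid; ring).
assert (Eac : (a - mid c a)%C = (RtoC (/2) * (a - c))%C) by (rewrite mid_sym; unfold mid; ring).
assert (F1 : (mid c a - mid a b)%C = (RtoC (/2) * - (b - c))%C) by (rewrite (mid_sym c a); unfold mid; ring).
assert (F2 : (mid a b - mid b c)%C = (RtoC (/2) * - (c - a))%C) by (rewrite (mid_sym a b); unfold mid; ring).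
assert (F3 : (mid b c - mid c a)%C = (RtoC (/2) * - (a - b))%C) by (rewrite (mid_sym b c); unfold mid; ring).
assert (S1' : Cmod (a - b)%C <= D) by (rewrite Cmod_minus_sym; exact S1).
assert (S2' : Cmod (b - c)%C <= D) by (rewrite Cmod_minus_sym; exact S2).
assert (S3' : Cmod (c - a)%C <= D) by (rewrite Cmod_minus_sym; exact S3).
pose proof (re_mid a b v) as R1. pose proof (re_mid b c v) as R2. pose proof (re_mid c a v) as R3.
pose proof (Cmod_ge_0 (b - a)%C) as P0.
destruct (Rle_lt_dec (Cmod (tri f a b c)) (4 * Cmod T1)) as [H1|H1].
{ exists (a, mid a b, mid c a). simpl.
  rewrite Eab, F1, Eac, !Cmod_half, Cmod_opp.
  replace (a - a)%C with (RtoC 0) by ring. rewrite Cmod_0. fold T1. repeat split; lra. }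
destruct (Rle_lt_dec (Cmod (tri f a b c)) (4 * Cmod T2)) as [H2|H2].
{ exists (mid a b, b, mid b c). simpl.
  rewrite Eba, Ebc, F2, Eab, !Cmod_half, Cmod_opp. fold T2. repeat split; lra. }
destruct (Rle_lt_dec (Cmod (tri f a b c)) (4 * Cmod T3)) as [H3|H3].
{ exists (mid c a, mid b c, c). simpl.
  rewrite F3, Ecb, (Cmod_minus_sym (mid c a) a), Eca, Eac, !Cmod_half, Cmod_opp.
  fold T3. repeat split; lra. }
exists (mid a b, mid b c, mid c a). simpl.
rewrite (Cmod_minus_sym (mid b c) (mid a b)), (Cmod_minus_sym (mid c a) (mid b c)),
  (Cmod_minus_sym (mid a b) (mid c a)), F1, F2, F3, Eab, !Cmod_half, !Cmod_opp.
fold T4. repeat split; lra.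
Qed.

Lemma div_pow2_lt (K eps : R) : 0 < eps -> exists n : nat, K / 2 ^ n < eps.
Proof.
intros He. destruct (Rle_lt_dec K 0) as [HK|HK].
{ exists O. simpl. lra. }
destruct (Pow_x_infinity 2 ltac:(rewrite Rabs_pos_eq; lra) (K / eps + 1)) as [N HN].
exists N. specialize (HN N (le_n N)). pose proof (pow_lt 2 N ltac:(lra)) as Hp.
rewrite Rabs_pos_eq in HN by lra.
apply (Rmult_lt_reg_r (2 ^ N)); [exact Hp|].
replace (K / 2 ^ N * 2 ^ N) with (K / eps * eps) by (field; lra).
rewrite (Rmult_comm eps). apply Rmult_lt_compat_r; lra.
Qed.

(** The explicit rate matters: in Goursat's argument the distance to the limit point
    has to shrink as fast as the triangles do. *)
Lemma geometric_limit (u : nat -> C) (D : R) :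
  (forall n, Cmod (u (S n) - u n)%C <= D / 2 ^ n) ->
  exists x : C, forall n, Cmod (u n - x)%C <= 2 * D / 2 ^ n.
Proof.
intros H.
assert (HD : 0 <= D).
{ specialize (H O). simpl in H. pose proof (Cmod_ge_0 (u 1%nat - u O)%C). lra. }
assert (Hs : ex_series (V:=C_R_CompleteNormedModule) (fun n => (u (S n) - u n)%C : C_R_CompleteNormedModule)).
{ apply (ex_series_le (V:=C_R_CompleteNormedModule) _ (fun n => D * (/ 2) ^ n)).
  - intros n. rewrite pow_inv. pose proof (Cmod_norm_R (u (S n) - u n)%C) as E.
    specialize (H n). unfold Rdiv in H. rewrite <- E in H. exact H.
  - apply (ex_series_scal (V:=R_NormedModule) D). apply ex_series_geom. rewrite Rabs_pos_eq; lra. }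
assert (Hsum : forall n, sum_n (G:=C_R_CompleteNormedModule) (fun n => (u (S n) - u n)%C) n = (u (S n) - u O)%C).
{ induction n as [|n IH].
  - rewrite sum_O. reflexivity.
  - rewrite sum_Sn, IH.
    change ((u (S n) - u O) + (u (S (S n)) - u (S n)) = u (S (S n)) - u O)%C. ring. }
assert (Htel : forall n k, Cmod (u n - u (n + k)%nat)%C <= 2 * D / 2 ^ n - 2 * D / 2 ^ (n + k)).
{ intros n. induction k as [|k IH].
  - rewrite Nat.add_0_r. replace (u n - u n)%C with (RtoC 0) by ring. rewrite Cmod_0. lra.
  - rewrite Nat.add_succ_r.
    replace (u n - u (S (n + k)))%C with ((u n - u (n + k)%nat) + - (u (S (n + k)) - u (n + k)%nat))%C by ring.
    eapply Rle_trans; [apply Cmod_triangle|]. rewrite Cmod_opp. specialize (H (n + k)%nat).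
    pose proof (pow_lt 2 (n + k) ltac:(lra)).
    replace (2 * D / 2 ^ S (n + k)) with (D / 2 ^ (n + k)) by (simpl; field; lra).
    replace (2 * D / 2 ^ (n + k)) with (2 * (D / 2 ^ (n + k))) in IH by (field; lra). lra. }
destruct Hs as [s Hs].
exists (u O + s)%C. intros n. apply le_epsilon. intros eps He.
assert (He2 : exists N, forall k, (N <= k)%nat -> Cmod (u (S k) - u O - s)%C < eps).
{ assert (Hb : locally (T:=C_UniformSpace) (s : C) (fun y => Cmod (y - s)%C < eps)).
  { apply locally_C. exists (mkposreal eps He). intros y Hy. exact Hy. }
  destruct (Hs _ Hb) as [N' HN']. exists N'. intros k Hk. specialize (HN' k Hk). rewrite Hsum in HN'. exact HN'. }
destruct He2 as [N' HN'].
specialize (HN' (n + N')%nat ltac:(lia)). specialize (Htel n (S N')).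
rewrite Nat.add_succ_r in Htel.
replace (u n - (u O + s))%C with ((u n - u (S (n + N'))) + (u (S (n + N')) - u O - s))%C by ring.
eapply Rle_trans; [apply Cmod_triangle|].
assert (0 <= 2 * D / 2 ^ S (n + N')).
{ apply Rmult_le_pos; [lra|]. apply Rlt_le, Rinv_0_lt_compat, pow_lt; lra. }
lra.
Qed.

Lemma Cmod_segment_le (p q x : C) (r t : R) :
  0 <= t <= 1 -> Cmod (p - x)%C <= r -> Cmod (q - x)%C <= r ->
  Cmod (p + RtoC t * (q - p) - x)%C <= r.
Proof.
intros Ht Hp Hq.
replace (p + RtoC t * (q - p) - x)%C with (RtoC (1 - t) * (p - x) + RtoC t * (q - x))%C
  by (rewrite RtoC_minus; ring).
eapply Rle_trans; [apply Cmod_triangle|].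
rewrite !Cmod_mult, !Cmod_R, !Rabs_pos_eq by lra. nra.
Qed.

(** Goursat's argument: after [n] bisections both the perimeter and the distance to
    the limit point are of order [2^-n], and replacing [f] by its affine approximation
    there, whose integral vanishes, gives a bound [o(4^-n)] for an integral of modulus at
    least [4^-n] times the initial one. Differentiability is only assumed in a half-plane,
    which allows an exceptional point outside of it. *)
Lemma goursat_half_plane (f : C -> C) (v : C) (m : R) (a b c : C) :
  (forall z, Ccont f z) -> (forall z, m <= Re (z * v) -> exists l, Cder f z l) ->
  m <= Re (a * v) -> m <= Re (b * v) -> m <= Re (c * v) -> tri f a b c = 0%C.
Proof.
intros Hf Hd Ha Hb Hc.
set (D := Cmod (b - a)%C + Cmod (c - b)%C + Cmod (a - c)%C).
pose proof (Cmod_ge_0 (b - a)%C) as N1. pose proof (Cmod_ge_0 (c - b)%C) as N2.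
pose proof (Cmod_ge_0 (a - c)%C) as N3.
assert (HD : 0 <= D) by (unfold D; lra).
assert (Hstep : forall nT : nat * (C * C * C), exists T', small_tri v m (D / 2 ^ fst nT) (snd nT) ->
   small_tri v m (D / 2 ^ fst nT / 2) T' /\
    Cmod (fst (fst T') - fst (fst (snd nT)))%C <= D / 2 ^ fst nT /\ Cmod (triT f (snd nT)) <= 4 * Cmod (triT f T')).
{ intros [n T]. simpl. destruct (classic (small_tri v m (D / 2 ^ n) T)) as [H|H].
  - destruct (tri_bisection f v m _ T Hf H) as [T' HT']. exists T'. intros _. exact HT'.
  - exists T. intros H'. contradiction. }
destruct (functional_choice _ Hstep) as [next Hnext].
set (T := fix T n := match n with O => (a, b, c) | S k => next (k, T k) end).
assert (HT : forall n, small_tri v m (D / 2 ^ n) (T n)).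
{ induction n as [|n IH].
  - change (small_tri v m (D / 1) (a, b, c)). split; [|auto]. rewrite Rdiv_1_r. unfold D. lra.
  - change (T (S n)) with (next (n, T n)). destruct (Hnext (n, T n) IH) as [H _]. simpl fst in H.
    replace (D / 2 ^ S n) with (D / 2 ^ n / 2) by (simpl; field; apply pow_nonzero; lra). exact H. }
assert (Hmod : forall n, Cmod (tri f a b c) <= 4 ^ n * Cmod (triT f (T n))).
{ induction n as [|n IH].
  - simpl. lra.
  - destruct (Hnext (n, T n) (HT n)) as (_ & _ & H). simpl snd in H.
    change (T (S n)) with (next (n, T n)).
    eapply Rle_trans; [exact IH|]. simpl pow. pose proof (pow_lt 4 n ltac:(lra)). nra. }
destruct (geometric_limit (fun n => fst (fst (T n))) D) as [x Hx].
{ intros n. destruct (Hnext (n, T n) (HT n)) as (_ & H & _). exact H. }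
cbv beta in Hx.
assert (Hxm : m <= Re (x * v)).
{ apply le_epsilon. intros eps He.
  destruct (div_pow2_lt (2 * D * Cmod v) eps He) as [n Hn].
  specialize (Hx n). specialize (HT n). destruct (T n) as [[an bn] cn]. simpl in Hx, HT.
  destruct HT as (_ & Hm & _).
  assert (Hre : Re (an * v) - Re (x * v) <= 2 * D / 2 ^ n * Cmod v).
  { replace (Re (an * v) - Re (x * v)) with (Re ((an - x) * v)).
    - eapply Rle_trans; [apply Rle_abs|]. eapply Rle_trans; [apply re_le_Cmod|].
      rewrite Cmod_mult. apply Rmult_le_compat_r; [apply Cmod_ge_0|exact Hx].
    - replace ((an - x) * v)%C with (an * v + - (x * v))%C by ring. rewrite re_plus, re_opp. ring. }
  replace (2 * D / 2 ^ n * Cmod v) with (2 * D * Cmod v / 2 ^ n) in Hre by (unfold Rdiv; ring). lra. }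
destruct (Hd x Hxm) as [l Hl].
apply Cmod_eq_0. apply Rle_antisym; [|apply Cmod_ge_0].
apply le_epsilon. intros eps He. rewrite Rplus_0_l.
assert (He' : 0 < eps / (9 * (D * D) + 1)) by (apply Rdiv_lt_0_compat; nra).
destruct (proj1 (Cder_eps _ _ _) Hl (mkposreal _ He')) as [d Hdd]. simpl in Hdd.
set (e := eps / (9 * (D * D) + 1)) in *.
destruct (div_pow2_lt (3 * D) d (cond_pos d)) as [n Hn].
eapply Rle_trans; [apply (Hmod n)|].
specialize (Hx n). specialize (HT n). destruct (T n) as [[an bn] cn]. simpl in Hx, HT |- *.
destruct HT as [(S1 & S2 & S3) _].
set (q := D / 2 ^ n) in *.
assert (Hq : 0 <= q) by (apply Rmult_le_pos; [exact HD|]; apply Rlt_le, Rinv_0_lt_compat, pow_lt; lra).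
replace (2 * D / 2 ^ n) with (2 * q) in Hx by (unfold q; field; apply pow_nonzero; lra).
replace (3 * D / 2 ^ n) with (3 * q) in Hn by (unfold q; field; apply pow_nonzero; lra).
set (g := fun u => (f x + l * (u - x))%C).
assert (Hg : forall z, Ccont g z).
{ intros z. apply Ccont_plus; [apply Ccont_const|]. apply Ccont_mult; [apply Ccont_const|].
  apply Ccont_plus; [apply Ccont_id|apply Ccont_const]. }
assert (Hgp : forall z, Cder (fun u => f x * u + l * (/ 2 * ((u - x) * (u - x))))%C z (g z)).
{ intros z.
  pose proof (Cder_minus _ _ z _ _ (Cder_id z) (Cder_const x z)) as H1.
  eapply Cder_ext; [reflexivity| |
      exact (Cder_plus _ _ z _ _ (Cder_scal _ (f x) z _ (Cder_id z))
        (Cder_scal _ l z _ (Cder_scal _ (/2)%C z _ (Cder_mult _ _ z _ _ H1 H1))))].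
  unfold g. field. }
assert (Hg0 : tri g an bn cn = 0%C).
{ unfold tri. rewrite !(seg_primitive g _ _ _ Hg Hgp). ring. }
assert (A1 : Cmod (an - x)%C <= 3 * q) by lra.
assert (A2 : Cmod (bn - x)%C <= 3 * q).
{ replace (bn - x)%C with ((bn - an) + (an - x))%C by ring.
  eapply Rle_trans; [apply Cmod_triangle|]. lra. }
assert (A3 : Cmod (cn - x)%C <= 3 * q).
{ replace (cn - x)%C with (- (an - cn) + (an - x))%C by ring.
  eapply Rle_trans; [apply Cmod_triangle|]. rewrite Cmod_opp. lra. }
assert (He0 : 0 < e) by exact He'.
assert (Hseg : forall p r, Cmod (p - x)%C <= 3 * q -> Cmod (r - x)%C <= 3 * q -> Cmod (r - p)%C <= q ->
  Cmod (seg f p r - seg g p r)%C <= q * (e * (3 * q))).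
{ intros p r Hp Hr Hpr.
  eapply Rle_trans; [apply (seg_bound_diff f g p r (e * (3 * q)) Hf Hg)|].
  - intros t Ht. pose proof (Cmod_segment_le p r x (3 * q) t Ht Hp Hr) as Hu.
    set (u := (p + RtoC t * (r - p))%C) in *.
    unfold g. replace (f u - (f x + l * (u - x)))%C with (f u - f x - l * (u - x))%C by ring.
    eapply Rle_trans; [apply Hdd; lra|]. apply Rmult_le_compat_l; lra.
  - apply Rmult_le_compat_r; [|exact Hpr]. apply Rmult_le_pos; lra. }
assert (Htri : Cmod (tri f an bn cn) <= 9 * e * (q * q)).
{ replace (tri f an bn cn) with (tri f an bn cn - tri g an bn cn)%C by (rewrite Hg0; ring).
  unfold tri.
  replace (_ - _)%C with ((seg f an bn - seg g an bn) + (seg f bn cn - seg g bn cn) + (seg f cn an - seg g cn an))%C by ring.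
  pose proof (Hseg an bn A1 A2 S1). pose proof (Hseg bn cn A2 A3 S2). pose proof (Hseg cn an A3 A1 S3).
  eapply Rle_trans; [apply Cmod_triangle|].
  pose proof (Cmod_triangle (seg f an bn - seg g an bn) (seg f bn cn - seg g bn cn)). lra. }
eapply Rle_trans; [apply Rmult_le_compat_l; [apply pow_le; lra|exact Htri]|].
assert (Eq : 4 ^ n * (q * q) = D * D).
{ unfold q. replace 4 with (2 * 2) by lra. rewrite Rpow_mult_distr. field. apply pow_nonzero; lra. }
replace (4 ^ n * (9 * e * (q * q))) with (9 * e * (4 ^ n * (q * q))) by ring. rewrite Eq.
apply Rle_trans with (e * (9 * (D * D) + 1)); [lra|]. unfold e. right. field. nra.
Qed.

(** * Primitives *)

Lemma seg_antiderivative (f F : C -> C) (z : C) (r : R) :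
  (forall u, Ccont f u) -> 0 < r ->
  (forall y, Cmod (y - z)%C < r -> F y = (F z + seg f z y)%C) -> Cder F z (f z).
Proof.
intros Hf Hr HF. apply Cder_eps. intros eps.
destruct (proj1 (Ccont_eps _ _) (Hf z) eps) as [d Hd].
assert (Hm : 0 < Rmin d r) by (apply Rmin_glb_lt; [apply cond_pos|exact Hr]).
exists (mkposreal _ Hm). simpl. intros y Hy.
assert (Hyd : Cmod (y - z)%C < d) by (eapply Rlt_le_trans; [exact Hy|apply Rmin_l]).
assert (Hyr : Cmod (y - z)%C < r) by (eapply Rlt_le_trans; [exact Hy|apply Rmin_r]).
rewrite (HF y Hyr).
assert (E : seg (fun _ => f z) z y = (f z * (y - z))%C).
{ rewrite (seg_primitive _ (fun u => f z * u)%C).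
  - ring.
  - intros u; apply Ccont_const.
  - intros u. eapply Cder_ext; [reflexivity| |apply Cder_scal, Cder_id]. ring. }
replace (F z + seg f z y - F z - f z * (y - z))%C with (seg f z y - seg (fun _ => f z) z y)%C by (rewrite E; ring).
rewrite Rmult_comm. apply seg_bound_diff; [exact Hf|intros u; apply Ccont_const|].
intros t Ht. apply Rlt_le, Hd.
eapply Rle_lt_trans; [|exact Hyd].
replace (z + RtoC t * (y - z) - z)%C with (RtoC t * (y - z))%C by ring.
rewrite Cmod_mult, Cmod_R, Rabs_pos_eq by lra.
pose proof (Cmod_ge_0 (y - z)%C). nra.
Qed.

(** For a vertex at the exceptional point [w], cut off a small homothetic copy at [w].
    What remains splits into two triangles contained in an open half-plane that avoids [w]
    (with inner normal [z - w]; this is where [y] has to be close to [z]), and the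
    small copy contributes little since [f] is bounded near [w]. *)
Lemma tri_punctured (f : C -> C) (w z y : C) :
  (forall u, Ccont f u) -> (forall u, u <> w -> exists l, Cder f u l) ->
  Cmod (y - z)%C < Cmod (z - w)%C -> tri f w z y = 0%C.
Proof.
intros Hf Hd Hy.
destruct (proj1 (Ccont_eps _ _) (Hf w) (mkposreal 1 Rlt_0_1)) as [d Hdw]. simpl in Hdw.
set (B := Cmod (f w) + 1).
assert (HB : forall u, Cmod (u - w)%C < d -> Cmod (f u) <= B).
{ intros u Hu. specialize (Hdw u Hu). pose proof (Cmod_minus_ge (f u) (f w)). unfold B. lra. }
(* [Re (u * v)] measures [u] along the direction [z - w]. *)
set (v := Cconj (z - w)%C).
pose proof (Cmod_ge_0 (y - z)%C) as Hh0. pose proof (Cmod_ge_0 (z - w)%C) as Hr0.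
pose proof (Cmod_ge_0 (w - y)%C) as Hy0.
assert (Hzv : Re ((z - w) * v) = Cmod (z - w)%C * Cmod (z - w)%C).
{ unfold v. rewrite <- Cmod2_conj. rewrite re_RtoC. ring. }
assert (Hhv : - (Cmod (y - z)%C * Cmod (z - w)%C) <= Re ((y - z) * v)).
{ pose proof (re_le_Cmod ((y - z) * v)%C) as H. rewrite Cmod_mult in H. unfold v in H at 2.
  rewrite Cmod_conj in H. apply Rabs_le_between in H. lra. }
assert (Hyv : 0 < Re ((y - w) * v)).
{ replace ((y - w) * v)%C with ((z - w) * v + (y - z) * v)%C by ring. rewrite re_plus, Hzv. nra. }
assert (Hzv0 : 0 < Re ((z - w) * v)) by (rewrite Hzv; nra).
set (K := Cmod (z - w)%C + Cmod (y - z)%C + Cmod (w - y)%C).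
assert (HK0 : 0 <= K) by (unfold K; lra).
pose proof (Cmod_ge_0 (f w)) as Hfw0.
assert (HB0 : 0 <= B) by (unfold B; lra).
assert (HKB0 : 0 <= K * B) by (apply Rmult_le_pos; assumption).
assert (Hsmall : forall s, 0 < s <= 1 -> s * (K + 1) < d -> Cmod (tri f w z y) <= s * (K * B)).
{ intros s Hs Hsd.
  set (zs := (w + RtoC s * (z - w))%C). set (ys := (w + RtoC s * (y - w))%C).
  set (Z := Re ((z - w) * v)) in *. set (Y := Re ((y - w) * v)) in *.
  set (m := Rmin (s * Z) (s * Y) + Re (w * v)).
  assert (Hpos : Re (w * v) < m).
  { unfold m. assert (0 < Rmin (s * Z) (s * Y)).
    { apply Rmin_glb_lt; apply Rmult_lt_0_compat; lra. } lra. }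
  assert (Hder : forall u, m <= Re (u * v) -> exists l, Cder f u l).
  { intros u Hu. apply Hd. intros ->. lra. }
  assert (Ez : Re (z * v) = Z + Re (w * v)) by (unfold Z; rewrite <- re_plus; f_equal; ring).
  assert (Ey : Re (y * v) = Y + Re (w * v)) by (unfold Y; rewrite <- re_plus; f_equal; ring).
  assert (Ezs : Re (zs * v) = s * Z + Re (w * v)).
  { unfold Z. rewrite <- re_scal_l, <- re_plus; f_equal; unfold zs; ring. }
  assert (Eys : Re (ys * v) = s * Y + Re (w * v)).
  { unfold Y. rewrite <- re_scal_l, <- re_plus; f_equal; unfold ys; ring. }
  pose proof (Rmin_l (s * Z) (s * Y)) as L1.
  pose proof (Rmin_r (s * Z) (s * Y)) as L2.
  assert (Mz : m <= Re (z * v)) by (rewrite Ez; unfold m; nra).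
  assert (My : m <= Re (y * v)) by (rewrite Ey; unfold m; nra).
  assert (Mzs : m <= Re (zs * v)) by (rewrite Ezs; unfold m; lra).
  assert (Mys : m <= Re (ys * v)) by (rewrite Eys; unfold m; lra).
  assert (G1 : tri f zs z y = 0%C) by (apply (goursat_half_plane f v m); assumption).
  assert (G2 : tri f zs y ys = 0%C) by (apply (goursat_half_plane f v m); assumption).
  assert (E : tri f w z y = tri f w zs ys).
  { transitivity (tri f w zs ys + tri f zs z y + tri f zs y ys)%C; [|rewrite G1, G2; ring].
    unfold tri.
    rewrite (seg_split f w z s Hf), (seg_swap f w y Hf), (seg_split f w y s Hf).
    fold zs ys. rewrite (seg_swap f ys y Hf), (seg_swap f y zs Hf), (seg_swap f w ys Hf).
    rewrite (seg_swap f zs ys Hf), (seg_swap f zs y Hf).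
    ring. }
  rewrite E.
  assert (Fz : (zs - w)%C = (RtoC s * (z - w))%C) by (unfold zs; ring).
  assert (Fy : (w - ys)%C = (RtoC s * (w - y))%C) by (unfold ys; ring).
  assert (Fyz : (ys - zs)%C = (RtoC s * (y - z))%C) by (unfold ys, zs; ring).
  assert (Cs : forall x, Cmod (RtoC s * x)%C = s * Cmod x).
  { intros x. rewrite Cmod_mult, Cmod_R, Rabs_pos_eq by lra. reflexivity. }
  assert (Dz : Cmod (zs - w)%C <= s * K).
  { rewrite Fz, Cs. apply Rmult_le_compat_l; [lra|]. unfold K. lra. }
  assert (Dy : Cmod (ys - w)%C <= s * K).
  { rewrite Cmod_minus_sym, Fy, Cs. apply Rmult_le_compat_l; [lra|]. unfold K. lra. }
  assert (Dw : Cmod (w - w)%C <= s * K).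
  { replace (w - w)%C with (RtoC 0) by ring. rewrite Cmod_0. apply Rmult_le_pos; lra. }
  assert (Hsg : forall p q, Cmod (p - w)%C <= s * K -> Cmod (q - w)%C <= s * K ->
    Cmod (seg f p q) <= Cmod (q - p)%C * B).
  { intros p q Hp Hq. apply seg_bound; [exact Hf|]. intros t Ht. apply HB.
    eapply Rle_lt_trans; [apply (Cmod_segment_le p q w (s * K)); assumption|]. lra. }
  pose proof (Hsg w zs Dw Dz) as I1. pose proof (Hsg zs ys Dz Dy) as I2. pose proof (Hsg ys w Dy Dw) as I3.
  rewrite Fz, Cs in I1. rewrite Fyz, Cs in I2. rewrite Fy, Cs in I3.
  unfold tri. eapply Rle_trans; [apply Cmod_triangle|].
  pose proof (Cmod_triangle (seg f w zs) (seg f zs ys)).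
  replace (s * (K * B)) with (s * Cmod (z - w)%C * B + s * Cmod (y - z)%C * B + s * Cmod (w - y)%C * B)
    by (unfold K; ring). lra. }
apply Cmod_eq_0. apply Rle_antisym; [|apply Cmod_ge_0].
apply le_epsilon. intros eps He. rewrite Rplus_0_l.
set (s := Rmin 1 (Rmin (d / (2 * (K + 1))) (eps / (K * B + 1)))).
pose proof (cond_pos d) as Hd0.
assert (Hs0 : 0 < s).
{ unfold s. repeat apply Rmin_glb_lt; [lra| |]; apply Rdiv_lt_0_compat; lra. }
assert (Hs1 : s <= 1) by apply Rmin_l.
assert (Hs2 : s <= d / (2 * (K + 1))) by (unfold s; eapply Rle_trans; [apply Rmin_r|apply Rmin_l]).
assert (Hs3 : s <= eps / (K * B + 1)) by (unfold s; eapply Rle_trans; [apply Rmin_r|apply Rmin_r]).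
eapply Rle_trans; [apply (Hsmall s)|].
- lra.
- apply Rle_lt_trans with (d / (2 * (K + 1)) * (K + 1)); [apply Rmult_le_compat_r; lra|].
  replace (d / (2 * (K + 1)) * (K + 1)) with (d / 2) by (field; lra). lra.
- apply Rle_trans with (eps / (K * B + 1) * (K * B + 1)); [|right; field; lra].
  apply Rmult_le_compat; lra.
Qed.

(** Integrating from the exceptional point itself makes it the apex of all the triangles
    needed, so that [tri_punctured] suffices. Difference quotients, which are
    differentiable away from one point, are the reason for allowing that point. *)
Lemma primitive_punctured (f : C -> C) (w : C) :
  (forall u, Ccont f u) -> (forall u, u <> w -> exists l, Cder f u l) ->
  exists F, forall z, Cder F z (f z).
Proof.
intros Hf Hd. exists (fun z => seg f w z). intros z.
destruct (classic (z = w)) as [->|Hz].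
- apply (seg_antiderivative f _ w 1 Hf); [lra|]. intros y _. rewrite seg_same. ring.
- apply (seg_antiderivative f _ z (Cmod (z - w)%C) Hf).
  + apply Cmod_gt_0. apply Cminus_eq_contra. exact Hz.
  + intros y Hy. pose proof (tri_punctured f w z y Hf Hd Hy) as H. unfold tri in H.
    rewrite (seg_swap f w y Hf) in H.
    replace (seg f w y) with (seg f w z + seg f z y - (seg f w z + seg f z y + - seg f w y))%C by ring.
    rewrite H. ring.
Qed.

(** * Means over circles *)

Definition circ (r t : R) : C := (r * cos t, r * sin t).

Lemma Cmod_circ (r t : R) : 0 <= r -> Cmod (circ r t) = r.
Proof.
intros Hr. unfold Cmod, circ; simpl fst; simpl snd.
replace ((r * cos t) ^ 2 + (r * sin t) ^ 2) with (r ^ 2).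
- apply sqrt_pow2; exact Hr.
- pose proof (sin2_cos2 t) as H. unfold Rsqr in H. nra.
Qed.

Lemma Cmod_le_components (z : C) : Cmod z <= Rabs (Re z) + Rabs (Im z).
Proof.
replace z with (RtoC (Re z) + Ci * RtoC (Im z))%C at 1.
- eapply Rle_trans; [apply Cmod_triangle|]. rewrite Cmod_mult, Cmod_Ci, !Cmod_R. lra.
- apply injective_projections; unfold RtoC, Ci, Cmult, Cplus, Re, Im; simpl; ring.
Qed.

Lemma Rder_circ (r t : R) : Rder (circ r) t (Ci * circ r t)%C.
Proof.
assert (H1 : is_derive (fun x => r * cos x) t (r * - sin t)) by (auto_derive; [exact I|ring]).
assert (H2 : is_derive (fun x => r * sin x) t (r * cos t)) by (auto_derive; [exact I|ring]).
apply Rder_eps. intros eps.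
assert (He : 0 < eps / 2) by (pose proof (cond_pos eps); lra).
destruct (proj2 H1 t (fun P HP => HP) (mkposreal _ He)) as [d1 K1].
destruct (proj2 H2 t (fun P HP => HP) (mkposreal _ He)) as [d2 K2].
assert (Hm : 0 < Rmin d1 d2) by (apply Rmin_glb_lt; apply cond_pos).
exists (mkposreal _ Hm). simpl pos. intros y Hy.
assert (L1 : Rabs (y - t) < d1) by (eapply Rlt_le_trans; [exact Hy|apply Rmin_l]).
assert (L2 : Rabs (y - t) < d2) by (eapply Rlt_le_trans; [exact Hy|apply Rmin_r]).
specialize (K1 y L1). specialize (K2 y L2).
change (Rabs (r * cos y - r * cos t - (y - t) * (r * - sin t)) <= eps / 2 * Rabs (y - t)) in K1.
change (Rabs (r * sin y - r * sin t - (y - t) * (r * cos t)) <= eps / 2 * Rabs (y - t)) in K2.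
eapply Rle_trans; [apply Cmod_le_components|].
replace (Re (circ r y - circ r t - Ci * circ r t * RtoC (y - t))) with
  (r * cos y - r * cos t - (y - t) * (r * - sin t))
  by (unfold circ, Re, Ci, RtoC, Cminus, Cplus, Copp, Cmult; simpl; ring).
replace (Im (circ r y - circ r t - Ci * circ r t * RtoC (y - t))) with
  (r * sin y - r * sin t - (y - t) * (r * cos t))
  by (unfold circ, Im, Ci, RtoC, Cminus, Cplus, Copp, Cmult; simpl; ring).
lra.
Qed.

(** The mean of [g] over the circle of radius [r] about the origin; multiplied by
    [2 i PI] the mean of [u * q u] is the contour integral of [q]. *)
Definition cmean (r : R) (g : C -> C) : C :=
  (RtoC (/ (2 * PI)) * CInt (fun t => g (circ r t)) 0 (2 * PI))%C.

(** Continuity in the plane at the points of the circle, rather than along the circle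
    only: all integrands below are of this kind. *)
Definition circle_cont (r : R) (g : C -> C) : Prop := forall u, Cmod u = r -> Ccont g u.

Lemma Rcont_on_circle (r : R) (g : C -> C) (t : R) :
  0 <= r -> circle_cont r g -> Rcont (fun s => g (circ r s)) t.
Proof.
intros Hr Hg. apply Rcont_comp.
- exact (Rder_Rcont _ _ _ (Rder_circ r t)).
- apply Hg, Cmod_circ, Hr.
Qed.

Lemma circle_correct (r : R) (g : C -> C) : 0 <= r -> circle_cont r g ->
  is_CInt (fun t => g (circ r t)) 0 (2 * PI) (CInt (fun t => g (circ r t)) 0 (2 * PI)).
Proof. intros Hr Hg. apply CInt_correct. intros t _. apply Rcont_on_circle; assumption. Qed.

Lemma cmean_plus (r : R) (f g : C -> C) : 0 <= r -> circle_cont r f -> circle_cont r g ->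
  cmean r (fun u => f u + g u)%C = (cmean r f + cmean r g)%C.
Proof.
intros Hr Hf Hg. unfold cmean. rewrite <- Cmult_plus_distr_l. f_equal. apply CInt_unique.
apply is_CInt_plus; apply circle_correct; assumption.
Qed.

Lemma cmean_scal (r : R) (c : C) (g : C -> C) : 0 <= r -> circle_cont r g ->
  cmean r (fun u => c * g u)%C = (c * cmean r g)%C.
Proof.
intros Hr Hg. unfold cmean.
rewrite (CInt_unique _ _ _ _ (is_CInt_scal c _ _ _ _ (circle_correct r g Hr Hg))). ring.
Qed.

Lemma cmean_ext (r : R) (f g : C -> C) : 0 <= r -> (forall u, Cmod u = r -> f u = g u) ->
  cmean r f = cmean r g.
Proof.
intros Hr H. unfold cmean. f_equal. apply CInt_ext. intros t _. apply H, Cmod_circ, Hr.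
Qed.

Lemma RtoC_2PI_neq_0 : RtoC (2 * PI) <> 0%C.
Proof. intros H. apply RtoC_inj in H. pose proof PI_RGT_0. lra. Qed.

Lemma cmean_const (r : R) (c : C) : cmean r (fun _ => c) = c.
Proof.
unfold cmean. rewrite (CInt_unique _ _ _ _ (is_CInt_const 0 (2 * PI) c)).
rewrite Rminus_0_r, RtoC_inv by (pose proof PI_RGT_0; lra).
rewrite Cmult_assoc, Cinv_l by apply RtoC_2PI_neq_0. ring.
Qed.

Lemma cmean_conj (r : R) (g : C -> C) : 0 <= r -> circle_cont r g ->
  cmean r (fun u => Cconj (g u)) = Cconj (cmean r g).
Proof.
intros Hr Hg. unfold cmean.
rewrite (CInt_unique _ _ _ _ (is_CInt_conj _ _ _ _ (circle_correct r g Hr Hg))).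
rewrite Cmult_conj. f_equal. apply injective_projections; simpl; ring.
Qed.

Lemma cmean_bound (r : R) (g : C -> C) (M : R) : 0 <= r -> circle_cont r g ->
  (forall t, 0 <= t <= 2 * PI -> Cmod (g (circ r t)) <= M) -> Cmod (cmean r g) <= M.
Proof.
intros Hr Hg H. pose proof PI_RGT_0 as Hpi. unfold cmean.
rewrite Cmod_mult, Cmod_R, Rabs_pos_eq by (apply Rlt_le, Rinv_0_lt_compat; lra).
assert (B : Cmod (CInt (fun t => g (circ r t)) 0 (2 * PI)) <= Rabs (2 * PI - 0) * M).
{ eapply is_CInt_bound; [|apply circle_correct; assumption].
  rewrite Rmin_left, Rmax_right by lra. exact H. }
rewrite Rminus_0_r, Rabs_pos_eq in B by lra.
apply (Rmult_le_reg_l (2 * PI)); [lra|]. rewrite <- Rmult_assoc, Rinv_r, Rmult_1_l by lra. exact B.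
Qed.

Lemma cmean_primitive (r : R) (q Q : C -> C) : 0 <= r -> circle_cont r q ->
  (forall u, Cder Q u (q u)) -> cmean r (fun u => u * q u)%C = 0%C.
Proof.
intros Hr Hq HQ. unfold cmean.
assert (H : is_CInt (fun t => q (circ r t) * (Ci * circ r t))%C 0 (2 * PI)
   (Q (circ r (2 * PI)) - Q (circ r 0))%C).
{ apply (is_CInt_Rder (fun t => Q (circ r t))).
  - intros t _. apply Rder_comp; [apply HQ|apply Rder_circ].
  - intros t _. apply Rcont_mult; [apply Rcont_on_circle; assumption|].
    apply (Rcont_on_circle r (fun u => Ci * u)%C); [exact Hr|].
    intros u _. apply Ccont_mult; [apply Ccont_const|apply Ccont_id]. }
replace (circ r (2 * PI)) with (circ r 0) in H
  by (unfold circ; rewrite cos_2PI, sin_2PI, cos_0, sin_0; reflexivity).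
replace (Q (circ r 0) - Q (circ r 0))%C with (RtoC 0) in H by ring.
apply (is_CInt_scal (- Ci)%C) in H.
replace (- Ci * RtoC 0)%C with (RtoC 0) in H by ring.
apply (is_CInt_ext _ (fun t => circ r t * q (circ r t))%C) in H.
- rewrite (CInt_unique _ _ _ _ H). ring.
- intros t _.
  replace (- Ci * (q (circ r t) * (Ci * circ r t)))%C with (- (Ci * Ci) * (circ r t * q (circ r t)))%C by ring.
  replace (Ci * Ci)%C with (RtoC (-1)).
  + rewrite <- RtoC_opp. replace (- (-1)) with 1 by ring. ring.
  + apply injective_projections; unfold RtoC, Ci, Cmult; simpl; ring.
Qed.

Lemma circle_bounded (r : R) (g : C -> C) : 0 <= r -> circle_cont r g ->
  exists B, forall t, 0 <= t <= 2 * PI -> Cmod (g (circ r t)) <= B.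
Proof.
intros Hr Hg. pose proof PI_RGT_0 as Hpi.
destruct (continuity_ab_maj (fun t => Cmod (g (circ r t))) 0 (2 * PI)) as [M [HM _]].
- lra.
- intros t _. apply continuity_pt_filterlim.
  apply (filterlim_locally (fun t => Cmod (g (circ r t)))). intros eps.
  destruct (proj1 (Rcont_eps _ _) (Rcont_on_circle r g t Hr Hg) eps) as [d Hd].
  exists d. intros y Hy. specialize (Hd y Hy). 
  change (Rabs (Cmod (g (circ r y)) - Cmod (g (circ r t))) < eps).
  pose proof (Cmod_minus_ge (g (circ r y)) (g (circ r t))) as H1.
  pose proof (Cmod_minus_ge (g (circ r t)) (g (circ r y))) as H2.
  rewrite Cmod_minus_sym in H2. apply Rabs_lt_between. lra.
- exists (Cmod (g (circ r M))). exact HM.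
Qed.

Lemma Ccont_circle (r : R) (g : C -> C) : (forall u, Ccont g u) -> circle_cont r g.
Proof. intros H u _. apply H. Qed.

Lemma circle_cont_mult (r : R) (f g : C -> C) :
  circle_cont r f -> circle_cont r g -> circle_cont r (fun u => f u * g u)%C.
Proof. intros Hf Hg u Hu. apply Ccont_mult; [apply Hf|apply Hg]; exact Hu. Qed.

Lemma circle_cont_plus (r : R) (f g : C -> C) :
  circle_cont r f -> circle_cont r g -> circle_cont r (fun u => f u + g u)%C.
Proof. intros Hf Hg u Hu. apply Ccont_plus; [apply Hf|apply Hg]; exact Hu. Qed.

Lemma circle_cont_const (r : R) (c : C) : circle_cont r (fun _ => c).
Proof. apply Ccont_circle. intros u; apply Ccont_const. Qed.

Lemma circle_cont_inv (r : R) (g : C -> C) :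
  circle_cont r g -> (forall u, Cmod u = r -> g u <> 0%C) -> circle_cont r (fun u => / g u)%C.
Proof.
intros Hg H u Hu. apply (Ccont_comp (fun u => / u)%C g); [apply Hg, Hu|apply Ccont_inv, H, Hu].
Qed.

Lemma Ccont_pow (n : nat) (z : C) : Ccont (fun u => u ^ n)%C z.
Proof.
induction n as [|n IH].
- apply Ccont_const.
- apply (Ccont_mult (fun u => u) (fun u => u ^ n)%C); [apply Ccont_id|exact IH].
Qed.

Lemma circle_nonzero (r : R) (u : C) : 0 < r -> Cmod u = r -> u <> 0%C.
Proof. intros Hr Hu. apply Cmod_gt_0. lra. Qed.

Lemma circle_cont_inv_pow (r : R) (n : nat) : 0 < r -> circle_cont r (fun u => / u ^ n)%C.
Proof.
intros Hr. apply circle_cont_inv.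
- intros u _. apply Ccont_pow.
- intros u Hu. apply Cpow_nz. exact (circle_nonzero r u Hr Hu).
Qed.

Lemma circle_away (r : R) (w u : C) : Cmod w < r -> Cmod u = r -> (u - w)%C <> 0%C.
Proof. intros Hw Hu. apply Cmod_gt_0. pose proof (Cmod_minus_ge u w). lra. Qed.

Lemma circle_cont_kernel (r : R) (w : C) : Cmod w < r -> circle_cont r (fun u => / (u - w))%C.
Proof.
intros Hw. apply circle_cont_inv.
- intros u _. apply Ccont_plus; [apply Ccont_id|apply Ccont_const].
- intros u Hu. exact (circle_away r w u Hw Hu).
Qed.

Lemma cmean_pow (r : R) (n : nat) : 0 <= r -> cmean r (fun u => u ^ S n)%C = 0%C.
Proof.
intros Hr. apply (cmean_primitive r (fun u => u ^ n)%C (fun u => / RtoC (INR (S n)) * u ^ S n)%C).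
- exact Hr.
- intros u _. apply Ccont_pow.
- intros u. eapply Cder_ext; [reflexivity| |apply Cder_scal, Cder_pow].
  rewrite Cmult_assoc, Cinv_l; [ring|].
  intros H. apply RtoC_inj in H. apply not_0_INR in H; [exact H|discriminate].
Qed.

Lemma circle_conj_pow (r : R) (u : C) (n : nat) : 0 < r -> Cmod u = r ->
  Cconj (u ^ n)%C = (RtoC ((r * r) ^ n) * / u ^ n)%C.
Proof.
intros Hr Hu. pose proof (circle_nonzero r u Hr Hu) as Hu0.
assert (E : (RtoC ((r * r) ^ n) = u ^ n * Cconj (u ^ n))%C).
{ rewrite <- Cmod2_conj, Cmod_pow, Hu. f_equal. rewrite Rpow_mult_distr. ring. }
rewrite E. field. apply Cpow_nz. exact Hu0.
Qed.

(** On the circle of radius [r] the inverse of [u] is its conjugate divided by [r ^ 2]. *)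
Lemma cmean_inv_pow (r : R) (n : nat) : 0 < r -> cmean r (fun u => / u ^ S n)%C = 0%C.
Proof.
intros Hr.
assert (Hrn : (r * r) ^ S n <> 0) by (apply pow_nonzero; nra).
rewrite (cmean_ext r _ (fun u => RtoC (/ (r * r) ^ S n) * Cconj (u ^ S n))%C).
- rewrite cmean_scal, cmean_conj, cmean_pow.
  + replace (Cconj 0%C) with (RtoC 0); [ring|]. apply injective_projections; simpl; ring.
  + lra.
  + lra.
  + intros u _; apply Ccont_pow.
  + lra.
  + intros u _. apply Ccont_conj, Ccont_pow.
- lra.
- intros u Hu. rewrite (circle_conj_pow r u (S n) Hr Hu), Cmult_assoc, <- RtoC_mult, Rinv_l by exact Hrn. ring.
Qed.

(** * Cauchy's formula *)

Definition centire (f : C -> C) : Prop := forall z, exists l, Cder f z l.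

Lemma centire_cont (f : C -> C) : centire f -> forall z, Ccont f z.
Proof. intros Hf z. destruct (Hf z) as [l Hl]. exact (Cder_Ccont _ _ _ Hl). Qed.

(** Extending the quotient by the derivative at [w] makes it continuous there; this is
    all that [primitive_punctured] asks for. *)
Lemma difference_quotient (f : C -> C) (w : C) : centire f ->
  exists q, (forall u, f u = f w + (u - w) * q u)%C /\ (forall u, Ccont q u) /\
    (forall u, u <> w -> exists l, Cder q u l).
Proof.
intros Hf. destruct (Hf w) as [l Hl].
set (q := fun u => if Ceq_dec u w then l else ((f u - f w) * / (u - w))%C).
assert (Hder : forall u, u <> w -> exists m, Cder q u m).
{ intros u Hu. destruct (Hf u) as [k Hk].
  assert (Huw : (u - w)%C <> 0%C) by (apply Cminus_eq_contra; exact Hu).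
  eexists.
  apply (Cder_ext_near (fun y => (f y - f w) * / (y - w))%C _ u _ (Cmod (u - w)%C)).
  - apply Cmod_gt_0. exact Huw.
  - intros y Hy. unfold q. destruct (Ceq_dec y w) as [->|]; [|reflexivity].
    rewrite Cmod_minus_sym in Hy. lra.
  - apply Cder_mult; [exact (Cder_minus _ _ _ _ _ Hk (Cder_const _ _))|].
    apply (Cder_comp (fun y => / y)%C (fun y => y - w)%C);
      [apply Cder_inv; exact Huw|exact (Cder_minus _ _ _ _ _ (Cder_id u) (Cder_const _ _))]. }
exists q. split; [|split; [|exact Hder]].
- intros u. unfold q. destruct (Ceq_dec u w) as [->|Hu]; [ring|].
  field. apply Cminus_eq_contra. exact Hu.
- intros u. destruct (Ceq_dec u w) as [->|Hu].
  + apply Ccont_eps. intros eps.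
    assert (He : 0 < eps / 2) by (pose proof (cond_pos eps); lra).
    destruct (proj1 (Cder_eps _ _ _) Hl (mkposreal _ He)) as [d Hd]. simpl in Hd.
    exists d. intros y Hy. unfold q. destruct (Ceq_dec w w) as [_|n]; [|congruence].
    destruct (Ceq_dec y w) as [->|Hyw].
    * replace (l - l)%C with (RtoC 0) by ring. rewrite Cmod_0. apply cond_pos.
    * specialize (Hd y Hy).
      assert (Hn : (y - w)%C <> 0%C) by (apply Cminus_eq_contra; exact Hyw).
      assert (Hp : 0 < Cmod (y - w)%C) by (apply Cmod_gt_0; exact Hn).
      replace ((f y - f w) * / (y - w) - l)%C with ((f y - f w - l * (y - w)) * / (y - w))%C by (field; exact Hn).
      rewrite Cmod_mult, Cmod_inv by exact Hn.
      apply Rle_lt_trans with (eps / 2 * Cmod (y - w)%C * / Cmod (y - w)%C).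
      -- apply Rmult_le_compat_r; [apply Rlt_le, Rinv_0_lt_compat; exact Hp|exact Hd].
      -- rewrite Rmult_assoc, Rinv_r, Rmult_1_r by lra. pose proof (cond_pos eps). lra.
  + destruct (Hder u Hu) as [m Hm]. exact (Cder_Ccont _ _ _ Hm).
Qed.

Lemma cmean_entire (f : C -> C) (r : R) : 0 <= r -> centire f -> cmean r f = f 0%C.
Proof.
intros Hr Hf. destruct (difference_quotient f 0%C Hf) as (q & Hq & Hc & Hd).
destruct (primitive_punctured q 0%C Hc Hd) as [Q HQ].
rewrite (cmean_ext r f (fun u => f 0%C + u * q u)%C Hr).
- rewrite cmean_plus, cmean_const, (cmean_primitive r q Q).
  + ring.
  + exact Hr.
  + apply Ccont_circle, Hc.
  + exact HQ.
  + exact Hr.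
  + apply circle_cont_const.
  + apply Ccont_circle. intros u. apply Ccont_mult; [apply Ccont_id|apply Hc].
- intros u _. rewrite (Hq u) at 1. f_equal. f_equal. ring.
Qed.

Fixpoint csum (a : nat -> C) (n : nat) : C :=
  match n with O => 0%C | S k => (csum a k + a k)%C end.

(** Geometric expansion of the Cauchy kernel with its remainder, integrated termwise. *)
Lemma kernel_expansion (r : R) (g : C -> C) (w : C) (N : nat) :
  0 < r -> circle_cont r g -> Cmod w < r ->
  cmean r (fun u => g u * (u * / (u - w)))%C =
  (csum (fun n => w ^ n * cmean r (fun u => g u * / u ^ n)%C) N +
   w ^ N * cmean r (fun u => g u * / u ^ N * (u * / (u - w)))%C)%C.
Proof.
intros Hr Hg Hw.
assert (Hr' : 0 <= r) by lra.
assert (Hu : circle_cont r (fun u => u)) by (intros u _; apply Ccont_id).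
assert (Hk := circle_cont_kernel r w Hw).
induction N as [|N IH].
- simpl csum. simpl Cpow.
  rewrite (cmean_ext r (fun u => g u * / (1%C) * (u * / (u - w)))%C (fun u => g u * (u * / (u - w)))%C Hr').
  + ring.
  + intros u _. f_equal. field.
- rewrite IH. simpl csum.
  rewrite (cmean_ext r (fun u => g u * / u ^ N * (u * / (u - w)))%C
    (fun u => g u * / u ^ N + w * (g u * / u ^ S N * (u * / (u - w))))%C Hr').
  + rewrite cmean_plus, cmean_scal.
    * rewrite Cpow_S. ring.
    * exact Hr'.
    * repeat apply circle_cont_mult; try assumption. apply circle_cont_inv_pow; exact Hr.
    * exact Hr'.
    * apply circle_cont_mult; [exact Hg|apply circle_cont_inv_pow; exact Hr].
    * apply circle_cont_mult; [apply circle_cont_const|].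
      repeat apply circle_cont_mult; try assumption. apply circle_cont_inv_pow; exact Hr.
  + intros u Hu1. pose proof (circle_nonzero r u Hr Hu1) as Hu0.
    pose proof (circle_away r w u Hw Hu1) as Huw.
    pose proof (Cpow_nz u N Hu0) as HuN. rewrite Cpow_S. field. repeat split; assumption.
Qed.

Lemma kernel_finite_expansion (r : R) (g : C -> C) (w : C) (N0 : nat) :
  0 < r -> circle_cont r g -> Cmod w < r ->
  (forall n, (N0 <= n)%nat -> cmean r (fun u => g u * / u ^ n)%C = 0%C) ->
  cmean r (fun u => g u * (u * / (u - w)))%C =
  csum (fun n => w ^ n * cmean r (fun u => g u * / u ^ n))%C N0.
Proof.
intros Hr Hg Hw H0.
set (a := fun n => (w ^ n * cmean r (fun u => g u * / u ^ n)%C)%C).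
assert (Hs : forall k, csum a (N0 + k) = csum a N0).
{ induction k as [|k IH].
  - rewrite Nat.add_0_r. reflexivity.
  - rewrite Nat.add_succ_r. simpl csum. rewrite IH. unfold a at 2. rewrite H0 by lia. ring. }
(* The remainder after [N] terms is at most of order [(|w| / r) ^ N]. *)
assert (Hc : circle_cont r (fun u => g u * (u * / (u - w)))%C).
{ apply circle_cont_mult; [exact Hg|]. apply circle_cont_mult; [intros u _; apply Ccont_id|].
  apply circle_cont_kernel; exact Hw. }
destruct (circle_bounded r _ (Rlt_le _ _ Hr) Hc) as [B HB].
set (t := Cmod w / r).
assert (Ht : 0 <= t < 1).
{ unfold t. pose proof (Cmod_ge_0 w). split.
  - apply Rmult_le_pos; [lra|]. apply Rlt_le, Rinv_0_lt_compat; lra.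
  - apply (Rmult_lt_reg_r r); [lra|]. unfold Rdiv. rewrite Rmult_assoc, Rinv_l by lra. lra. }
apply Ceq_minus, Cmod_eq_0. apply Rle_antisym; [|apply Cmod_ge_0].
apply le_epsilon. intros eps He. rewrite Rplus_0_l.
assert (HB1 : 0 < Rabs B + 1) by (pose proof (Rabs_pos B); lra).
destruct (pow_lt_1_zero t ltac:(rewrite Rabs_pos_eq; lra) (eps / (Rabs B + 1)) ltac:(apply Rdiv_lt_0_compat; lra)) as [N HN].
specialize (HN (N0 + N)%nat ltac:(lia)). rewrite Rabs_pos_eq in HN by (apply pow_le; lra).
rewrite (kernel_expansion r g w (N0 + N) Hr Hg Hw). fold a. rewrite Hs.
set (n := (N0 + N)%nat) in *.
replace (csum a N0 + w ^ n * cmean r (fun u => g u * / u ^ n * (u * / (u - w))) - csum a N0)%C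
  with (w ^ n * cmean r (fun u => g u * / u ^ n * (u * / (u - w))))%C by ring.
rewrite Cmod_mult, Cmod_pow.
assert (Hm : Cmod (cmean r (fun u => g u * / u ^ n * (u * / (u - w)))%C) <= / r ^ n * B).
{ apply cmean_bound; [lra| |].
  - apply circle_cont_mult.
    + apply circle_cont_mult; [exact Hg|apply circle_cont_inv_pow; exact Hr].
    + apply circle_cont_mult; [intros u _; apply Ccont_id|apply circle_cont_kernel; exact Hw].
  - intros s Hs'. set (u := circ r s).
    assert (Hu : Cmod u = r) by (apply Cmod_circ; lra).
    replace (g u * / u ^ n * (u * / (u - w)))%C with (/ u ^ n * (g u * (u * / (u - w))))%C by ring.
    rewrite Cmod_mult, Cmod_inv, Cmod_pow, Hu by (apply Cpow_nz, (circle_nonzero r); assumption).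
    apply Rmult_le_compat_l; [apply Rlt_le, Rinv_0_lt_compat, pow_lt; lra|]. apply HB; exact Hs'. }
apply Rle_trans with (Cmod w ^ n * (/ r ^ n * B)).
- apply Rmult_le_compat_l; [apply pow_le, Cmod_ge_0|exact Hm].
- replace (Cmod w ^ n * (/ r ^ n * B)) with (t ^ n * B)
    by (unfold t, Rdiv; rewrite Rpow_mult_distr, pow_inv; ring).
  apply Rle_trans with (t ^ n * (Rabs B + 1)).
  + apply Rmult_le_compat_l; [apply pow_le; lra|]. pose proof (Rle_abs B). lra.
  + apply Rle_trans with (eps / (Rabs B + 1) * (Rabs B + 1)).
    * apply Rmult_le_compat_r; lra.
    * right. field. lra.
Qed.

Lemma cmean_kernel (r : R) (w : C) : Cmod w < r -> cmean r (fun u => u * / (u - w))%C = 1%C.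
Proof.
intros Hw. assert (Hr : 0 < r) by (pose proof (Cmod_ge_0 w); lra).
rewrite (cmean_ext r _ (fun u => 1 * (u * / (u - w)))%C) by (try lra; intros u _; ring).
rewrite (kernel_finite_expansion r (fun _ => 1%C) w 1 Hr (circle_cont_const r 1%C) Hw).
- simpl csum. simpl Cpow.
  rewrite (cmean_ext r _ (fun _ => 1%C)) by (try lra; intros u _; field).
  rewrite cmean_const. ring.
- intros n Hn. destruct n as [|n]; [lia|].
  rewrite (cmean_ext r _ (fun u => / u ^ S n)%C) by (try lra; intros u _; ring).
  apply cmean_inv_pow; exact Hr.
Qed.

(** Write [f u = f w + (u - w) * q u]. The constant part contributes [f w] by
    [cmean_kernel], and [u * q u] has mean zero because [q] has a primitive. *)
Lemma cauchy_formula (f : C -> C) (r : R) (w : C) : centire f -> Cmod w < r ->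
  cmean r (fun u => f u * (u * / (u - w)))%C = f w.
Proof.
intros Hf Hw. assert (Hr : 0 < r) by (pose proof (Cmod_ge_0 w); lra).
assert (Hr' : 0 <= r) by lra.
destruct (difference_quotient f w Hf) as (q & Hq & Hc & Hd).
destruct (primitive_punctured q w Hc Hd) as [Q HQ].
rewrite (cmean_ext r _ (fun u => f w * (u * / (u - w)) + u * q u)%C Hr').
- rewrite cmean_plus, cmean_scal, cmean_kernel, (cmean_primitive r q Q).
  + ring.
  + exact Hr'.
  + apply Ccont_circle, Hc.
  + exact HQ.
  + exact Hw.
  + exact Hr'.
  + apply circle_cont_mult; [intros u _; apply Ccont_id|apply circle_cont_kernel; exact Hw].
  + exact Hr'.
  + apply circle_cont_mult; [apply circle_cont_const|].
    apply circle_cont_mult; [intros u _; apply Ccont_id|apply circle_cont_kernel; exact Hw].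
  + apply Ccont_circle. intros u. apply Ccont_mult; [apply Ccont_id|apply Hc].
- intros u Hu. rewrite (Hq u). field. exact (circle_away r w u Hw Hu).
Qed.

(** * Derivatives and Taylor coefficients of entire functions *)

(** Differentiation under the integral sign, from a quadratic bound on the error of the
    linear approximation of the kernel that is uniform on the circle. *)
Lemma cmean_param_derivative (r rho M : R) (w : C) (K : C -> C -> C) (dK : C -> C) :
  0 <= r -> 0 < rho -> 0 <= M ->
  (forall h, Cmod h < rho -> circle_cont r (K (w + h)%C)) -> circle_cont r dK ->
  (forall h t, Cmod h < rho -> 0 <= t <= 2 * PI ->
    Cmod (K (w + h) (circ r t) - K w (circ r t) - h * dK (circ r t))%C <= M * (Cmod h * Cmod h)) ->
  Cder (fun v => cmean r (K v)) w (cmean r dK).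
Proof.
intros Hr Hrho HM HK HdK Hb. apply Cder_eps. intros eps.
pose proof (cond_pos eps) as He.
assert (Hd : 0 < Rmin rho (eps / (M + 1))) by (apply Rmin_glb_lt; [exact Hrho|apply Rdiv_lt_0_compat; lra]).
exists (mkposreal _ Hd). simpl pos. intros y Hy.
set (h := (y - w)%C) in *.
assert (Ey : y = (w + h)%C) by (unfold h; ring).
assert (H1 : Cmod h < rho) by (eapply Rlt_le_trans; [exact Hy|apply Rmin_l]).
assert (H2 : Cmod h < eps / (M + 1)) by (eapply Rlt_le_trans; [exact Hy|apply Rmin_r]).
pose proof (HK h H1) as C1.
pose proof (HK 0%C ltac:(rewrite Cmod_0; exact Hrho)) as C2.
replace (w + 0)%C with w in C2 by ring.
rewrite Ey.
assert (E : (cmean r (K (w + h)%C) - cmean r (K w) - cmean r dK * h)%C =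
  cmean r (fun u => K (w + h) u + (- (1) * K w u + (- h) * dK u))%C).
{ rewrite !cmean_plus, !cmean_scal; try assumption.
  - ring.
  - apply circle_cont_mult; [apply circle_cont_const|exact C2].
  - apply circle_cont_mult; [apply circle_cont_const|exact HdK].
  - apply circle_cont_plus; (apply circle_cont_mult; [apply circle_cont_const|assumption]). }
rewrite E. apply Rle_trans with (M * (Cmod h * Cmod h)).
- apply cmean_bound.
  + exact Hr.
  + apply circle_cont_plus; [exact C1|].
    apply circle_cont_plus; (apply circle_cont_mult; [apply circle_cont_const|assumption]).
  + intros t Ht. replace (_ + _)%C with
     (K (w + h) (circ r t) - K w (circ r t) - h * dK (circ r t))%C by ring.
    apply Hb; assumption.
- rewrite <- Rmult_assoc. apply Rmult_le_compat_r; [apply Cmod_ge_0|].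
  apply Rle_trans with (M * (eps / (M + 1))).
  + apply Rmult_le_compat_l; lra.
  + apply Rle_trans with ((M + 1) * (eps / (M + 1))).
    * apply Rmult_le_compat_r; [|lra]. apply Rlt_le, Rdiv_lt_0_compat; lra.
    * right. field. lra.
Qed.

Lemma kernel_bounds (r : R) (w h u : C) : Cmod u = r -> Cmod h < (r - Cmod w) / 2 ->
  Cmod w < r ->
  (r - Cmod w) / 2 <= Cmod (u - w)%C /\ (r - Cmod w) / 2 <= Cmod (u - w - h)%C.
Proof.
intros Hu Hh Hw.
pose proof (Cmod_minus_ge u w) as H1. pose proof (Cmod_minus_ge (u - w)%C h) as H2. lra.
Qed.

Lemma circle_cont_kernel2 (r : R) (w : C) : Cmod w < r ->
  circle_cont r (fun u => / (u - w) * / (u - w))%C.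
Proof. intros Hw. apply circle_cont_mult; apply circle_cont_kernel; exact Hw. Qed.

Lemma Cmod_translate_lt (r : R) (w h : C) : Cmod w < r -> Cmod h < (r - Cmod w) / 2 -> Cmod (w + h)%C < r.
Proof. intros Hw Hh. pose proof (Cmod_triangle w h). lra. Qed.

Lemma Cder_cauchy_integral (r : R) (phi : C -> C) (w : C) : circle_cont r phi -> Cmod w < r ->
  Cder (fun v => cmean r (fun u => phi u * / (u - v))%C) w
       (cmean r (fun u => phi u * (/ (u - w) * / (u - w)))%C).
Proof.
intros Hphi Hw. assert (Hr : 0 < r) by (pose proof (Cmod_ge_0 w); lra).
destruct (circle_bounded r phi ltac:(lra) Hphi) as [B HB].
set (rho := (r - Cmod w) / 2). assert (Hrho : 0 < rho) by (unfold rho; lra).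
assert (HB0 : 0 <= B).
{ eapply Rle_trans; [apply Cmod_ge_0|apply (HB 0)]. pose proof PI_RGT_0; lra. }
apply (cmean_param_derivative r rho (B * / rho ^ 3) w (fun v u => phi u * / (u - v))%C
   (fun u => phi u * (/ (u - w) * / (u - w)))%C).
- lra.
- exact Hrho.
- apply Rmult_le_pos; [exact HB0|]. apply Rlt_le, Rinv_0_lt_compat, pow_lt; exact Hrho.
- intros h Hh. apply circle_cont_mult; [exact Hphi|apply circle_cont_kernel].
  apply Cmod_translate_lt; assumption.
- apply circle_cont_mult; [exact Hphi|apply circle_cont_kernel2; exact Hw].
- intros h t Hh Ht. set (u := circ r t).
  assert (Hu : Cmod u = r) by (apply Cmod_circ; lra).
  destruct (kernel_bounds r w h u Hu Hh Hw) as [K1 K2]. fold rho in K1, K2.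
  assert (N1 : (u - w)%C <> 0%C) by (apply Cmod_gt_0; lra).
  assert (N2 : (u - w - h)%C <> 0%C) by (apply Cmod_gt_0; lra).
  replace (phi u * / (u - (w + h)) - phi u * / (u - w) - h * (phi u * (/ (u - w) * / (u - w))))%C with
    (phi u * (/ ((u - w) * (u - w) * (u - w - h)) * (h * h)))%C.
  + rewrite !Cmod_mult, Cmod_inv by (repeat apply Cmult_neq_0; assumption).
    rewrite !Cmod_mult, <- Rmult_assoc.
    apply Rmult_le_compat_r; [pose proof (Cmod_ge_0 h); nra|].
    apply Rmult_le_compat; [apply Cmod_ge_0| |apply HB; exact Ht|].
    * apply Rlt_le, Rinv_0_lt_compat. repeat apply Rmult_lt_0_compat; lra.
    * apply Rinv_le_contravar; [apply pow_lt; exact Hrho|].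
      replace (rho ^ 3) with (rho * rho * rho) by ring.
      apply Rmult_le_compat; [nra|lra| |exact K2]. apply Rmult_le_compat; lra.
  + field. repeat split; try assumption.
    replace (u - (w + h))%C with (u - w - h)%C by ring. exact N2.
Qed.

Lemma Cder_cauchy_integral2 (r : R) (phi : C -> C) (w : C) : circle_cont r phi -> Cmod w < r ->
  Cder (fun v => cmean r (fun u => phi u * (/ (u - v) * / (u - v)))%C) w
       (cmean r (fun u => phi u * (2 * (/ (u - w) * / (u - w) * / (u - w))))%C).
Proof.
intros Hphi Hw. assert (Hr : 0 < r) by (pose proof (Cmod_ge_0 w); lra).
destruct (circle_bounded r phi ltac:(lra) Hphi) as [B HB].
set (rho := (r - Cmod w) / 2). assert (Hrho : 0 < rho) by (unfold rho; lra).
assert (HB0 : 0 <= B).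
{ eapply Rle_trans; [apply Cmod_ge_0|apply (HB 0)]. pose proof PI_RGT_0; lra. }
assert (Hi : 0 < / rho ^ 5) by (apply Rinv_0_lt_compat, pow_lt; exact Hrho).
apply (cmean_param_derivative r rho (B * (/ rho ^ 5 * (8 * r))) w (fun v u => phi u * (/ (u - v) * / (u - v)))%C
   (fun u => phi u * (2 * (/ (u - w) * / (u - w) * / (u - w))))%C).
- lra.
- exact Hrho.
- apply Rmult_le_pos; [exact HB0|]. apply Rmult_le_pos; lra.
- intros h Hh. apply circle_cont_mult; [exact Hphi|apply circle_cont_kernel2].
  apply Cmod_translate_lt; assumption.
- apply circle_cont_mult; [exact Hphi|]. apply circle_cont_mult; [apply circle_cont_const|].
  apply circle_cont_mult; [apply circle_cont_kernel2|apply circle_cont_kernel]; exact Hw.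
- intros h t Hh Ht. set (u := circ r t).
  assert (Hu : Cmod u = r) by (apply Cmod_circ; lra).
  destruct (kernel_bounds r w h u Hu Hh Hw) as [K1 K2]. fold rho in K1, K2.
  assert (N1 : (u - w)%C <> 0%C) by (apply Cmod_gt_0; lra).
  assert (N2 : (u - w - h)%C <> 0%C) by (apply Cmod_gt_0; lra).
  replace (phi u * (/ (u - (w + h)) * / (u - (w + h))) - phi u * (/ (u - w) * / (u - w))
     - h * (phi u * (2 * (/ (u - w) * / (u - w) * / (u - w)))))%C with
    (phi u * (/ ((u - w) * (u - w) * (u - w) * (u - w - h) * (u - w - h)) * (RtoC 3 * (u - w) - RtoC 2 * h)) * (h * h))%C.
  + rewrite (Cmod_mult _ (h * h)%C), (Cmod_mult h h).
    apply Rmult_le_compat_r; [pose proof (Cmod_ge_0 h); nra|].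
    rewrite !Cmod_mult, Cmod_inv by (repeat apply Cmult_neq_0; assumption).
    rewrite !Cmod_mult.
    apply Rmult_le_compat; [apply Cmod_ge_0| |apply HB; exact Ht|].
    * apply Rmult_le_pos; [|apply Cmod_ge_0].
      apply Rlt_le, Rinv_0_lt_compat. repeat apply Rmult_lt_0_compat; lra.
    * apply Rmult_le_compat; [|apply Cmod_ge_0| |].
      -- apply Rlt_le, Rinv_0_lt_compat. repeat apply Rmult_lt_0_compat; lra.
      -- apply Rinv_le_contravar; [apply pow_lt; exact Hrho|].
         replace (rho ^ 5) with (rho * rho * rho * rho * rho) by ring.
         repeat (apply Rmult_le_compat; try lra; repeat apply Rmult_le_pos; try lra).
      -- unfold Cminus at 1. eapply Rle_trans; [apply Cmod_triangle|]. rewrite Cmod_opp, !Cmod_mult, !Cmod_R, !Rabs_pos_eq by lra.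
         pose proof (Cmod_triangle u (- w)%C) as H1. rewrite Cmod_opp, Hu in H1.
         change (u + - w)%C with (u - w)%C in H1. unfold rho in Hh. lra.
  + assert (N3 : (u - (w + h))%C <> 0%C) by (replace (u - (w + h))%C with (u - w - h)%C by ring; exact N2).
    field. repeat split; assumption.
Qed.

(** Cauchy's formula expresses [f], hence [f'], near any point as an integral of an explicit
    kernel, and such an integral can be differentiated once more. *)
Lemma centire_derivative (f f' : C -> C) : (forall z, Cder f z (f' z)) -> centire f'.
Proof.
intros Hf z.
assert (Hfe : centire f) by (intros u; exists (f' u); apply Hf).
set (r := Cmod z + 1).
assert (Hz : Cmod z < r) by (unfold r; lra).
assert (Hr : 0 <= r) by (unfold r; pose proof (Cmod_ge_0 z); lra).
set (phi := fun u => (f u * u)%C).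
assert (Hphi : circle_cont r phi).
{ apply circle_cont_mult; [apply Ccont_circle, centire_cont, Hfe|intros u _; apply Ccont_id]. }
assert (E : forall v, Cmod v < r -> cmean r (fun u => phi u * / (u - v))%C = f v).
{ intros v Hv. rewrite <- (cauchy_formula f r v Hfe Hv). apply cmean_ext; [exact Hr|].
  intros u _. unfold phi. ring. }
assert (E' : forall v, Cmod v < r -> cmean r (fun u => phi u * (/ (u - v) * / (u - v)))%C = f' v).
{ intros v Hv. apply (Cder_unique f v); [|apply Hf].
  apply (Cder_ext_near (fun v => cmean r (fun u => phi u * / (u - v))%C) f v _ (r - Cmod v)).
  - lra.
  - intros y Hy. apply E. pose proof (Cmod_minus_ge y v). lra.
  - apply Cder_cauchy_integral; assumption. }
eexists.
apply (Cder_ext_near (fun v => cmean r (fun u => phi u * (/ (u - v) * / (u - v)))%C) f' z _ 1).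
- lra.
- intros y Hy. apply E'. unfold r. pose proof (Cmod_minus_ge y z). lra.
- apply Cder_cauchy_integral2; assumption.
Qed.

Lemma centire_derivative_ex (f : C -> C) : centire f -> exists f', centire f' /\ forall z, Cder f z (f' z).
Proof.
intros Hf. destruct (functional_choice _ Hf) as [f' Hf']. exists f'. split; [|exact Hf'].
exact (centire_derivative f f' Hf').
Qed.

Lemma centire_quotient (f : C -> C) : centire f ->
  exists q, centire q /\ forall u, f u = (f 0 + u * q u)%C.
Proof.
intros Hf. destruct (difference_quotient f 0%C Hf) as (q & Hq & Hc & Hd).
destruct (primitive_punctured q 0%C Hc Hd) as [Q HQ].
exists q. split; [exact (centire_derivative Q q HQ)|].
intros u. rewrite (Hq u) at 1. ring.
Qed.

(** Dividing [f - f 0] by the variable lowers the index and keeps the function entire,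
    which reduces the claim to the mean value property. *)
Lemma taylor_coefficient (n : nat) (f : C -> C) : centire f ->
  exists a, forall r, 0 < r -> cmean r (fun u => f u * / u ^ n)%C = a.
Proof.
revert f. induction n as [|n IH]; intros f Hf.
- exists (f 0%C). intros r Hr. rewrite <- (cmean_entire f r ltac:(lra) Hf).
  apply cmean_ext; [lra|]. intros u _. simpl Cpow. field.
- destruct (centire_quotient f Hf) as (q & Hq & E). destruct (IH q Hq) as [a Ha].
  exists a. intros r Hr. rewrite <- (Ha r Hr).
  assert (Hr' : 0 <= r) by lra.
  rewrite (cmean_ext r _ (fun u => f 0%C * / u ^ S n + q u * / u ^ n)%C Hr').
  + rewrite cmean_plus, cmean_scal, cmean_inv_pow.
    * ring.
    * exact Hr.
    * exact Hr'.
    * apply circle_cont_inv_pow; exact Hr.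
    * exact Hr'.
    * apply circle_cont_mult; [apply circle_cont_const|apply circle_cont_inv_pow; exact Hr].
    * apply circle_cont_mult; [apply Ccont_circle, centire_cont, Hq|apply circle_cont_inv_pow; exact Hr].
  + intros u Hu. pose proof (circle_nonzero r u Hr Hu) as Hu0.
    rewrite (E u), Cpow_S. field. split; [apply Cpow_nz|]; exact Hu0.
Qed.

Lemma centire_mult (f g : C -> C) : centire f -> centire g -> centire (fun u => f u * g u)%C.
Proof.
intros Hf Hg z. destruct (Hf z) as [a Ha]. destruct (Hg z) as [b Hb].
eexists. apply Cder_mult; eassumption.
Qed.

Lemma centire_plus (f g : C -> C) : centire f -> centire g -> centire (fun u => f u + g u)%C.
Proof.
intros Hf Hg z. destruct (Hf z) as [a Ha]. destruct (Hg z) as [b Hb].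
eexists. apply Cder_plus; eassumption.
Qed.

Lemma centire_const (c : C) : centire (fun _ => c).
Proof. intros z. eexists. apply Cder_const. Qed.

Lemma centire_pow (n : nat) : centire (fun u => u ^ n)%C.
Proof.
destruct n as [|n]; intros z; eexists; [exact (Cder_const 1%C z)|exact (Cder_pow n z)].
Qed.

(** * Entire functions with real part of polynomial growth *)

Lemma cmean_le_re (r : R) (g h : C -> C) : 0 <= r -> circle_cont r g -> circle_cont r h ->
  (forall u, Cmod u = r -> Cmod (g u) <= Re (h u)) -> Cmod (cmean r g) <= Re (cmean r h).
Proof.
intros Hr Hg Hh H. pose proof PI_RGT_0 as Hpi. unfold cmean.
rewrite Cmod_mult, Cmod_R, Rabs_pos_eq by (apply Rlt_le, Rinv_0_lt_compat; lra).
rewrite re_scal_l. apply Rmult_le_compat_l; [apply Rlt_le, Rinv_0_lt_compat; lra|].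
pose proof (circle_correct r g Hr Hg) as Ig. pose proof (circle_correct r h Hr Hh) as Ih.
apply is_CInt_components in Ih as [Ih _].
rewrite <- Cmod_norm_R.
apply (norm_RInt_le (V:=C_R_NormedModule) (fun t => g (circ r t)) (fun t => Re (h (circ r t))) 0 (2 * PI)).
- lra.
- intros t _. rewrite Cmod_norm_R. apply H, Cmod_circ, Hr.
- exact Ig.
- exact Ih.
Qed.

(** Adding to [L] its conjugate and subtracting the constant [2 * M] does not change the
    coefficients of positive index, since the conjugate only has coefficients of
    nonpositive index. The function thus obtained is real and nonpositive, so the mean of
    its modulus is minus its mean. *)
Lemma borel_caratheodory_coefficient (L : C -> C) (r M : R) (n : nat) : centire L -> 0 < r ->
  (forall u, Cmod u = r -> Re (L u) <= M) ->
  Cmod (cmean r (fun u => L u * / u ^ S n)%C) <= (2 * M - 2 * Re (L 0%C)) / r ^ S n.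
Proof.
intros HL Hr HM. assert (Hr' : 0 <= r) by lra.
set (N := S n).
assert (HLc : circle_cont r L) by (apply Ccont_circle, centire_cont, HL).
assert (Hip : circle_cont r (fun u => / u ^ N)%C) by (apply circle_cont_inv_pow; exact Hr).
assert (Hcc : circle_cont r (fun u => Cconj (L u))).
{ intros u Hu. apply Ccont_conj, HLc, Hu. }
assert (Hconj : cmean r (fun u => Cconj (L u) * / u ^ N)%C = 0%C).
{ assert (Hrn : (r * r) ^ N <> 0) by (apply pow_nonzero; nra).
  rewrite (cmean_ext r _ (fun u => RtoC (/ (r * r) ^ N) * Cconj (L u * u ^ N))%C Hr').
  - rewrite cmean_scal, (cmean_conj r (fun u => L u * u ^ N)%C).
    + rewrite (cmean_entire (fun u => L u * u ^ N)%C r Hr' (centire_mult _ _ HL (centire_pow N))).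
      unfold N. rewrite Cpow_S. replace (L 0 * (0 * 0 ^ n))%C with (RtoC 0) by ring.
      replace (Cconj 0%C) with (RtoC 0); [ring|]. apply injective_projections; simpl; ring.
    + exact Hr'.
    + apply Ccont_circle, centire_cont, centire_mult; [exact HL|apply centire_pow].
    + exact Hr'.
    + intros u _. apply (Ccont_conj (fun u => L u * u ^ N)%C).
      apply centire_cont, centire_mult; [exact HL|apply centire_pow].
  - intros u Hu. rewrite Cmult_conj, (circle_conj_pow r u N Hr Hu).
    replace (RtoC (/ (r * r) ^ N) * (Cconj (L u) * (RtoC ((r * r) ^ N) * / u ^ N)))%C with
     ((RtoC (/ (r * r) ^ N) * RtoC ((r * r) ^ N)) * (Cconj (L u) * / u ^ N))%C by ring.
    rewrite <- RtoC_mult, Rinv_l by exact Hrn. ring. }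
assert (E : cmean r (fun u => L u * / u ^ N)%C =
  cmean r (fun u => (L u * / u ^ N + Cconj (L u) * / u ^ N) + (- RtoC (2 * M)) * / u ^ N)%C).
{ rewrite !cmean_plus, cmean_scal, Hconj; try exact Hr'.
  - unfold N. rewrite cmean_inv_pow by exact Hr. ring.
  - exact Hip.
  - apply circle_cont_mult; assumption.
  - apply circle_cont_mult; assumption.
  - apply circle_cont_plus; apply circle_cont_mult; assumption.
  - apply circle_cont_mult; [apply circle_cont_const|exact Hip]. }
rewrite E.
(* [Re h] is the modulus of the integrand on the circle, and [h] is entire, so its mean is its value at [0]. *)
set (h := fun u => (RtoC (2 * M / r ^ N) + RtoC (- (2 / r ^ N)) * L u)%C).
assert (Hh : cmean r h = (RtoC (2 * M / r ^ N) + RtoC (- (2 / r ^ N)) * L 0%C)%C).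
{ apply cmean_entire; [exact Hr'|]. apply centire_plus; [apply centire_const|].
  apply centire_mult; [apply centire_const|exact HL]. }
replace ((2 * M - 2 * Re (L 0%C)) / r ^ N) with (Re (cmean r h)).
- apply cmean_le_re.
  + exact Hr'.
  + apply circle_cont_plus; [apply circle_cont_plus; apply circle_cont_mult; assumption|].
    apply circle_cont_mult; [apply circle_cont_const|exact Hip].
  + apply circle_cont_plus; [apply circle_cont_const|].
    apply circle_cont_mult; [apply circle_cont_const|exact HLc].
  + intros u Hu. pose proof (circle_nonzero r u Hr Hu) as Hu0.
    replace ((L u * / u ^ N + Cconj (L u) * / u ^ N) + (- RtoC (2 * M)) * / u ^ N)%C with
      (RtoC (2 * Re (L u) - 2 * M) * / u ^ N)%C.
    * rewrite Cmod_mult, Cmod_inv, Cmod_pow, Cmod_R, Hu by (apply Cpow_nz; exact Hu0).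
      specialize (HM u Hu). rewrite Rabs_left1 by lra.
      unfold h. rewrite re_plus, re_RtoC, re_scal_l. right. unfold Rdiv. ring.
    * replace (RtoC (2 * Re (L u) - 2 * M)) with (L u + Cconj (L u) - RtoC (2 * M))%C; [ring|].
      apply injective_projections; unfold Cconj, Cplus, Cminus, Copp, RtoC, Re; simpl; ring.
- rewrite Hh, re_plus, re_RtoC, re_scal_l. field. apply pow_nonzero; lra.
Qed.

(** By [borel_caratheodory_coefficient] the coefficient of index [n] is at most of order
    [r ^ k / r ^ n]; being independent of [r], it vanishes for [n > k]. *)
Lemma re_polynomial_growth (L : C -> C) (A : R) (k : nat) : centire L -> 0 <= A ->
  (forall z, Re (L z) <= A * (1 + Cmod z) ^ k) ->
  exists a, forall z, L z = csum (fun n => a n * z ^ n)%C (S k).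
Proof.
intros HL HA HG.
destruct (functional_choice (fun n a => forall r, 0 < r -> cmean r (fun u => L u * / u ^ n)%C = a)
   (fun n => taylor_coefficient n L HL)) as [a Ha].
assert (Hz : forall n, (S k <= n)%nat -> a n = 0%C).
{ intros n Hn. destruct n as [|n]; [lia|].
  apply Cmod_eq_0. apply Rle_antisym; [|apply Cmod_ge_0].
  apply le_epsilon. intros eps He. rewrite Rplus_0_l.
  set (B := 2 * A * 2 ^ k + 2 * Rabs (Re (L 0%C))).
  pose proof (Rabs_pos (Re (L 0%C))) as Hp0. pose proof (pow_lt 2 k ltac:(lra)) as H2k.
  assert (HB : 0 <= B) by (unfold B; nra).
  set (r := Rmax 1 (B / eps)).
  assert (Hr1 : 1 <= r) by apply Rmax_l. assert (Hr2 : B / eps <= r) by apply Rmax_r.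
  rewrite <- (Ha (S n) r ltac:(lra)).
  eapply Rle_trans; [apply (borel_caratheodory_coefficient L r (A * (1 + r) ^ k) n HL ltac:(lra))|].
  - intros u Hu. rewrite <- Hu. apply HG.
  - assert (Hpow : (1 + r) ^ k <= 2 ^ k * r ^ k).
    { rewrite <- Rpow_mult_distr. apply pow_incr. lra. }
    pose proof (pow_R1_Rle r k Hr1) as Hrk.
    assert (Hnum : 2 * (A * (1 + r) ^ k) - 2 * Re (L 0%C) <= B * r ^ k).
    { unfold B. pose proof (Rle_abs (- Re (L 0%C))) as Habs. rewrite Rabs_Ropp in Habs.
      assert (A * (1 + r) ^ k <= A * (2 ^ k * r ^ k)) by (apply Rmult_le_compat_l; assumption). nra. }
    assert (Hrn : r * r ^ k <= r ^ S n).
    { change (r * r ^ k) with (r ^ S k). apply Rle_pow; [exact Hr1|lia]. }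
    assert (Hrk0 : 0 < r ^ k) by lra.
    apply (Rmult_le_reg_r (r ^ S n)); [apply pow_lt; lra|].
    unfold Rdiv. rewrite Rmult_assoc, Rinv_l, Rmult_1_r by (apply pow_nonzero; lra).
    apply Rle_trans with (B * r ^ k); [exact Hnum|].
    apply Rle_trans with (eps * (r * r ^ k)); [|apply Rmult_le_compat_l; lra].
    rewrite <- Rmult_assoc. apply Rmult_le_compat_r; [lra|].
    apply Rle_trans with (eps * (B / eps)); [right; field; lra|apply Rmult_le_compat_l; lra]. }
exists a. intros z. set (r := Cmod z + 1).
assert (Hr : 0 < r) by (unfold r; pose proof (Cmod_ge_0 z); lra).
assert (Hzr : Cmod z < r) by (unfold r; lra).
rewrite <- (cauchy_formula L r z HL Hzr).
rewrite (kernel_finite_expansion r L z (S k) Hr).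
- assert (E : forall N, csum (fun n => z ^ n * cmean r (fun u => L u * / u ^ n))%C N = csum (fun n => a n * z ^ n)%C N).
  { induction N as [|N IH]; [reflexivity|]. cbn [csum]. rewrite IH, (Ha N r Hr). ring. }
  apply E.
- apply Ccont_circle, centire_cont, HL.
- exact Hzr.
- intros n Hn. rewrite (Ha n r Hr). apply Hz, Hn.
Qed.

(** * The complex exponential and logarithms of entire functions *)

Definition Cexp (z : C) : C := (exp (Re z) * cos (Im z), exp (Re z) * sin (Im z)).

Lemma Cexp_plus (a b : C) : Cexp (a + b)%C = (Cexp a * Cexp b)%C.
Proof.
unfold Cexp. rewrite re_plus, im_plus, exp_plus, cos_plus, sin_plus.
apply injective_projections; unfold Cmult; simpl; ring.
Qed.

Lemma Cexp_0 : Cexp 0%C = 1%C.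
Proof.
unfold Cexp. change (Re 0%C) with 0. change (Im 0%C) with 0.
rewrite exp_0, cos_0, sin_0. apply injective_projections; unfold RtoC; simpl; ring.
Qed.

Lemma Cexp_opp_l (a : C) : (Cexp (- a) * Cexp a)%C = 1%C.
Proof. rewrite <- Cexp_plus, <- Cexp_0. f_equal. ring. Qed.

Lemma Cexp_neq_0 (a : C) : Cexp a <> 0%C.
Proof.
intros H. pose proof (Cexp_opp_l a) as E. rewrite H in E.
replace (Cexp (- a) * 0)%C with (RtoC 0) in E by ring. apply RtoC_inj in E. lra.
Qed.

Lemma Cmod_Cexp (z : C) : Cmod (Cexp z) = exp (Re z).
Proof.
unfold Cexp. fold (circ (exp (Re z)) (Im z)). apply Cmod_circ, Rlt_le, exp_pos.
Qed.

Lemma real_derivative_eps (f : R -> R) (t l : R) : is_derive f t l ->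
  forall eps : R, 0 < eps -> exists d : posreal, forall y, Rabs (y - t) < d ->
    Rabs (f y - f t - (y - t) * l) <= eps * Rabs (y - t).
Proof.
intros H eps He. destruct (proj2 H t (fun P HP => HP) (mkposreal _ He)) as [d Hd].
exists d. intros y Hy. exact (Hd y Hy).
Qed.

(** Only the point [0] needs an estimate; elsewhere the functional equation applies. *)
Lemma Cder_Cexp_0 : Cder Cexp 0%C 1%C.
Proof.
apply Cder_eps. intros eps.
set (e := Rmin 1 (eps / 7)).
assert (He : 0 < e) by (apply Rmin_glb_lt; [lra|pose proof (cond_pos eps); lra]).
assert (He1 : e <= 1) by apply Rmin_l. assert (He2 : e <= eps / 7) by apply Rmin_r.
assert (D1 : is_derive exp 0 1) by (auto_derive; [exact I|rewrite exp_0; ring]).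
assert (D2 : is_derive cos 0 0) by (auto_derive; [exact I|rewrite sin_0; ring]).
assert (D3 : is_derive sin 0 1) by (auto_derive; [exact I|rewrite cos_0; ring]).
destruct (real_derivative_eps _ _ _ D1 e He) as [d1 K1].
destruct (real_derivative_eps _ _ _ D2 e He) as [d2 K2].
destruct (real_derivative_eps _ _ _ D3 e He) as [d3 K3].
assert (Hd : 0 < Rmin e (Rmin d1 (Rmin d2 d3))) by (apply Rmin_glb_lt; [exact He|repeat apply Rmin_glb_lt; apply cond_pos]).
exists (mkposreal _ Hd). simpl pos. intros h Hh.
replace (h - 0)%C with h in * by ring. rewrite Cexp_0.
replace (Cexp h - 1 - 1 * h)%C with (Cexp h - 1 - h)%C by ring.
pose proof (Rmin_l e (Rmin d1 (Rmin d2 d3))) as M0. pose proof (Rmin_r e (Rmin d1 (Rmin d2 d3))) as M1.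
pose proof (Rmin_l d1 (Rmin d2 d3)) as M2. pose proof (Rmin_r d1 (Rmin d2 d3)) as M3.
pose proof (Rmin_l d2 d3) as M4. pose proof (Rmin_r d2 d3) as M5.
pose proof (Rmax_Cmod h) as Hmax.
set (x := Re h). set (y := Im h).
assert (Hx : Rabs x <= Cmod h) by (eapply Rle_trans; [apply Rmax_l|exact Hmax]).
assert (Hy : Rabs y <= Cmod h) by (eapply Rle_trans; [apply Rmax_r|exact Hmax]).
specialize (K1 x). specialize (K2 y). specialize (K3 y).
rewrite Rminus_0_r in K1, K2, K3. rewrite exp_0 in K1. rewrite cos_0 in K2. rewrite sin_0 in K3.
specialize (K1 ltac:(lra)). specialize (K2 ltac:(lra)). specialize (K3 ltac:(lra)).
eapply Rle_trans; [apply Cmod_le_components|].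
assert (E1 : Re (Cexp h - 1 - h)%C = (exp x - 1 - x * 1) * cos y + (1 + x) * (cos y - 1 - y * 0)).
{ unfold Cminus. rewrite !re_plus, !re_opp, re_RtoC. unfold Cexp. fold x y. change (Re (?a, ?b)) with a. ring. }
assert (E2 : Im (Cexp h - 1 - h)%C = (exp x - 1 - x * 1) * sin y + (1 + x) * (sin y - 0 - y * 1) + x * y).
{ unfold Cminus. rewrite !im_plus, !im_opp, im_RtoC. unfold Cexp. fold x y. change (Im (?a, ?b)) with b. ring. }
rewrite E1, E2.
pose proof (Rabs_pos x) as Px. pose proof (Rabs_pos y) as Py.
assert (C1 : Rabs (cos y) <= 1) by (apply Rabs_le, COS_bound).
assert (C2 : Rabs (sin y) <= 1) by (apply Rabs_le, SIN_bound).
assert (C3 : Rabs (1 + x) <= 2).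
{ eapply Rle_trans; [apply Rabs_triang|]. rewrite Rabs_R1. lra. }
assert (B1 : Rabs ((exp x - 1 - x * 1) * cos y) <= e * Rabs x).
{ rewrite Rabs_mult. pose proof (Rabs_pos (exp x - 1 - x * 1)). pose proof (Rabs_pos (cos y)). nra. }
assert (B2 : Rabs ((exp x - 1 - x * 1) * sin y) <= e * Rabs x).
{ rewrite Rabs_mult. pose proof (Rabs_pos (exp x - 1 - x * 1)). pose proof (Rabs_pos (sin y)). nra. }
assert (B3 : Rabs ((1 + x) * (cos y - 1 - y * 0)) <= 2 * (e * Rabs y)).
{ rewrite Rabs_mult. apply Rmult_le_compat; try apply Rabs_pos; assumption. }
assert (B4 : Rabs ((1 + x) * (sin y - 0 - y * 1)) <= 2 * (e * Rabs y)).
{ rewrite Rabs_mult. apply Rmult_le_compat; try apply Rabs_pos; assumption. }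
assert (B5 : Rabs (x * y) <= e * Rabs y).
{ rewrite Rabs_mult. apply Rmult_le_compat_r; lra. }
pose proof (Rabs_triang ((exp x - 1 - x * 1) * cos y) ((1 + x) * (cos y - 1 - y * 0))) as T1.
pose proof (Rabs_triang ((exp x - 1 - x * 1) * sin y + (1 + x) * (sin y - 0 - y * 1)) (x * y)) as T2.
pose proof (Rabs_triang ((exp x - 1 - x * 1) * sin y) ((1 + x) * (sin y - 0 - y * 1))) as T3.
assert (S1 : e * Rabs x <= e * Cmod h) by (apply Rmult_le_compat_l; lra).
assert (S2 : e * Rabs y <= e * Cmod h) by (apply Rmult_le_compat_l; lra).
apply Rle_trans with (7 * (e * Cmod h)); [lra|].
rewrite <- Rmult_assoc. apply Rmult_le_compat_r; [apply Cmod_ge_0|lra].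
Qed.

Lemma Cder_Cexp (z : C) : Cder Cexp z (Cexp z).
Proof.
assert (H1 : Cder (fun u => u - z)%C z (1 - 0)%C) by exact (Cder_minus _ _ z _ _ (Cder_id z) (Cder_const z z)).
assert (H0 : Cder Cexp (z - z)%C 1%C) by (replace (z - z)%C with (RtoC 0) by ring; exact Cder_Cexp_0).
eapply Cder_ext; [| |exact (Cder_scal _ (Cexp z) z _ (Cder_comp Cexp (fun u => u - z)%C z _ _ H0 H1))].
- intros u. cbv beta. rewrite <- Cexp_plus. f_equal. ring.
- ring.
Qed.

Lemma Cexp_surjective (z : C) : z <> 0%C -> exists w, Cexp w = z.
Proof.
intros Hz. assert (Hp : 0 < Cmod z) by (apply Cmod_gt_0; exact Hz).
set (a := Re z / Cmod z). set (b := Im z / Cmod z).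
assert (Hab : a * a + b * b = 1).
{ unfold a, b. pose proof (Cmod2_alt z) as H. field_simplify; [|lra].
  rewrite <- H. field. lra. }
assert (Ha : -1 <= a <= 1) by nra.
(* [acos] takes values in [[0, PI]], where the sine is nonnegative. *)
set (t := if Rle_dec 0 b then acos a else - acos a).
assert (Hcos : cos t = a).
{ unfold t. destruct (Rle_dec 0 b); [|rewrite cos_neg]; apply cos_acos; exact Ha. }
assert (Hsin : sin t = b).
{ unfold t. destruct (Rle_dec 0 b) as [Hb|Hb].
  - rewrite sin_acos by exact Ha. replace (1 - Rsqr a) with (b * b) by (unfold Rsqr; lra).
    apply sqrt_square; exact Hb.
  - rewrite sin_neg, sin_acos by exact Ha. replace (1 - Rsqr a) with ((- b) * (- b)) by (unfold Rsqr; lra).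
    rewrite sqrt_square by lra. ring. }
exists (ln (Cmod z), t). unfold Cexp. change (Re (?x, ?y)) with x. change (Im (?x, ?y)) with y.
rewrite exp_ln, Hcos, Hsin by exact Hp.
apply injective_projections; unfold a, b, Re, Im; simpl; field; lra.
Qed.

Lemma zero_derivative (F : C -> C) : (forall z, Cder F z 0%C) -> forall z, F z = F 0%C.
Proof.
intros H z.
pose proof (seg_primitive (fun _ => 0%C) F 0%C z (Ccont_const 0%C) H) as E1.
pose proof (seg_primitive (fun _ => 0%C) (fun _ => 0%C) 0%C z (Ccont_const 0%C) (Cder_const 0%C)) as E2.
rewrite E1 in E2. apply Ceq_minus. rewrite E2. ring.
Qed.

(** A primitive of [G' / G] is a logarithm of [G] up to a multiplicative constant, and
    every nonzero constant is an exponential. *)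
Lemma entire_logarithm (G : C -> C) : centire G -> (forall z, G z <> 0%C) ->
  exists L, centire L /\ forall z, G z = Cexp (L z).
Proof.
intros HG Hn. destruct (centire_derivative_ex G HG) as (G' & HG' & Hd).
assert (Hi : centire (fun u => / G u)%C).
{ intros z. eexists. apply (Cder_comp (fun u => / u)%C G); [apply Cder_inv, Hn|apply Hd]. }
pose proof (centire_mult _ _ HG' Hi) as Hq.
destruct (primitive_punctured (fun u => G' u * / G u)%C 0%C (centire_cont _ Hq) (fun u _ => Hq u)) as [l Hl].
assert (Hz : forall z, Cder (fun u => G u * Cexp (- l u))%C z 0%C).
{ intros z. eapply Cder_ext; [reflexivity| |
   exact (Cder_mult _ _ z _ _ (Hd z) (Cder_comp Cexp _ z _ _ (Cder_Cexp _) (Cder_opp _ _ _ (Hl z))))].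
  cbv beta. field. apply Hn. }
pose proof (zero_derivative _ Hz) as Hc. cbv beta in Hc.
destruct (Cexp_surjective (G 0 * Cexp (- l 0))%C) as [d Hdc].
{ apply Cmult_neq_0; [apply Hn|apply Cexp_neq_0]. }
exists (fun z => l z + d)%C. split.
- apply (centire_plus l (fun _ => d)); [intros z; eexists; apply Hl|apply centire_const].
- intros z. rewrite Cexp_plus, Hdc, <- (Hc z).
  replace (Cexp (l z) * (G z * Cexp (- l z)))%C with (G z * (Cexp (- l z) * Cexp (l z)))%C by ring.
  rewrite Cexp_opp_l. ring.
Qed.

(** * Polynomials *)

(** [poly n a f]: the function [f] is a polynomial of degree at most [n] whose coefficient
    of index [n] is [a]. Describing this through successive derivatives makes stability
    under sums, products, translations and differentiation immediate, without any
    bookkeeping of coefficients. *)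
Fixpoint poly (n : nat) (a : C) (f : C -> C) : Prop :=
  match n with
  | O => forall z, f z = a
  | S m => exists g, (forall z, Cder f z (g z)) /\ poly m (RtoC (INR (S m)) * a)%C g
  end.

Definition ispoly (f : C -> C) : Prop := exists n a, poly n a f.

Lemma INR_S_neq_0 (n : nat) : RtoC (INR (S n)) <> 0%C.
Proof. intros H. apply RtoC_inj in H. exact (not_0_INR (S n) (Nat.neq_succ_0 n) H). Qed.

Lemma poly_ext (n : nat) (a b : C) (f g : C -> C) :
  (forall z, f z = g z) -> a = b -> poly n a f -> poly n b g.
Proof.
intros H <-. destruct n as [|n]; simpl.
- intros Hf z. rewrite <- H. apply Hf.
- intros (h & Hh & Hp). exists h. split; [|exact Hp].
  intros z. exact (Cder_ext f g z _ _ H eq_refl (Hh z)).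
Qed.

Lemma poly_plus (n : nat) : forall a b f g, poly n a f -> poly n b g -> poly n (a + b)%C (fun z => f z + g z)%C.
Proof.
induction n as [|n IH]; intros a b f g.
- simpl. intros Hf Hg z. rewrite Hf, Hg. reflexivity.
- intros (f' & Hf & Pf) (g' & Hg & Pg). exists (fun z => f' z + g' z)%C. split.
  + intros z. apply Cder_plus; [apply Hf|apply Hg].
  + eapply poly_ext; [| |exact (IH _ _ _ _ Pf Pg)]; [reflexivity|]. ring.
Qed.

Lemma poly_scal (n : nat) : forall c a f, poly n a f -> poly n (c * a)%C (fun z => c * f z)%C.
Proof.
induction n as [|n IH]; intros c a f.
- simpl. intros Hf z. rewrite Hf. reflexivity.
- intros (f' & Hf & Pf). exists (fun z => c * f' z)%C. split.
  + intros z. apply Cder_scal, Hf.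
  + eapply poly_ext; [| |exact (IH c _ _ Pf)]; [reflexivity|]. ring.
Qed.

Lemma poly_shift (n : nat) : forall c a f, poly n a f -> poly n a (fun z => f (z + c)%C).
Proof.
induction n as [|n IH]; intros c a f.
- simpl. intros Hf z. apply Hf.
- intros (f' & Hf & Pf). exists (fun z => f' (z + c))%C. split.
  + intros z. eapply Cder_ext; [reflexivity| |
      exact (Cder_comp f (fun u => u + c)%C z _ _ (Hf _) (Cder_plus _ _ _ _ _ (Cder_id z) (Cder_const c z)))].
    ring.
  + exact (IH c _ _ Pf).
Qed.

Lemma poly_zero (n : nat) : poly n 0%C (fun _ => 0%C).
Proof.
induction n as [|n IH].
- intros z; reflexivity.
- exists (fun _ => 0%C). split; [intros z; apply Cder_const|].
  eapply poly_ext; [| |exact IH]; [reflexivity|ring].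
Qed.

Lemma poly_succ (n : nat) : forall a f, poly n a f -> poly (S n) 0%C f.
Proof.
induction n as [|n IH]; intros a f.
- simpl. intros Hf. exists (fun _ => 0%C). split.
  + intros z. eapply Cder_ext; [| |exact (Cder_const a z)]; [intros u; symmetry; apply Hf|reflexivity].
  + intros z. ring.
- intros (f' & Hf & Pf). exists f'. split; [exact Hf|].
  eapply poly_ext; [| |exact (IH _ _ Pf)]; [reflexivity|ring].
Qed.

Lemma poly_raise (n k : nat) (a : C) (f : C -> C) : poly n a f -> poly (k + S n) 0%C f.
Proof.
intros H. induction k as [|k IH].
- exact (poly_succ n a f H).
- exact (poly_succ _ _ _ IH).
Qed.

Lemma poly_mult (k : nat) : forall n m, (n + m = k)%nat -> forall a b f g,
  poly n a f -> poly m b g -> poly (n + m) (a * b)%C (fun z => f z * g z)%C.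
Proof.
induction k as [|k IH]; intros n m Hk a b f g Hf Hg.
- assert (n = O) by lia. assert (m = O) by lia. subst n m. simpl in *. intros z. rewrite Hf, Hg. reflexivity.
- destruct n as [|n].
  + eapply poly_ext; [| |exact (poly_scal m a b g Hg)]; [|reflexivity].
    intros z. simpl in Hf. rewrite Hf. reflexivity.
  + destruct m as [|m].
    * rewrite Nat.add_0_r. eapply poly_ext; [| |exact (poly_scal _ b a f Hf)]; [|ring].
      intros z. simpl in Hg. rewrite Hg. ring.
    * destruct Hf as (f' & Hf & Pf). destruct Hg as (g' & Hg & Pg).
      assert (Pf0 : poly (S n) a f) by (exists f'; split; assumption).
      assert (Pg0 : poly (S m) b g) by (exists g'; split; assumption).
      exists (fun z => f' z * g z + f z * g' z)%C. split.
      -- intros z. apply Cder_mult; [apply Hf|apply Hg].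
      -- pose proof (IH n (S m) ltac:(lia) _ _ _ _ Pf Pg0) as Q1.
         pose proof (IH (S n) m ltac:(lia) _ _ _ _ Pf0 Pg) as Q2.
         replace (S n + m)%nat with (n + S m)%nat in Q2 by lia.
         eapply poly_ext; [| |exact (poly_plus _ _ _ _ _ Q1 Q2)]; [reflexivity|].
         replace (S (n + S m)) with (S n + S m)%nat by lia. rewrite plus_INR, RtoC_plus. ring.
Qed.

Lemma poly_derivative (n : nat) (a : C) (f f' : C -> C) :
  (forall z, Cder f z (f' z)) -> poly n a f -> poly n 0%C f'.
Proof.
intros Hd. destruct n as [|n].
- simpl. intros Hf z. apply (Cder_unique f z); [apply Hd|].
  eapply Cder_ext; [| |exact (Cder_const a z)]; [intros u; symmetry; apply Hf|reflexivity].
- intros (g & Hg & Pg). apply (poly_succ n (RtoC (INR (S n)) * a)%C).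
  eapply poly_ext; [| |exact Pg]; [|reflexivity]. intros z. exact (Cder_unique f z _ _ (Hg z) (Hd z)).
Qed.

Lemma poly_unique (n : nat) : forall a b f, poly n a f -> poly n b f -> a = b.
Proof.
induction n as [|n IH]; intros a b f.
- simpl. intros H1 H2. rewrite <- (H1 0%C). apply H2.
- intros (g & Hg & Pg) (h & Hh & Ph).
  assert (E : (RtoC (INR (S n)) * a = RtoC (INR (S n)) * b)%C).
  { apply (IH _ _ g Pg). eapply poly_ext; [| |exact Ph]; [|reflexivity].
    intros z. exact (Cder_unique f z _ _ (Hh z) (Hg z)). }
  pose proof (INR_S_neq_0 n) as Hn.
  replace a with (/ RtoC (INR (S n)) * (RtoC (INR (S n)) * a))%C by (field; exact Hn).
  rewrite E. field. exact Hn.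
Qed.

Lemma poly_null (n : nat) (a : C) (f : C -> C) : poly n a f -> (forall z, f z = 0%C) -> a = 0%C.
Proof.
intros Hf H0. apply (poly_unique n a 0%C f Hf).
eapply poly_ext; [| |exact (poly_zero n)]; [|reflexivity]. intros z. symmetry. apply H0.
Qed.

Lemma poly_pred (n : nat) : forall f, poly (S n) 0%C f -> exists b, poly n b f.
Proof.
induction n as [|n IH]; intros f (g & Hg & Pg).
- exists (f 0%C). simpl in Pg |- *. apply zero_derivative. intros z.
  eapply Cder_ext; [| |exact (Hg z)]; [reflexivity|]. rewrite Pg. ring.
- destruct (IH g) as [b Hb].
  { eapply poly_ext; [| |exact Pg]; [reflexivity|ring]. }
  exists (/ RtoC (INR (S n)) * b)%C. exists g. split; [exact Hg|].
  eapply poly_ext; [| |exact Hb]; [reflexivity|]. field. apply INR_S_neq_0.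
Qed.

Lemma poly_degree (n : nat) : forall a f, poly n a f ->
  (forall z, f z = 0%C) \/ exists (m : nat) (b : C), b <> 0%C /\ poly m b f.
Proof.
induction n as [|n IH]; intros a f Hf.
- destruct (Ceq_dec a 0%C) as [->|Ha]; [left; exact Hf|right; exists O; exists a; split; assumption].
- destruct (Ceq_dec a 0%C) as [->|Ha].
  + destruct (poly_pred n f Hf) as [b Hb]. exact (IH b f Hb).
  + right. exists (S n); exists a. split; assumption.
Qed.

Lemma poly_monomial (n : nat) : poly n 1%C (fun z => z ^ n)%C.
Proof.
induction n as [|n IH].
- intros z. reflexivity.
- exists (fun z => RtoC (INR (S n)) * z ^ n)%C. split.
  + intros z. exact (Cder_pow n z).
  + exact (poly_scal n _ _ _ IH).
Qed.

Lemma ispoly_plus (f g : C -> C) : ispoly f -> ispoly g -> ispoly (fun z => f z + g z)%C.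
Proof.
intros (n & a & Hf) (m & b & Hg). exists (m + S n)%nat.
pose proof (poly_raise n m a f Hf) as H1. pose proof (poly_raise m n b g Hg) as H2.
replace (n + S m)%nat with (m + S n)%nat in H2 by lia.
eexists. exact (poly_plus _ _ _ _ _ H1 H2).
Qed.

Lemma ispoly_mult (f g : C -> C) : ispoly f -> ispoly g -> ispoly (fun z => f z * g z)%C.
Proof.
intros (n & a & Hf) (m & b & Hg). exists (n + m)%nat, (a * b)%C.
exact (poly_mult (n + m) n m eq_refl a b f g Hf Hg).
Qed.

Lemma ispoly_const (c : C) : ispoly (fun _ => c).
Proof. exists O, c. intros z; reflexivity. Qed.

Lemma ispoly_opp (f : C -> C) : ispoly f -> ispoly (fun z => - f z)%C.
Proof.
intros (n & a & H). exists n, (- (1) * a)%C.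
eapply poly_ext; [| |exact (poly_scal n (-(1))%C a f H)]; [|reflexivity]. intros z. cbv beta. ring.
Qed.

Lemma ispoly_shift (c : C) (f : C -> C) : ispoly f -> ispoly (fun z => f (z + c)%C).
Proof. intros (n & a & H). exists n, a. exact (poly_shift n c a f H). Qed.

Lemma ispoly_csum (a : nat -> C) (N : nat) : ispoly (fun z => csum (fun n => a n * z ^ n)%C N).
Proof.
induction N as [|N IH].
- exact (ispoly_const 0%C).
- assert (HN : ispoly (fun z => z ^ N)%C) by (exists N, (RtoC 1); exact (poly_monomial N)).
  exact (ispoly_plus _ _ IH (ispoly_mult _ _ (ispoly_const (a N)) HN)).
Qed.

Lemma ispoly_ext (f g : C -> C) : (forall z, f z = g z) -> ispoly f -> ispoly g.
Proof. intros H (n & a & Hf). exists n, a. exact (poly_ext n a a f g H eq_refl Hf). Qed.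

Lemma ispoly_centire (f : C -> C) : ispoly f -> centire f.
Proof.
intros (n & a & Hf). pose proof (poly_succ n a f Hf) as (g & Hg & _).
intros z. exists (g z). apply Hg.
Qed.

Lemma ispoly_derivative (f f' : C -> C) : (forall z, Cder f z (f' z)) -> ispoly f -> ispoly f'.
Proof. intros Hd (n & a & Hf). exists n, 0%C. exact (poly_derivative n a f f' Hd Hf). Qed.

Definition constant (f : C -> C) : Prop := forall z, f z = f 0%C.

(** If [Q] and [D'] are nonzero then [Q * D'] has degree at least that of [Q], hence
    greater than that of [Q'], and cannot be its opposite. *)
Lemma poly_ode (Q D Q' D' : C -> C) : ispoly Q -> ispoly D ->
  (forall z, Cder Q z (Q' z)) -> (forall z, Cder D z (D' z)) -> ~ constant D ->
  (forall z, Q' z + Q z * D' z = 0)%C -> forall z, Q z = 0%C.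
Proof.
intros (n & a & HQ) HD DQ DD Hnc Hode.
destruct (poly_degree n a Q HQ) as [H0|(n' & a' & Ha & HQ')]; [exact H0|exfalso].
destruct (ispoly_derivative D D' DD HD) as (m & b & HDp).
destruct (poly_degree m b D' HDp) as [H0|(m' & b' & Hb & HD')].
- apply Hnc. intros z. apply zero_derivative. intros u. rewrite <- (H0 u). apply DD.
- pose proof (poly_mult _ n' m' eq_refl _ _ _ _ HQ' HD') as Hprod.
  pose proof (poly_derivative n' a' Q Q' DQ HQ') as Hder.
  assert (Hder' : poly (n' + m') 0%C Q').
  { destruct m' as [|m'].
    - rewrite Nat.add_0_r. exact Hder.
    - pose proof (poly_raise n' m' 0%C Q' Hder) as H. replace (n' + S m')%nat with (m' + S n')%nat by lia. exact H. }
  pose proof (poly_null _ _ _ (poly_plus _ _ _ _ _ Hder' Hprod) Hode) as E.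
  replace (0 + a' * b')%C with (a' * b')%C in E by ring.
  exact (Cmult_neq_0 a' b' Ha Hb E).
Qed.

(** * Linear independence of exponentials of polynomials *)

(** Total, so that [twist] can be mapped over a list without carrying proofs. *)
Definition deriv (f : C -> C) (z : C) : C := epsilon (inhabits (RtoC 0)) (fun l => Cder f z l).

Lemma deriv_correct (f : C -> C) (z : C) : centire f -> Cder f z (deriv f z).
Proof. intros Hf. unfold deriv. apply epsilon_spec, Hf. Qed.

Fixpoint exp_sum (l : list ((C -> C) * (C -> C))) (z : C) : C :=
  match l with
  | nil => 0%C
  | (Q, P) :: l' => (Q z * Cexp (P z) + exp_sum l' z)%C
  end.

(** The effect on a term [Q * Cexp P] of the operator that sends [g] to
    [g' - P1' * g]. It lowers the degree of the factor of [Cexp P1] and preserves the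
    exponents. *)
Definition twist (P1 : C -> C) (t : (C -> C) * (C -> C)) : (C -> C) * (C -> C) :=
  (fun z => (deriv (fst t) z + fst t z * (deriv (snd t) z - deriv P1 z))%C, snd t).

Definition poly_term (t : (C -> C) * (C -> C)) : Prop := ispoly (fst t) /\ ispoly (snd t).

Lemma poly_deriv_spec (f : C -> C) : ispoly f -> ispoly (deriv f) /\ forall z, Cder f z (deriv f z).
Proof.
intros Hf. assert (H : forall z, Cder f z (deriv f z)) by (intros z; apply deriv_correct, ispoly_centire, Hf).
split; [exact (ispoly_derivative f _ H Hf)|exact H].
Qed.

Lemma twist_poly_term (P1 : C -> C) (t : (C -> C) * (C -> C)) :
  ispoly P1 -> poly_term t -> poly_term (twist P1 t).
Proof.
intros H1 [HQ HP]. split; [|exact HP].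
destruct (poly_deriv_spec _ H1) as [D1 _]. destruct (poly_deriv_spec _ HQ) as [DQ _].
destruct (poly_deriv_spec _ HP) as [DP _].
apply (ispoly_plus _ _ DQ). apply (ispoly_mult _ _ HQ). exact (ispoly_plus _ _ DP (ispoly_opp _ D1)).
Qed.

Lemma Cder_exp_sum (P1 : C -> C) (l : list ((C -> C) * (C -> C))) (z : C) :
  (forall t, In t l -> poly_term t) ->
  Cder (exp_sum l) z (exp_sum (map (twist P1) l) z + deriv P1 z * exp_sum l z)%C.
Proof.
induction l as [|[Q P] l IH]; intros Hl.
- eapply Cder_ext; [| |exact (Cder_const 0%C z)]; [reflexivity|]. simpl. ring.
- destruct (Hl (Q, P) (or_introl eq_refl)) as [HQ HP]. simpl in HQ, HP.
  destruct (poly_deriv_spec Q HQ) as [_ DQ]. destruct (poly_deriv_spec P HP) as [_ DP].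
  specialize (IH (fun t Ht => Hl t (or_intror Ht))).
  eapply Cder_ext; [| |exact (Cder_plus _ _ z _ _
     (Cder_mult _ _ z _ _ (DQ z) (Cder_comp Cexp P z _ _ (Cder_Cexp _) (DP z))) IH)].
  + intros u. reflexivity.
  + simpl. ring.
Qed.

(** A form of Borel's lemma. Applying the operator of [twist] for the exponent [P1] of
    another term often enough removes that term. The distinguished factor [Q] becomes
    [Q' + Q * (P - P1)'] each time, which by [poly_ode] vanishes only if [Q] does, because
    [P - P1] is not constant. The other terms may merge or cancel along the way. *)
Lemma exp_independence (n : nat) : forall l, length l = n ->
  (forall t, In t l -> poly_term t) ->
  forall Q P, ispoly Q -> ispoly P ->
  (forall t, In t l -> ~ constant (fun z => P z - snd t z)%C) ->
  (forall z, exp_sum ((Q, P) :: l) z = 0%C) -> forall z, Q z = 0%C.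
Proof.
induction n as [|n IHn].
{ intros l Hl _ Q P _ _ _ H z. destruct l; [|discriminate]. specialize (H z). simpl in H.
  replace (Q z * Cexp (P z) + 0)%C with (Q z * Cexp (P z))%C in H by ring.
  destruct (Ceq_dec (Q z) 0%C) as [E|E]; [exact E|].
  destruct (Cmult_neq_0 _ _ E (Cexp_neq_0 (P z)) H). }
(* The degree bound [N] of the factor of the term to be removed decreases with each application of the operator. *)
assert (Hinner : forall N R1 a P1 l, poly N a R1 -> ispoly P1 -> length l = n ->
  (forall t, In t l -> poly_term t) ->
  forall Q P, ispoly Q -> ispoly P ->
  ~ constant (fun z => P z - P1 z)%C ->
  (forall t, In t l -> ~ constant (fun z => P z - snd t z)%C) ->
  (forall z, exp_sum ((Q, P) :: (R1, P1) :: l) z = 0%C) -> forall z, Q z = 0%C).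
{ induction N as [|N IHN]; intros R1 a P1 l HR HP1 Hlen Hl Q P HQ HP Hnc1 Hnc Hsum;
  set (T := twist P1 (Q, P)).
  all: assert (HT : poly_term T) by (apply twist_poly_term; [exact HP1|split; assumption]).
  all: assert (HR1 : ispoly R1) by (eexists; eexists; exact HR).
  all: assert (Hl' : forall t, In t ((Q, P) :: (R1, P1) :: l) -> poly_term t)
    by (intros t [<-|[<-|Ht]]; [split; assumption|split; assumption|exact (Hl t Ht)]).
  all: assert (HsumT : forall z, exp_sum (map (twist P1) ((Q, P) :: (R1, P1) :: l)) z = 0%C)
    by (intros z; pose proof (Cder_exp_sum P1 _ z Hl') as H1; rewrite Hsum in H1;
      assert (H2 : Cder (exp_sum ((Q, P) :: (R1, P1) :: l)) z 0%C)
        by (eapply Cder_ext; [| |exact (Cder_const 0%C z)]; [intros u; symmetry; apply Hsum|reflexivity]);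
      rewrite <- (Cder_unique _ z _ _ H1 H2); ring).
  all: assert (Hlm : forall t, In t (map (twist P1) l) -> poly_term t)
    by (intros t Ht; apply in_map_iff in Ht as (s & <- & Hs); apply twist_poly_term; [exact HP1|exact (Hl s Hs)]).
  all: assert (Hncm : forall t, In t (map (twist P1) l) -> ~ constant (fun z => P z - snd t z)%C)
    by (intros t Ht; apply in_map_iff in Ht as (s & <- & Hs); exact (Hnc s Hs)).
  all: destruct (poly_deriv_spec Q HQ) as [_ DQ]; destruct (poly_deriv_spec P HP) as [_ DP];
    destruct (poly_deriv_spec P1 HP1) as [_ DP1]; destruct (poly_deriv_spec R1 HR1) as [_ DR1].
  all: apply (poly_ode Q (fun z => P z - P1 z)%C (deriv Q) (fun z => deriv P z - deriv P1 z)%C HQ);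
    [exact (ispoly_plus _ _ HP (ispoly_opp _ HP1))|exact DQ
    |intros z; apply Cder_minus; [apply DP|apply DP1]|exact Hnc1|].
  - apply (IHn (map (twist P1) l) ltac:(rewrite length_map; exact Hlen) Hlm (fst T) P (proj1 HT) HP Hncm).
    intros z. rewrite <- (HsumT z). simpl.
    assert (E : deriv R1 z = 0%C).
    { apply (Cder_unique R1 z); [apply DR1|].
      eapply Cder_ext; [| |exact (Cder_const a z)]; [intros u; symmetry; apply HR|reflexivity]. }
    rewrite E. ring.
  - destruct HR as (g & Hg & Pg).
    apply (IHN g _ P1 (map (twist P1) l) Pg HP1 ltac:(rewrite length_map; exact Hlen) Hlm
      (fst T) P (proj1 HT) HP Hnc1 Hncm).
    intros z. rewrite <- (HsumT z). simpl. rewrite (Cder_unique R1 z _ _ (Hg z) (DR1 z)). ring. }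
intros l Hlen Hl Q P HQ HP Hnc Hsum.
destruct l as [|[R1 P1] l]; [discriminate|].
destruct (Hl (R1, P1) (or_introl eq_refl)) as [(N & a & HR) HP1].
apply (Hinner N R1 a P1 l HR HP1 ltac:(injection Hlen; auto) (fun t Ht => Hl t (or_intror Ht)) Q P HQ HP
  (Hnc (R1, P1) (or_introl eq_refl)) (fun t Ht => Hnc t (or_intror Ht)) Hsum).
Qed.

(** * The system of exponential equations *)

Lemma constant_plus (f g h : C -> C) : constant f -> constant g ->
  (forall z, h z = f z + g z)%C -> constant h.
Proof. intros Hf Hg H z. rewrite !H, (Hf z), (Hg z). reflexivity. Qed.

Lemma constant_opp (f h : C -> C) : constant f -> (forall z, h z = - f z)%C -> constant h.
Proof. intros Hf H z. rewrite !H, (Hf z). reflexivity. Qed.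

Lemma poly_nonconstant (n : nat) (a : C) (f : C -> C) : a <> 0%C -> poly (S n) a f -> ~ constant f.
Proof.
intros Ha Hf Hc. apply Ha.
assert (H0 : poly O (f 0%C) f) by (intros z; apply Hc).
apply (poly_unique (S n) a 0%C f Hf).
pose proof (poly_raise O n _ f H0) as H. replace (n + 1)%nat with (S n) in H by lia. exact H.
Qed.

(** The leading coefficient is doubled. *)
Lemma sum_shifts_nonconstant (P : C -> C) (a b : C) : ispoly P -> ~ constant P ->
  ~ constant (fun z => P (z + a) + P (z + b))%C.
Proof.
intros (n & c & HP) Hnc.
destruct (poly_degree n c P HP) as [H0|(m & d & Hd & Hm)].
- destruct Hnc. intros z. rewrite !H0. reflexivity.
- destruct m as [|m].
  + destruct Hnc. intros z. simpl in Hm. rewrite !Hm. reflexivity.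
  + apply (poly_nonconstant m (d + d)%C).
    * replace (d + d)%C with (RtoC 2 * d)%C by ring. apply Cmult_neq_0; [|exact Hd].
      intros H. apply RtoC_inj in H. lra.
    * exact (poly_plus _ _ _ _ _ (poly_shift _ a _ _ Hm) (poly_shift _ b _ _ Hm)).
Qed.

(** The contrapositive of [exp_independence] for constant factors, which is the form in
    which exponents get matched below. *)
Lemma exp_match (c : C) (P : C -> C) (l : list ((C -> C) * (C -> C))) :
  c <> 0%C -> ispoly P -> (forall t, In t l -> poly_term t) ->
  (forall z, exp_sum ((fun _ => c, P) :: l) z = 0%C) ->
  exists t, In t l /\ constant (fun z => P z - snd t z)%C.
Proof.
intros Hc HP Hl H. apply NNPP. intros Hn. apply Hc.
refine (exp_independence (length l) l eq_refl Hl (fun _ => c) P (ispoly_const c) HP _ H 0%C).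
intros t Ht Hct. apply Hn. exists t. split; assumption.
Qed.

Lemma exp_pair (P : C -> C) (c d : C) : ispoly P -> ~ constant P ->
  (forall z, c * Cexp (P z) + d * Cexp (- P z) = 0)%C -> c = 0%C /\ d = 0%C.
Proof.
intros HP Hnc H.
assert (Hc : c = 0%C).
{ destruct (Ceq_dec c 0%C) as [E|E]; [exact E|].
  destruct (exp_match c P ((fun _ => d, fun z => - P z)%C :: nil) E HP) as (t & [<-|[]] & Ht).
  - intros t [<-|[]]. split; [exact (ispoly_const d)|exact (ispoly_opp _ HP)].
  - intros z. etransitivity; [|exact (H z)]. simpl. ring.
  - simpl in Ht. destruct (sum_shifts_nonconstant P 0%C 0%C HP Hnc).
    intros z. specialize (Ht z). simpl in Ht.
    replace (P (z + 0) + P (z + 0))%C with (P z - - P z)%C by (replace (z + 0)%C with z by ring; ring).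
    rewrite Ht. replace (0 + 0)%C with (RtoC 0) by ring. ring. }
split; [exact Hc|].
specialize (H 0%C). rewrite Hc in H.
replace (0 * Cexp (P 0) + d * Cexp (- P 0))%C with (d * Cexp (- P 0))%C in H by ring.
destruct (Ceq_dec d 0%C) as [E|E]; [exact E|].
destruct (Cmult_neq_0 _ _ E (Cexp_neq_0 _) H).
Qed.

Lemma Ci_square : (Ci * Ci)%C = (- (1))%C.
Proof. apply injective_projections; unfold Ci, Cmult, Copp, RtoC; simpl; ring. Qed.

(** The equation [cosh A1 - cosh A = - i sinh B], cleared of denominators. *)
Definition cosine_difference (A1 A B : C -> C) : Prop := forall z,
  (Cexp (A1 z) + Cexp (- A1 z) - Cexp (A z) - Cexp (- A z) + Ci * Cexp (B z) - Ci * Cexp (- B z) = 0)%C.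

(** Let [A1] be the translate of [A]. Since [A1 + A], [2 * A] and [2 * A1] are nonconstant,
    if [A1 - A] were nonconstant too then both [A1] and [A] would have to be partners of
    [B] or [- B], and then [A1 - A] or [A1 + A] would be constant after all. So [A1 - A] is
    constant, and [B] has a partner among [A], [- A], [A1] and [- A1]. *)
Lemma cosine_difference_match (A B : C -> C) : ispoly A -> ispoly B -> ~ constant A -> ~ constant B ->
  cosine_difference (fun z => A (z + 1)%C) A B ->
  constant (fun z => A (z + 1) - A z)%C /\
  (constant (fun z => B z - A z)%C \/ constant (fun z => B z + A z)%C).
Proof.
intros HA HB HcA HcB H. set (A1 := fun z => A (z + 1)%C) in *.
assert (HA1 : ispoly A1) by exact (ispoly_shift 1%C A HA).
pose proof (ispoly_opp _ HA) as HA'. pose proof (ispoly_opp _ HA1) as HA1'. pose proof (ispoly_opp _ HB) as HB'.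
assert (S1 : ~ constant (fun z => A z + A z)%C).
{ intros Hc. apply (sum_shifts_nonconstant A 0%C 0%C HA HcA). intros z.
  replace (z + 0)%C with z by ring. replace (0 + 0)%C with (RtoC 0) by ring. apply Hc. }
assert (S2 : ~ constant (fun z => A1 z + A1 z)%C) by exact (sum_shifts_nonconstant A 1%C 1%C HA HcA).
assert (S3 : ~ constant (fun z => A1 z + A z)%C).
{ intros Hc. apply (sum_shifts_nonconstant A 1%C 0%C HA HcA). intros z.
  replace (z + 0)%C with z by ring. replace (0 + 0)%C with (RtoC 0) by ring. apply Hc. }
assert (N1 : RtoC 1 <> 0%C) by (intros E; apply RtoC_inj in E; lra).
assert (Ni : Ci <> 0%C) by exact Ci_nz.
set (k := fun c : C => fun _ : C => c).
assert (Hpt : forall c P, ispoly P -> poly_term (k c, P)) by (intros c P HP; split; [exact (ispoly_const c)|exact HP]).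
assert (M1 : constant (fun z => A1 z - A z)%C \/ constant (fun z => A1 z - B z)%C \/ constant (fun z => A1 z + B z)%C).
{ destruct (exp_match 1%C A1 ((k 1%C, fun z => - A1 z)%C :: (k (- (1))%C, A) :: (k (- (1))%C, fun z => - A z)%C ::
     (k Ci, B) :: (k (- Ci)%C, fun z => - B z)%C :: nil) N1 HA1) as (t & Ht & Hc).
  - intros t [<-|[<-|[<-|[<-|[<-|[]]]]]]; apply Hpt; assumption.
  - intros z. etransitivity; [|exact (H z)]. unfold k. simpl. ring.
  - destruct Ht as [<-|[<-|[<-|[<-|[<-|[]]]]]]; simpl in Hc.
    + destruct S2. intros z. specialize (Hc z). cbv beta in Hc.
      replace (A1 z + A1 z)%C with (A1 z - - A1 z)%C by ring. rewrite Hc. ring.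
    + left; exact Hc.
    + destruct S3. intros z. specialize (Hc z). cbv beta in Hc.
      replace (A1 z + A z)%C with (A1 z - - A z)%C by ring. rewrite Hc. ring.
    + right; left; exact Hc.
    + right; right. intros z. specialize (Hc z). cbv beta in Hc.
      replace (A1 z + B z)%C with (A1 z - - B z)%C by ring. rewrite Hc. ring. }
assert (M2 : constant (fun z => A1 z - A z)%C \/ constant (fun z => A z - B z)%C \/ constant (fun z => A z + B z)%C).
{ destruct (exp_match (- (1))%C A ((k 1%C, A1) :: (k 1%C, fun z => - A1 z)%C :: (k (- (1))%C, fun z => - A z)%C ::
     (k Ci, B) :: (k (- Ci)%C, fun z => - B z)%C :: nil)) as (t & Ht & Hc).
  - intros E. apply N1. replace (RtoC 1) with (- - (1))%C by ring. rewrite E. ring.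
  - exact HA.
  - intros t [<-|[<-|[<-|[<-|[<-|[]]]]]]; apply Hpt; assumption.
  - intros z. etransitivity; [|exact (H z)]. unfold k. simpl. ring.
  - destruct Ht as [<-|[<-|[<-|[<-|[<-|[]]]]]]; simpl in Hc.
    + left. apply (constant_opp _ _ Hc). intros z. ring.
    + destruct S3. intros z. specialize (Hc z). cbv beta in Hc.
      replace (A1 z + A z)%C with (A z - - A1 z)%C by ring. rewrite Hc. ring.
    + destruct S1. intros z. specialize (Hc z). cbv beta in Hc.
      replace (A z + A z)%C with (A z - - A z)%C by ring. rewrite Hc. ring.
    + right; left; exact Hc.
    + right; right. intros z. specialize (Hc z). cbv beta in Hc.
      replace (A z + B z)%C with (A z - - B z)%C by ring. rewrite Hc. ring. }
(* Two partners of the same sign for [A1] and [A] make [A1 - A] constant, opposite signs make [A1 + A] constant. *)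
assert (K : constant (fun z => A1 z - A z)%C).
{ destruct M1 as [M1|[M1|M1]]; [exact M1| |]; (destruct M2 as [M2|[M2|M2]]; [exact M2| |]).
  - apply (constant_plus _ (fun z => - (A z - B z))%C _ M1); [|intros z; ring].
    apply (constant_opp _ _ M2). reflexivity.
  - destruct S3. apply (constant_plus _ _ _ M1 M2). intros z; ring.
  - destruct S3. apply (constant_plus _ _ _ M1 M2). intros z; ring.
  - apply (constant_plus _ (fun z => - (A z + B z))%C _ M1); [|intros z; ring].
    apply (constant_opp _ _ M2). reflexivity. }
split; [exact K|].
destruct (exp_match Ci B ((k 1%C, A1) :: (k 1%C, fun z => - A1 z)%C :: (k (- (1))%C, A) :: (k (- (1))%C, fun z => - A z)%C ::
     (k (- Ci)%C, fun z => - B z)%C :: nil) Ni HB) as (t & Ht & Hc).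
- intros t [<-|[<-|[<-|[<-|[<-|[]]]]]]; apply Hpt; assumption.
- intros z. etransitivity; [|exact (H z)]. unfold k. simpl. ring.
- destruct Ht as [<-|[<-|[<-|[<-|[<-|[]]]]]]; simpl in Hc.
  + left. apply (constant_plus _ _ _ Hc K). intros z; ring.
  + right. apply (constant_plus _ (fun z => - (A1 z - A z))%C _ Hc); [|intros z; ring].
    apply (constant_opp _ _ K). reflexivity.
  + left. exact Hc.
  + right. apply (constant_plus _ (fun _ => 0%C) _ Hc); [intros z; reflexivity|intros z; ring].
  + destruct (sum_shifts_nonconstant B 0%C 0%C HB HcB). intros z.
    replace (z + 0)%C with z by ring. replace (0 + 0)%C with (RtoC 0) by ring.
    specialize (Hc z). cbv beta in Hc.
    replace (B z + B z)%C with (B z - - B z)%C by ring. rewrite Hc. ring.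
Qed.

(** If neither exponent is constant, [B] is [A] or [- A] up to a constant, and both
    equations become relations between [Cexp A] and [Cexp (- A)] with constant coefficients,
    all of which vanish. With [x] and [y] the exponentials of the two additive constants,
    the resulting equations for [x], [y] and their inverses are inconsistent. *)
Lemma exponential_system (A B : C -> C) : ispoly A -> ispoly B ->
  cosine_difference (fun z => A (z + 1)%C) A B ->
  cosine_difference (fun z => B (z + 1)%C) B A ->
  constant A \/ constant B.
Proof.
intros HA HB H1 H2. apply NNPP. intros Hn.
assert (HcA : ~ constant A) by (intros Hc; apply Hn; left; exact Hc).
assert (HcB : ~ constant B) by (intros Hc; apply Hn; right; exact Hc).
destruct (cosine_difference_match A B HA HB HcA HcB H1) as [Ka Kb].
set (al := (A (0 + 1) - A 0)%C).
assert (EA : forall z, A (z + 1)%C = (A z + al)%C).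
{ intros z. unfold al. rewrite <- (Ka z). ring. }
set (x := Cexp al). set (x' := Cexp (- al)%C).
assert (Hx : (x' * x = 1)%C) by apply Cexp_opp_l.
destruct Kb as [Kb|Kb].
(* Here [B = A + be]; the relations force [y ^ 2 = 1] and then [2 = 1]. *)
- set (be := (B 0 - A 0)%C).
  assert (EB : forall z, B z = (A z + be)%C) by (intros z; unfold be; rewrite <- (Kb z); ring).
  set (y := Cexp be). set (y' := Cexp (- be)%C).
  assert (Hy : (y' * y = 1)%C) by apply Cexp_opp_l.
  assert (Q1 : (x - 1 + Ci * y = 0)%C /\ (x' - 1 - Ci * y' = 0)%C).
  { apply (exp_pair A _ _ HA HcA). intros z. etransitivity; [|exact (H1 z)]. cbv beta.
    rewrite EA, EB, !Copp_plus_distr, !Cexp_plus. fold x x' y y'. ring. }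
  assert (Q2 : (x * y - y + Ci = 0)%C /\ (x' * y' - y' - Ci = 0)%C).
  { apply (exp_pair A _ _ HA HcA). intros z. etransitivity; [|exact (H2 z)]. cbv beta.
    rewrite !EB, EA, !Copp_plus_distr, !Cexp_plus. fold x x' y y'. ring. }
  destruct Q1 as [Q1 Q1']. destruct Q2 as [Q2 _].
  assert (Ex : x = (1 - Ci * y)%C) by (replace x with ((x - 1 + Ci * y) + (1 - Ci * y))%C by ring; rewrite Q1; ring).
  assert (Ex' : x' = (1 + Ci * y')%C) by (replace x' with ((x' - 1 - Ci * y') + (1 + Ci * y'))%C by ring; rewrite Q1'; ring).
  rewrite Ex, Ex' in Hx. rewrite Ex in Q2.
  assert (Hyy : (y * y = 1)%C).
  { replace (y * y)%C with (1 + Ci * ((1 - Ci * y) * y - y + Ci) + (Ci * Ci + 1) * (y * y - 1))%C by ring.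
    rewrite Q2, Ci_square. ring. }
  assert (Eyy : y' = y).
  { replace y' with (y' * (y * y))%C by (rewrite Hyy; ring). rewrite Cmult_assoc, Hy. ring. }
  rewrite Eyy in Hx.
  assert (F : (RtoC 2 = 1)%C).
  { rewrite <- Hx. replace ((1 + Ci * y) * (1 - Ci * y))%C with (1 - Ci * Ci * (y * y))%C by ring.
    rewrite Hyy, Ci_square. rewrite <- RtoC_opp, <- !RtoC_mult, <- RtoC_minus. f_equal. ring. }
  apply RtoC_inj in F. lra.
(* Here [B = - A + be]; the relations force [y' ^ 2 = -1] and then [4 = 1]. *)
- set (be := (B 0 + A 0)%C).
  assert (EB : forall z, B z = (- A z + be)%C) by (intros z; unfold be; rewrite <- (Kb z); ring).
  set (y := Cexp be). set (y' := Cexp (- be)%C).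
  assert (Hy : (y' * y = 1)%C) by apply Cexp_opp_l.
  assert (EoB : forall z, (- B z = A z + - be)%C) by (intros z; rewrite EB; ring).
  assert (Q1 : (x - 1 - Ci * y' = 0)%C /\ (x' - 1 + Ci * y = 0)%C).
  { apply (exp_pair A _ _ HA HcA). intros z. etransitivity; [|exact (H1 z)]. cbv beta.
    rewrite EoB, EA, EB, !Copp_plus_distr, !Cexp_plus. fold x x' y y'. ring. }
  assert (Q2 : (x * y' - y' + Ci = 0)%C /\ (x' * y - y - Ci = 0)%C).
  { apply (exp_pair A _ _ HA HcA). intros z. etransitivity; [|exact (H2 z)]. cbv beta.
    rewrite !EoB, !EB, EA, !Copp_plus_distr, !Cexp_plus. fold x x' y y'. ring. }
  destruct Q1 as [Q1 Q1']. destruct Q2 as [Q2 _].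
  assert (Ex : x = (1 + Ci * y')%C) by (replace x with ((x - 1 - Ci * y') + (1 + Ci * y'))%C by ring; rewrite Q1; ring).
  assert (Ex' : x' = (1 - Ci * y)%C) by (replace x' with ((x' - 1 + Ci * y) + (1 - Ci * y))%C by ring; rewrite Q1'; ring).
  rewrite Ex, Ex' in Hx. rewrite Ex in Q2.
  assert (Hyy : (y' * y' = - (1))%C).
  { replace (y' * y')%C with (- (1) - Ci * ((1 + Ci * y') * y' - y' + Ci) + (Ci * Ci + 1) * (y' * y' + 1))%C by ring.
    rewrite Q2, Ci_square. ring. }
  assert (Eyy : y = (- y')%C).
  { replace y with (- (- (1)) * y)%C by ring. rewrite <- Hyy. replace (- (y' * y') * y)%C with (- (y' * (y' * y)))%C by ring.
    rewrite Hy. ring. }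
  rewrite Eyy in Hx.
  assert (F : (Ci * (2 * y') = - (1))%C).
  { replace (Ci * (2 * y'))%C with ((1 - Ci * - y') * (1 + Ci * y') - 1 - Ci * Ci * (y' * y'))%C by ring.
    rewrite Hx, Hyy, Ci_square. ring. }
  assert (F2 : (RtoC 4 = 1)%C).
  { replace (RtoC 1) with (- (1) * - (1))%C by ring. rewrite <- F.
    replace (Ci * (2 * y') * (Ci * (2 * y')))%C with (Ci * Ci * (RtoC 2 * RtoC 2) * (y' * y'))%C by ring.
    rewrite Hyy, Ci_square. rewrite <- !RtoC_opp, <- !RtoC_mult. f_equal. ring. }
  apply RtoC_inj in F2. lra.
Qed.

(** * The Fermat system on the complex line *)

Lemma exp_le (x y : R) : x <= y -> exp x <= exp y.
Proof. intros [H| ->]; [left; apply exp_increasing; exact H|right; reflexivity]. Qed.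

Lemma exp_le_inv (x y : R) : exp x <= exp y -> x <= y.
Proof. intros H. destruct (Rle_lt_dec x y) as [K|K]; [exact K|]. pose proof (exp_increasing _ _ K). lra. Qed.

(** The equation says that [F + i S] and [F - i S] are inverse to each other. So
    [F + i S] has an entire logarithm, whose real part grows polynomially. *)
Lemma fermat_parametrization (F S : C -> C) (A : R) (k : nat) : centire F -> centire S -> 0 <= A ->
  (forall z, Cmod (F z) <= exp (A * (1 + Cmod z) ^ k)) ->
  (forall z, Cmod (S z) <= exp (A * (1 + Cmod z) ^ k)) ->
  (forall z, F z * F z + S z * S z = 1)%C ->
  exists L, ispoly L /\ forall z, (2 * F z = Cexp (L z) + Cexp (- L z))%C /\
    (2 * Ci * S z = Cexp (L z) - Cexp (- L z))%C.
Proof.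
intros HF HS HA GF GS H.
set (G := fun z => (F z + Ci * S z)%C).
assert (HG : centire G) by (apply centire_plus; [exact HF|apply centire_mult; [apply centire_const|exact HS]]).
assert (Hprod : forall z, (G z * (F z - Ci * S z) = 1)%C).
{ intros z. unfold G. rewrite <- (H z).
  replace ((F z + Ci * S z) * (F z - Ci * S z))%C with (F z * F z - Ci * Ci * (S z * S z))%C by ring.
  rewrite Ci_square. ring. }
assert (Hn : forall z, G z <> 0%C).
{ intros z E. specialize (Hprod z). rewrite E in Hprod.
  replace (0 * (F z - Ci * S z))%C with (RtoC 0) in Hprod by ring. apply RtoC_inj in Hprod. lra. }
destruct (entire_logarithm G HG Hn) as (L & HL & EL).
assert (Hpow : forall z, 1 <= (1 + Cmod z) ^ k).
{ intros z. apply pow_R1_Rle. pose proof (Cmod_ge_0 z). lra. }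
destruct (re_polynomial_growth L (1 + A) k HL ltac:(lra)) as [a Ha].
{ intros z. apply exp_le_inv. rewrite <- Cmod_Cexp, <- EL. unfold G.
  eapply Rle_trans; [apply Cmod_triangle|]. rewrite Cmod_mult, Cmod_Ci, Rmult_1_l.
  specialize (GF z). specialize (GS z). specialize (Hpow z).
  set (p := (1 + Cmod z) ^ k) in *.
  apply Rle_trans with (2 * exp (A * p)); [lra|].
  replace ((1 + A) * p) with (p + A * p) by ring. rewrite exp_plus.
  apply Rmult_le_compat_r; [apply Rlt_le, exp_pos|].
  pose proof (exp_ineq1_le p). lra. }
exists L. split.
- apply (ispoly_ext (fun z => csum (fun n => a n * z ^ n)%C (Datatypes.S k))); [intros z; symmetry; apply Ha|].
  apply ispoly_csum.
- intros z.
  assert (E1 : Cexp (- L z) = (F z - Ci * S z)%C).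
  { replace (Cexp (- L z)) with (Cexp (- L z) * (G z * (F z - Ci * S z)))%C by (rewrite Hprod; ring).
    rewrite EL, Cmult_assoc, Cexp_opp_l. ring. }
  rewrite E1, <- EL. unfold G. split; ring.
Qed.

Lemma square_one_constant (F : C -> C) : centire F -> (forall z, F z * F z = 1)%C -> constant F.
Proof.
intros HF H. destruct (functional_choice _ HF) as [F' HF'].
intros z. apply zero_derivative. intros u.
assert (E : (F' u * F u + F u * F' u = 0)%C).
{ apply (Cder_unique (fun z => F z * F z)%C u); [apply Cder_mult; apply HF'|].
  eapply Cder_ext; [| |exact (Cder_const 1%C u)]; [intros v; symmetry; apply H|reflexivity]. }
replace (RtoC 0) with (F' u); [apply HF'|].
replace (F' u) with ((F' u * F u + F u * F' u) * (/ 2 * F u) + F' u * (1 - F u * F u))%C by field.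
rewrite E, H. ring.
Qed.

(** [F1] and [F2] are hyperbolic cosines of polynomials that solve the system of
    [exponential_system], so one of them is constant; then its difference vanishes and the
    other function has square one. In either case [F2] is constant. *)
Lemma fermat_system_line (F1 F2 : C -> C) (A : R) (k : nat) : centire F1 -> centire F2 -> 0 <= A ->
  (forall z, Cmod (F1 z) <= exp (A * (1 + Cmod z) ^ k)) ->
  (forall z, Cmod (F2 z) <= exp (A * (1 + Cmod z) ^ k)) ->
  (forall z, F1 z * F1 z + (F2 (z + 1) - F2 z) * (F2 (z + 1) - F2 z) = 1)%C ->
  (forall z, F2 z * F2 z + (F1 (z + 1) - F1 z) * (F1 (z + 1) - F1 z) = 1)%C ->
  forall z, (F1 z * F1 z = 1)%C.
Proof.
intros H1 H2 HA G1 G2 E1 E2.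
assert (Hsh : forall F, centire F -> centire (fun z => F (z + 1) - F z)%C).
{ intros F HF z. destruct (HF z) as [a Ha]. destruct (HF (z + 1)%C) as [b Hb].
  eexists. apply Cder_minus; [|exact Ha].
  exact (Cder_comp F (fun u => u + 1)%C z _ _ Hb (Cder_plus _ _ _ _ _ (Cder_id z) (Cder_const 1%C z))). }
set (B := 1 + A * 2 ^ k).
pose proof (pow_lt 2 k ltac:(lra)) as H2k.
pose proof (pow_R1_Rle 2 k ltac:(lra)) as H2k1.
assert (HB : 0 <= B) by (unfold B; nra).
assert (Hg : forall F : C -> C, (forall z, Cmod (F z) <= exp (A * (1 + Cmod z) ^ k)) ->
   (forall z, Cmod (F z) <= exp (B * (1 + Cmod z) ^ k)) /\
   (forall z, Cmod (F (z + 1) - F z)%C <= exp (B * (1 + Cmod z) ^ k))).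
{ intros F GF.
  assert (Hb : forall z, A * (1 + Cmod z) ^ k <= A * (2 ^ k * (1 + Cmod z) ^ k) /\
     A * (1 + Cmod (z + 1)%C) ^ k <= A * (2 ^ k * (1 + Cmod z) ^ k) /\ 1 <= (1 + Cmod z) ^ k).
  { intros z. pose proof (Cmod_ge_0 z) as Hz.
    pose proof (pow_R1_Rle (1 + Cmod z) k ltac:(lra)) as Hp.
    split; [|split; [|exact Hp]]; (apply Rmult_le_compat_l; [exact HA|]).
    - nra.
    - rewrite <- Rpow_mult_distr. apply pow_incr. pose proof (Cmod_triangle z 1%C) as Ht.
      rewrite Cmod_1 in Ht. pose proof (Cmod_ge_0 (z + 1)%C). lra. }
  split; intros z; destruct (Hb z) as (B1 & B2 & B3).
  - eapply Rle_trans; [apply GF|]. apply exp_le. unfold B. lra.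
  - unfold Cminus. eapply Rle_trans; [apply Cmod_triangle|]. rewrite Cmod_opp.
    pose proof (GF z) as K1. pose proof (GF (z + 1)%C) as K2.
    pose proof (exp_le _ _ B1) as K3. pose proof (exp_le _ _ B2) as K4.
    set (p := (1 + Cmod z) ^ k) in *.
    replace (B * p) with (p + A * (2 ^ k * p)) by (unfold B; ring). rewrite exp_plus.
    pose proof (exp_ineq1_le p). pose proof (exp_pos (A * (2 ^ k * p))). nra. }
destruct (fermat_parametrization F1 (fun z => F2 (z + 1) - F2 z)%C B k H1 (Hsh _ H2) HB
  (proj1 (Hg _ G1)) (proj2 (Hg _ G2)) E1) as (L1 & P1 & R1).
destruct (fermat_parametrization F2 (fun z => F1 (z + 1) - F1 z)%C B k H2 (Hsh _ H1) HB
  (proj1 (Hg _ G2)) (proj2 (Hg _ G1)) E2) as (L2 & P2 & R2).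
assert (Q : forall (F : C -> C) (L M : C -> C),
   (forall z, 2 * F z = Cexp (L z) + Cexp (- L z))%C ->
   (forall z, 2 * Ci * (F (z + 1) - F z) = Cexp (M z) - Cexp (- M z))%C ->
   cosine_difference (fun z => L (z + 1)%C) L M).
{ intros F L M S1 S2 z.
  replace (Cexp (L (z + 1)) + Cexp (- L (z + 1)) - Cexp (L z) - Cexp (- L z) + Ci * Cexp (M z) - Ci * Cexp (- M z))%C
   with ((Cexp (L (z + 1)) + Cexp (- L (z + 1))) - (Cexp (L z) + Cexp (- L z)) + Ci * (Cexp (M z) - Cexp (- M z)))%C by ring.
  rewrite <- !S1, <- S2.
  replace (2 * F (z + 1) - 2 * F z + Ci * (2 * Ci * (F (z + 1) - F z)))%C with
    ((1 + Ci * Ci) * (2 * F (z + 1) - 2 * F z))%C by ring.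
  rewrite Ci_square. ring. }
assert (Hc : forall F L, (forall z, 2 * F z = Cexp (L z) + Cexp (- L z))%C -> constant L -> constant F).
{ intros F L S1 HL z.
  replace (F z) with (/ 2 * (2 * F z))%C by field.
  rewrite S1, (HL z), <- S1. field. }
assert (D0 : forall F, constant F -> forall z, (F (z + 1) - F z = 0)%C).
{ intros F HF z. rewrite (HF (z + 1)%C), (HF z). ring. }
assert (C2 : constant F2).
{ destruct (exponential_system L1 L2 P1 P2) as [K|K].
  - apply (Q F1); intros z; [apply R1|apply R2].
  - apply (Q F2); intros z; [apply R2|apply R1].
  - apply square_one_constant; [exact H2|]. intros z. rewrite <- (E2 z).
    rewrite (D0 F1 (Hc F1 L1 (fun z => proj1 (R1 z)) K)). ring.
  - exact (Hc F2 L2 (fun z => proj1 (R2 z)) K). }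
intros z. rewrite <- (E1 z), (D0 F2 C2). ring.
Qed.

(** * Entire functions on C^2 *)

Lemma entire_on_line (f : C * C -> C) (w c : C * C) : entire f ->
  centire (fun t => f (fst w + t * fst c, snd w + t * snd c)%C).
Proof.
intros Hf t. set (z := (fst w + t * fst c, snd w + t * snd c)%C).
destruct (Hf z) as [l Hl].
assert (Hg : @filterdiff C_AbsRing (AbsRing_NormedModule C_AbsRing) C2
   (fun s : C => ((fst w + s * fst c)%C, (snd w + s * snd c)%C)) (@locally (AbsRing_NormedModule C_AbsRing) t) (fun s : C_AbsRing => scal (s : C_AbsRing) (c : C2))).
{ apply (filterdiff_ext_lin _ (fun s : C_AbsRing => plus (zero : C2) (scal (s : C_AbsRing) (c : C2)))).
  - exact (filterdiff_plus_fct (V:=C2) (fun _ => w) (fun s : C_AbsRing => scal (s : C_AbsRing) (c : C2)) _ _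
      (filterdiff_const (V:=C2) w) (filterdiff_linear _ (is_linear_scal_l (V:=C2) c))).
  - intros s. apply plus_zero_l. }
pose proof (filterdiff_comp' (K:=C_AbsRing) (U:=AbsRing_NormedModule C_AbsRing) (V:=C2) (W:=C_NormedModule) _ f t _ l Hg Hl) as [[Hp Hs _] H].
assert (El : forall h : C, l (scal (h : C_AbsRing) (c : C2)) = (h * l c)%C).
{ intros h. exact (linear_scal _ (proj1 Hl) h (c : C2)). }
exists (l c). apply Cder_eps. intros eps.
destruct (H t (fun P HP => HP) eps) as [d Hd].
exists d. intros y Hy. specialize (Hd y Hy). rewrite El in Hd.
rewrite (Cmult_comm (l c)). exact Hd.
Qed.

Lemma entire_continuous (f : C * C -> C) (z : C * C) : entire f ->
  exists d : posreal, forall y : C * C,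
    Rabs (Re (fst y) - Re (fst z)) < d -> Rabs (Im (fst y) - Im (fst z)) < d ->
    Rabs (Re (snd y) - Re (snd z)) < d -> Rabs (Im (snd y) - Im (snd z)) < d ->
    Cmod (f y - f z)%C < 1.
Proof.
intros Hf.
pose proof (filterdiff_continuous (K:=C_AbsRing) (U:=C2) (V:=C_NormedModule) f z (Hf z)) as Hc.
assert (Hb : locally (T:=C_UniformSpace) (f z) (fun u => Cmod (u - f z)%C < 1)).
{ apply locally_C. exists (mkposreal 1 Rlt_0_1). intros y Hy. exact Hy. }
destruct (Hc _ Hb) as [d Hd]. exists d. intros y H1 H2 H3 H4.
apply (Hd y). repeat split; assumption.
Qed.

Lemma list_bound {T : Type} (g : T -> R) (l : list T) : exists M, forall t, In t l -> g t <= M.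
Proof.
induction l as [|a l [M HM]].
- exists 0. intros t [].
- exists (Rmax (g a) M). intros t [<-|Ht]; [apply Rmax_l|].
  eapply Rle_trans; [exact (HM t Ht)|apply Rmax_r].
Qed.

Lemma norm_C2_components (z : C * C) (r : R) : norm_C2 z <= r ->
  - r <= Re (fst z) <= r /\ - r <= Im (fst z) <= r /\ - r <= Re (snd z) <= r /\ - r <= Im (snd z) <= r.
Proof.
intros Hz.
assert (H1 : Cmod (fst z) <= r).
{ eapply Rle_trans; [|exact Hz]. unfold norm_C2.
  rewrite <- (sqrt_pow2 (Cmod (fst z))) at 1 by apply Cmod_ge_0.
  apply sqrt_le_1_alt. pose proof (pow2_ge_0 (Cmod (snd z))). lra. }
assert (H2 : Cmod (snd z) <= r).
{ eapply Rle_trans; [|exact Hz]. unfold norm_C2.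
  rewrite <- (sqrt_pow2 (Cmod (snd z))) at 1 by apply Cmod_ge_0.
  apply sqrt_le_1_alt. pose proof (pow2_ge_0 (Cmod (fst z))). lra. }
pose proof (Rmax_Cmod (fst z)) as M1. pose proof (Rmax_Cmod (snd z)) as M2.
pose proof (Rmax_l (Rabs (fst (fst z))) (Rabs (snd (fst z)))) as A1.
pose proof (Rmax_r (Rabs (fst (fst z))) (Rabs (snd (fst z)))) as A2.
pose proof (Rmax_l (Rabs (fst (snd z))) (Rabs (snd (snd z)))) as A3.
pose proof (Rmax_r (Rabs (fst (snd z))) (Rabs (snd (snd z)))) as A4.
unfold Re, Im. split; [|split; [|split]]; apply Rabs_le_between; lra.
Qed.

(** Finiteness of the supremum in [max_modulus] has to be known before it bounds [f],
    since [real] sends infinity to 0. *)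
Lemma entire_bounded_on_balls (f : C * C -> C) (r : R) : entire f ->
  exists M, forall z, norm_C2 z <= r -> Cmod (f z) <= M.
Proof.
intros Hf.
(* The ball lies in a compact box of R^4; a finite cover by boxes on which [f] varies by less than [1] bounds [f]. *)
set (pt := fun t : Compactness.Tn 4 R => let '(a, (b, (c, (d, _)))) := t in ((a, b), (c, d)) : C * C).
destruct (functional_choice _ (fun t => entire_continuous f (pt t) Hf)) as [delta Hdelta].
destruct (NNPP _ (compactness_list 4 (- r, (- r, (- r, (- r, tt)))) (r, (r, (r, (r, tt)))) delta)) as [l Hl].
destruct (list_bound (fun t => Cmod (f (pt t)) + 1) l) as [M HM].
exists M. intros z Hz.
destruct (norm_C2_components z r Hz) as (B1 & B2 & B3 & B4).
destruct (Hl (Re (fst z), (Im (fst z), (Re (snd z), (Im (snd z), tt))))) as (t & Ht & _ & Hc).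
{ simpl. tauto. }
eapply Rle_trans; [|exact (HM t Ht)].
assert (Hd : Cmod (f z - f (pt t))%C < 1).
{ destruct t as [t1 [t2 [t3 [t4 []]]]]. simpl in Hc. destruct Hc as (K1 & K2 & K3 & K4 & _).
  apply (Hdelta (t1, (t2, (t3, (t4, tt))))); assumption. }
pose proof (Cmod_minus_ge (f z) (f (pt t))). lra.
Qed.

Lemma max_modulus_ge (f : C * C -> C) (r : R) (z : C * C) : entire f -> norm_C2 z <= r ->
  Cmod (f z) <= max_modulus f r.
Proof.
intros Hf Hz. unfold max_modulus.
set (E := fun x : R => exists z : C * C, norm_C2 z <= r /\ x = Cmod (f z)).
destruct (Lub_Rbar_correct E) as [Hub Hlub].
destruct (entire_bounded_on_balls f r Hf) as [M HM].
assert (H1 : Rbar_le (Cmod (f z)) (Lub_Rbar E)) by (apply Hub; exists z; split; [exact Hz|reflexivity]).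
assert (H2 : Rbar_le (Lub_Rbar E) M).
{ apply Hlub. intros x (y & Hy & ->). apply HM, Hy. }
destruct (Lub_Rbar E) as [s| |]; simpl in *; [exact H1|contradiction|contradiction].
Qed.

Lemma log_plus_le (x T : R) : log_plus x <= T -> x <= exp T.
Proof.
intros H. destruct (Rle_lt_dec x 0) as [Hx|Hx].
- pose proof (exp_pos T). lra.
- rewrite <- (exp_ln x Hx). apply exp_le. eapply Rle_trans; [apply Rmax_r|exact H].
Qed.

(** A finite upper limit provides a radius beyond which [log log M(r)] is at most
    [S * ln r], that is, [M(r)] is at most the exponential of [r ^ S]. The exponent is left
    free above a threshold so that two functions can share it. *)
Lemma finite_order_growth (f : C * C -> C) : entire f -> finite_order f ->
  exists (k0 : nat) (r0 : R), 1 <= r0 /\ forall (k : nat) (r : R) z, (k0 <= k)%nat -> r0 <= r ->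
    norm_C2 z <= r -> Cmod (f z) <= exp (r ^ k).
Proof.
intros Hf Ho. unfold finite_order, order, LimSup_p_infty in Ho.
set (g := fun r => log_plus (log_plus (max_modulus f r)) / ln r).
set (E := fun s : Rbar => exists r0 : R, s = Lub_Rbar (fun y : R => exists r : R, r0 < r /\ y = g r)).
change (Rbar_lt (Rbar_glb E) p_infty) in Ho.
(* Otherwise the infimum defining the order would be infinite. *)
assert (Hfin : exists s, E s /\ Rbar_lt s p_infty).
{ apply NNPP. intros Hn.
  assert (Hglb : Rbar_is_glb E p_infty).
  { split.
    - intros s Hs. destruct s as [s| |]; [|exact I|].
      + destruct Hn. exists (Finite s). split; [exact Hs|exact I].
      + destruct Hn. exists m_infty. split; [exact Hs|exact I].
    - intros b _. destruct b; exact I. }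
  rewrite (Rbar_is_glb_unique _ _ Hglb) in Ho. exact Ho. }
destruct Hfin as (s & [r0 ->] & Hs).
set (Y := fun y : R => exists r : R, r0 < r /\ y = g r) in *.
destruct (Lub_Rbar_correct Y) as [Hub _].
assert (HS : exists S, forall r, r0 < r -> g r <= S).
{ destruct (Lub_Rbar Y) as [S| |] eqn:EY.
  - exists S. intros r Hr. apply (Hub (g r)). exists r. split; [exact Hr|reflexivity].
  - destruct Hs.
  - exists 0. intros r Hr. destruct (Hub (g r)). exists r. split; [exact Hr|reflexivity]. }
destruct HS as [S HS].
destruct (nfloor_ex (Rabs S) (Rabs_pos S)) as [k0 Hk0].
exists (Datatypes.S k0), (Rmax 2 (r0 + 1)). split; [eapply Rle_trans; [|apply Rmax_l]; lra|].
intros k r z Hk Hr Hz.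
pose proof (Rmax_l 2 (r0 + 1)) as M1. pose proof (Rmax_r 2 (r0 + 1)) as M2.
assert (Hr2 : 2 <= r) by lra. assert (Hrr : r0 < r) by lra.
assert (Hln : 0 < ln r) by (rewrite <- ln_1; apply ln_increasing; lra).
eapply Rle_trans; [exact (max_modulus_ge f r z Hf Hz)|].
apply log_plus_le.
rewrite <- (exp_ln (r ^ k)) by (apply pow_lt; lra).
apply log_plus_le. rewrite ln_pow by lra.
specialize (HS r Hrr). unfold g in HS.
assert (HSk : S <= INR k).
{ pose proof (Rle_abs S). apply le_INR in Hk. rewrite S_INR in Hk. lra. }
apply Rle_trans with (S * ln r); [|apply Rmult_le_compat_r; lra].
apply (Rmult_le_reg_r (/ ln r)); [apply Rinv_0_lt_compat; exact Hln|].
replace (S * ln r * / ln r) with S by (field; lra). exact HS.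
Qed.

Lemma norm_C2_le (z : C * C) : norm_C2 z <= Cmod (fst z) + Cmod (snd z).
Proof.
pose proof (Cmod_ge_0 (fst z)). pose proof (Cmod_ge_0 (snd z)).
unfold norm_C2. rewrite <- (sqrt_pow2 (Cmod (fst z) + Cmod (snd z))) by lra.
apply sqrt_le_1_alt. nra.
Qed.

Lemma growth_on_line (f1 f2 : C * C -> C) (w c : C * C) :
  entire f1 -> finite_order f1 -> entire f2 -> finite_order f2 ->
  exists (A : R) (k : nat), 0 <= A /\
   (forall t, Cmod (f1 (fst w + t * fst c, snd w + t * snd c)%C) <= exp (A * (1 + Cmod t) ^ k)) /\
   (forall t, Cmod (f2 (fst w + t * fst c, snd w + t * snd c)%C) <= exp (A * (1 + Cmod t) ^ k)).
Proof.
intros E1 O1 E2 O2.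
destruct (finite_order_growth f1 E1 O1) as (k1 & r1 & H1 & G1).
destruct (finite_order_growth f2 E2 O2) as (k2 & r2 & H2 & G2).
set (B := r1 + r2 + (Cmod (fst w) + Cmod (snd w)) + (Cmod (fst c) + Cmod (snd c))).
pose proof (Cmod_ge_0 (fst w)). pose proof (Cmod_ge_0 (snd w)).
pose proof (Cmod_ge_0 (fst c)). pose proof (Cmod_ge_0 (snd c)).
assert (HB : 0 <= B) by (unfold B; lra).
assert (HR : forall t, r1 <= B * (1 + Cmod t) /\ r2 <= B * (1 + Cmod t) /\
   norm_C2 (fst w + t * fst c, snd w + t * snd c)%C <= B * (1 + Cmod t)).
{ intros t. pose proof (Cmod_ge_0 t) as Ht.
  assert (HBt : 0 <= B * Cmod t) by (apply Rmult_le_pos; assumption).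
  split; [|split].
  - unfold B in *. nra.
  - unfold B in *. nra.
  - eapply Rle_trans; [apply norm_C2_le|]. simpl fst; simpl snd.
    pose proof (Cmod_triangle (fst w) (t * fst c)) as T1. pose proof (Cmod_triangle (snd w) (t * snd c)) as T2.
    rewrite Cmod_mult in T1, T2.
    assert (Cmod t * (Cmod (fst c) + Cmod (snd c)) <= Cmod t * B) by (apply Rmult_le_compat_l; unfold B; lra).
    unfold B in *. lra. }
exists (B ^ (k1 + k2)), (k1 + k2)%nat. split; [apply pow_le; exact HB|].
split; intros t; destruct (HR t) as (R1 & R2 & R3); rewrite <- Rpow_mult_distr.
- apply G1; [lia|exact R1|exact R3].
- apply G2; [lia|exact R2|exact R3].
Qed.

Lemma Csquare (z : C) : (z ^ 2 = z * z)%C.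
Proof. simpl. ring. Qed.

Theorem theorem1p1 (c : C * C) :
  ~ exists f1 f2 : C * C -> C,
      (transcendental_entire f1 /\ finite_order f1) /\
      (transcendental_entire f2 /\ finite_order f2) /\
      forall z : C * C,
        ((f1 z) ^ 2 + (Delta c f2 z) ^ 2 = 1)%C /\
        ((f2 z) ^ 2 + (Delta c f1 z) ^ 2 = 1)%C.
Proof.
intros (f1 & f2 & [[E1 N1] O1] & [[E2 _] O2] & H).
(* Restricted to the complex line through [w] in the direction of [c], the translation
   by [c] is the translation by 1 of the parameter. *)
assert (Hsq : forall w, (f1 w * f1 w = 1)%C).
{ intros w. destruct (growth_on_line f1 f2 w c E1 O1 E2 O2) as (A & k & HA & G1 & G2).
  assert (Hsh : forall t, (fst w + (t + 1) * fst c, snd w + (t + 1) * snd c)%C =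
     (fst (fst w + t * fst c, snd w + t * snd c) + fst c, snd (fst w + t * fst c, snd w + t * snd c) + snd c)%C).
  { intros t. simpl. f_equal; ring. }
  pose proof (fermat_system_line _ _ A k (entire_on_line f1 w c E1) (entire_on_line f2 w c E2) HA G1 G2) as K.
  cbv beta in K.
  assert (Ew : w = (fst w + 0 * fst c, snd w + 0 * snd c)%C).
  { destruct w as [w1 w2]. simpl. f_equal; ring. }
  rewrite Ew. apply K.
  - intros t. rewrite Hsh. destruct (H (fst w + t * fst c, snd w + t * snd c)%C) as [K1 _].
    rewrite !Csquare in K1. exact K1.
  - intros t. rewrite Hsh. destruct (H (fst w + t * fst c, snd w + t * snd c)%C) as [_ K2].
    rewrite !Csquare in K2. exact K2. }
apply N1. exists O, (fun _ _ => f1 (RtoC 0, RtoC 0)). intros z1 z2.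
rewrite !sum_O.
pose proof (square_one_constant _ (entire_on_line f1 (RtoC 0, RtoC 0) (z1, z2) E1) (fun t => Hsq _) 1%C) as K.
simpl in K.
replace (0 + 1 * z1)%C with z1 in K by ring. replace (0 + 1 * z2)%C with z2 in K by ring.
replace (0 + 0 * z1)%C with (RtoC 0) in K by ring. replace (0 + 0 * z2)%C with (RtoC 0) in K by ring.
rewrite K. simpl. ring.
Qed.
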